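(* Let $n\le 3$ and let $\Omega\subset\mathbb{R}^n$ be a bounded domain with smooth boundary, let $\tau>0$, $\beta>0$, $\gamma>0$ and $\alpha\in\mathbb{R}$, and suppose that $f\in C^3(\mathbb{R})$ satisfies $f(0)=0$ and is such that $$f''(\xi)\ge 0\quad\text{for all }\xi\in\mathbb{R},\qquad \frac{f(\xi)}{\xi}\to+\infty\quad\text{as }\xi\to+\infty,$$ and $$\int_{\xi_0}^\infty\frac{d\xi}{f(\xi)}<\infty\quad\text{for some }\xi_0>0.$$ Then for all $T_0>0$ there exists $K_0=K_0(T_0)>0$ such that if $u_0\in W^{4,2}(\Omega)\cap W_0^{1,2}(\Omega)$ satisfies $$\int_\Omega u_0e_1>K_0,$$ then there exists $K_1=K_1(u_0)>0$ such that whenever $u_1\in W^{2,2}(\Omega)\cap W_0^{1,2}(\Omega)$ satisfies $$\int_\Omega u_1e_1>K_1,$$ there exists $K_2=K_2(u_1)>0$ such that if $u_2\in W^{2,2}(\Omega)\cap W_0^{1,2}(\Omega)$ satisfies $$\int_\Omega u_2e_1>K_2,$$ then the corresponding maximal strong solution $u$ of the initial-boundary value problem $$\begin{cases}\tau u_{ttt}+\alpha u_{tt}=\beta\Delta u_t+\gamma\Delta u+(f(u))_{tt}, & x\in\Omega,\ t>0,\\ u=0, & x\in\partial\Omega,\ t>0,\\ u(x,0)=u_0(x),\ u_t(x,0)=u_1(x),\ u_{tt}(x,0)=u_2(x), & x\in\Omega,\end{cases}$$ blows up by time $T_0$, in the sense that its maximal existence time satisfies $T_{max}\le T_0$ and $$\limsup_{t\nearrow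 T_{max}}\|u(\cdot,t)\|_{L^\infty(\Omega)}=\infty.$$
   Context: $(e_i)_{i\ge1}\subset C^\infty(\overline{\Omega})$ denotes the system of Dirichlet eigenfunctions of $-\Delta$ in $\Omega$, i.e. $-\Delta e_i=\lambda_ie_i$ in $\Omega$, $e_i=0$ on $\partial\Omega$, normalized such that $\int_\Omega e_ie_j=\delta_{ij}$ for $i,j\in\mathbb{N}=\{1,2,3,\dots\}$ and such that $e_1>0$ in $\Omega$ (so $e_1$ is the principal eigenfunction). Strong solution: for $T\in(0,\infty]$, a function $u$ is called a strong solution of the initial-boundary value problem in $\Omega\times(0,T)$ if $u,u_t\in C^0([0,T);W_0^{1,2}(\Omega)\cap C^0(\overline{\Omega}))\cap L^\infty_{loc}([0,T);W^{2,2}(\Omega))$, $u_{tt}\in C^0([0,T);L^2(\Omega))\cap L^\infty_{loc}([0,T);W_0^{1,2}(\Omega))$ and $u_{ttt}\in L^\infty_{loc}([0,T);L^2(\Omega))$, if $u(\cdot,0)=u_0$, $u_t(\cdot,0)=u_1$ and $u_{tt}(\cdot,0)=u_2$, and if $$\tau u_{ttt}+\alpha u_{tt}=\beta\Delta u_t+\gamma\Delta u+f'(u)u_{tt}+f''(u)u_t^2\quad\text{a.e. in }\Omega\times(0,T).$$ Maximal strong solution: for $n\le3$, $f\in C^3(\mathbb{R})$ with $f(0)=0$, $u_0\in W^{4,2}(\Omega)\cap W_0^{1,2}(\Omega)$ and $u_1,u_2\in W^{2,2}(\Omega)\cap W_0^{1,2}(\Omega)$, another theorem of the paper provides $T_{max}\in(0,\infty]$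 and a uniquely determined strong solution $u$ in $\Omega\times(0,T_{max})$ with the property that if $T_{max}<\infty$ then $\limsup_{t\nearrow T_{max}}\|u(\cdot,t)\|_{L^\infty(\Omega)}=\infty$. This is the solution $u$, and the $T_{max}$, referred to in the claim. *)

(* Defs.v *)
From HB Require Import structures.
From mathcomp Require Import all_boot all_order all_algebra.
From mathcomp Require Import all_classical all_reals all_analysis.
Import numFieldNormedType.Exports.
Set Implicit Arguments.
Unset Strict Implicit.
Unset Printing Implicit Defensive.
Import Order.TTheory GRing.Theory Num.Theory.
Local Open Scope classical_set_scope.
Local Open Scope ring_scope.

Section measurable_rV.
Context {d : measure_display} {T : measurableType d}.
Variable n : nat.

Let coord : 'I_n -> 'rV[T]_n -> T := fun i x => x ord0 i.

Let rV_set0 : g_sigma_preimage coord set0.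
Proof. exact: sigma_algebra0. Qed.

Let rV_setC A : g_sigma_preimage coord A -> g_sigma_preimage coord (~` A).
Proof. exact: sigma_algebraC. Qed.

Let rV_bigcup (F : _^nat) : (forall i, g_sigma_preimage coord (F i)) ->
  g_sigma_preimage coord (\bigcup_i (F i)).
Proof. exact: sigma_algebra_bigcup. Qed.

(* On 'rV[R]_n this is the Borel sigma-algebra. *)
HB.instance Definition _ := @isMeasurable.Build (measure_tuple_display d)
  'rV[T]_n (g_sigma_preimage coord) rV_set0 rV_setC rV_bigcup.

Lemma measurable_coord (i : 'I_n) :
  measurable_fun [set: 'rV[T]_n] (fun x : 'rV[T]_n => x ord0 i).
Proof.
move=> _ A mA; apply: sub_sigma_algebra.
by rewrite (bigD1 i)//=; left; exists A.
Qed.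

Lemma measurable_fun_rV d' (S : measurableType d') (f : S -> 'rV[T]_n) :
  (forall i, measurable_fun [set: S] (fun s => f s ord0 i)) ->
  measurable_fun [set: S] f.
Proof.
move=> mf; apply: (measurability (\big[setU/set0]_(i < n)
  preimage_set_system setT (coord i) measurable)) => //.
move=> _ [A + <-]; rewrite -bigcup_pred => -[i _ [B mB <-]].
by rewrite setTI; exact: (mf i).
Qed.

End measurable_rV.

Section lebesgue_rV.
Context {R : realType}.

Definition cons_rV n (p : measurableTypeR R * 'rV[R]_n) : 'rV[R]_n.+1 :=
  row_mx (const_mx p.1 : 'rV[R]_1) p.2.

Lemma measurable_cons_rV n : measurable_fun [set: measurableTypeR R * 'rV[R]_n] (@cons_rV n).
Proof.
apply: measurable_fun_rV => i; rewrite /cons_rV.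
case: (split_ordP (i : 'I_(1 + n))) => j ->.
  rewrite [X in measurable_fun _ X](_ : _ = @fst (measurableTypeR R) 'rV[R]_n); first exact: measurable_fst.
  by apply/funext => p; rewrite [LHS]row_mxEl mxE.
rewrite [X in measurable_fun _ X](_ : _ = (fun x : 'rV[R]_n => x ord0 j) \o snd).
  exact: (measurableT_comp (measurable_coord j) measurable_snd).
by apply/funext => p; rewrite [LHS]row_mxEr.
Qed.

Lemma measurable_behead_rV n :
  measurable_fun [set: 'rV[R]_n.+1]
    (fun v => (v ord0 ord0 : measurableTypeR R, @rsubmx R 1 1 n v)).
Proof.
apply/measurable_fun_pairP; split; first exact: measurable_coord.
apply: measurable_fun_rV => i /=.
rewrite [X in measurable_fun _ X](_ : _ = fun v : 'rV[R]_n.+1 => v ord0 (rshift 1 i)).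
  exact: (@measurable_coord _ R n.+1 (rshift 1 i)).
by apply/funext => v; rewrite mxE.
Qed.

Lemma cons_rVK n (p : measurableTypeR R * 'rV[R]_n) :
  (cons_rV p ord0 ord0, @rsubmx R 1 1 n (cons_rV p)) = p.
Proof.
case: p => t x; rewrite /cons_rV row_mxKr; congr pair.
have -> : ord0 = lshift n ord0 :> 'I_(1 + n) by exact/val_inj.
by rewrite [LHS]row_mxEl mxE.
Qed.

Definition lebesgue_cons n (m : {sigma_finite_measure set 'rV[R]_n -> \bar R})
  : set 'rV[R]_n.+1 -> \bar R :=
  pushforward (@lebesgue_measure R \x m)%E (@cons_rV n).

Section lebesgue_cons_measure.
Variables (n : nat) (m : {sigma_finite_measure set 'rV[R]_n -> \bar R}).

Let lebesgue_cons0 : lebesgue_cons m set0 = 0%E.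
Proof. by rewrite /lebesgue_cons /pushforward preimage_set0 measure0. Qed.

Let lebesgue_cons_ge0 A : (0 <= lebesgue_cons m A)%E.
Proof. by rewrite /lebesgue_cons /pushforward; exact: measure_ge0. Qed.

Let lebesgue_cons_sigma_additive : semi_sigma_additive (lebesgue_cons m).
Proof.
move=> F mF tF mUF; rewrite /lebesgue_cons /pushforward preimage_bigcup.
apply: measure_semi_sigma_additive.
- by move=> k; rewrite -[X in measurable X]setTI; exact: measurable_cons_rV.
- apply/trivIsetP => i j _ _ ij; rewrite -preimage_setI.
  by move/trivIsetP : tF => /(_ _ _ _ _ ij) ->//; rewrite preimage_set0.
- by rewrite -preimage_bigcup -[X in measurable X]setTI; exact: measurable_cons_rV.
Qed.

HB.instance Definition _ := isMeasure.Build _ _ _ (lebesgue_cons m)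
  lebesgue_cons0 lebesgue_cons_ge0 lebesgue_cons_sigma_additive.

Let lebesgue_cons_sigma_finite : sigma_finite setT (lebesgue_cons m).
Proof.
have /sigma_finiteP[F [TF ndF Foo]] := sigma_finiteT (@lebesgue_measure R).
have /sigma_finiteP[G [TG ndG Goo]] := sigma_finiteT m.
exists (fun i => (fun v : 'rV[R]_n.+1 => (v ord0 ord0 : measurableTypeR R,
  @rsubmx R 1 1 n v)) @^-1` (F i `*` G i)).
  apply/esym; rewrite -subTset => v _ /=.
  have [i _ Fi] : (\bigcup_i F i) (v ord0 ord0) by rewrite -TF.
  have [j _ Gj] : (\bigcup_i G i) (@rsubmx R 1 1 n v) by rewrite -TG.
  exists (maxn i j) => //; split => /=.
    by move: Fi; exact/subsetPset/ndF/leq_maxl.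
  by move: Gj; exact/subsetPset/ndG/leq_maxr.
move=> i; have [mF Fi] := Foo i; have [mG Gi] := Goo i; split.
  rewrite -[X in measurable X]setTI; apply: measurable_behead_rV => //.
  exact: measurableX.
rewrite /lebesgue_cons /pushforward -comp_preimage.
rewrite (_ : _ \o _ = id); last by apply/funext => p; exact: cons_rVK.
rewrite preimage_id product_measure1E//.
by rewrite lte_mul_pinfty// ge0_fin_numE.
Qed.

HB.instance Definition _ := Measure_isSigmaFinite.Build _ _ _
  (lebesgue_cons m) lebesgue_cons_sigma_finite.

End lebesgue_cons_measure.

(* Lebesgue measure on R^n, as the iterated product transported along
   R x R^m ~ R^(m+1). *)
Fixpoint lebesgue_rV n : {sigma_finite_measure set 'rV[R]_n -> \bar R} :=
  match n with
  | 0 => @dirac _ 'rV[R]_0 (0 : 'rV[R]_0) R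
  | m.+1 => lebesgue_cons (lebesgue_rV m)
  end.

End lebesgue_rV.

Section calculus.
Context {R : realType}.

(* Derivative along the directions v_1, ..., v_k listed in s; for open U, a
   function is C^infty on U iff all of these exist and are continuous on U. *)
Definition iter_derive {V : normedModType R} (s : seq V) (f : V -> R) : V -> R :=
  foldr (fun v g => 'D_v g) f s.

Definition smooth_on {V : normedModType R} (U : set V) (f : V -> R) : Prop :=
  forall (s : seq V) (x : V), U x ->
    {for x, continuous (iter_derive s f)} /\
    forall v, derivable (iter_derive s f) x v.

(* C_c^infty(U) *)
Definition test_fun {V : normedModType R} (U : set V) (phi : V -> R) : Prop :=
  smooth_on setT phi /\
  exists K : set V, [/\ compact K, K `<=` U & forall x, ~ K x -> phi x = 0].

Definition C3 (f : R -> R) : Prop :=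
  (forall (k : nat) (x : R), (k < 3)%N -> derivable (derive1n k f) x 1) /\
  continuous (derive1n 3 f).

End calculus.

Section space.
Context {R : realType} {n : nat}.
Local Notation V := 'rV[R]_n.
Local Notation mu := (@lebesgue_rV R n).
Implicit Types (Omega : set V) (g h : V -> R).

Definition basis_vec (i : 'I_n) : V := delta_mx ord0 i.

(* Near each boundary point, the boundary is the zero set of a smooth function rho with
   nonvanishing differential there, Omega lying on the side rho < 0. *)
Definition smooth_bounded_domain Omega : Prop :=
  [/\ open Omega, connected Omega, Omega !=set0, bounded_set Omega &
   forall x0, closure Omega x0 -> ~ Omega x0 ->
     exists (U : set V) (rho : V -> R),
     [/\ open U, U x0, smooth_on U rho, exists v, 'D_v rho x0 != 0 &
         Omega `&` U = U `&` [set x | rho x < 0]]].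

Definition smooth_closure Omega g : Prop :=
  [/\ smooth_on Omega g, {within closure Omega, continuous g} &
   forall s : seq V, exists h, {within closure Omega, continuous h} /\
     forall x, Omega x -> h x = iter_derive s g x].

Definition laplacian g : V -> R :=
  fun x => \sum_(i < n) iter_derive [:: basis_vec i; basis_vec i] g x.

(* g is extended by 0 outside Omega, so this is the norm of L^p(Omega). *)
Definition Lp_norm (p : \bar R) Omega g : \bar R :=
  ('N[mu]_p[(EFin \o g) \_ Omega])%E.

Definition L2 Omega g : Prop :=
  measurable_fun Omega g /\ (Lp_norm 2%:E Omega g < +oo)%E.

(* The system (e_i), indexed from 0, so that e 0 is the principal
   eigenfunction: an orthonormal basis of L^2(Omega), ordered by eigenvalue. *)
Definition dirichlet_eigensystem Omega (e : nat -> V -> R) (lambda : nat -> R) :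
  Prop :=
  [/\ forall i, smooth_closure Omega (e i),
      forall i, (forall x, Omega x -> - laplacian (e i) x = lambda i * e i x) /\
        (forall x, closure Omega x -> ~ Omega x -> e i x = 0),
      forall i j, \int[mu]_(x in Omega) (e i x * e j x) = (i == j)%:R,
      {homo lambda : i j / (i <= j)%N >-> i <= j} /\
        (forall g, L2 Omega g ->
          (forall i, \int[mu]_(x in Omega) (g x * e i x) = 0) ->
          {ae mu, forall x, Omega x -> g x = 0})
    & forall x, Omega x -> 0 < e 0%N x].

(* h is the weak derivative of g along the coordinate directions listed in s. *)
Definition is_weak_deriv Omega (s : seq 'I_n) g h : Prop :=
  forall phi, test_fun Omega phi ->
    \int[mu]_(x in Omega) (g x * iter_derive (map basis_vec s) phi x) =
    (-1) ^+ size s * \int[mu]_(x in Omega) (h x * phi x).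

(* A square integrable weak derivative, if there is one. *)
Definition weak_deriv Omega (s : seq 'I_n) g : V -> R :=
  get [set h | L2 Omega h /\ is_weak_deriv Omega s g h].

(* W^{k,2}(Omega) *)
Definition sobolev Omega (k : nat) g : Prop :=
  L2 Omega g /\
  forall s : seq 'I_n, (size s <= k)%N ->
    exists h, L2 Omega h /\ is_weak_deriv Omega s g h.

(* The sum of the L^2 norms of all weak derivatives of order at most k, a norm
   equivalent to the Hilbert norm of W^{k,2}(Omega). *)
Definition sobolev_norm Omega (k : nat) g : \bar R :=
  (\sum_(j < k.+1) \sum_(s : j.-tuple 'I_n)
     Lp_norm 2%:E Omega (weak_deriv Omega s g))%E.

(* W_0^{1,2}(Omega), the closure of C_c^infty(Omega) in W^{1,2}(Omega) *)
Definition sobolev0 Omega g : Prop :=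
  sobolev Omega 1 g /\
  exists phi : nat -> V -> R, (forall k, test_fun Omega (phi k)) /\
    (fun k => sobolev_norm Omega 1 (g \- phi k)) @ \oo --> 0%E.

Definition weak_laplacian Omega g : V -> R :=
  fun x => \sum_(i < n) weak_deriv Omega [:: i; i] g x.

(* W_0^{1,2}(Omega) \cap C^0(closure Omega) and its norm *)
Definition sobolev0C Omega g : Prop :=
  sobolev0 Omega g /\ {within closure Omega, continuous g}.

Definition sobolev0C_norm Omega g : \bar R :=
  (sobolev_norm Omega 1 g +
   ereal_sup [set `|g x|%:E | x in closure Omega])%E.

End space.

Section spacetime.
Context {R : realType} {n : nat}.
Local Notation V := 'rV[R]_n.
Local Notation mu := (@lebesgue_rV R n).
Local Notation leb := (@lebesgue_measure R).
Implicit Types (Omega : set V) (T : \bar R) (u v w : R -> V -> R).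

Definition Ico0 T : set R := [set t | 0 <= t /\ (t%:E < T)%E].
Definition Ioo0 T : set R := [set t | 0 < t /\ (t%:E < T)%E].

(* measurableTypeR R, convertible to R, carries the sigma-algebra on which
   lebesgue_measure is defined. *)
Definition cylinder Omega T : set (measurableTypeR R * V) := Ioo0 T `*` Omega.

(* C^0([0,T); X), where the space X of functions has norm N *)
Definition C0_time T (X : (V -> R) -> Prop) (N : (V -> R) -> \bar R) u : Prop :=
  forall t, Ico0 T t ->
    X (u t) /\ (fun s => N (u s \- u t)) @ within (Ico0 T) (nbhs t) --> 0%E.

Definition measurable_cylinder Omega T u : Prop :=
  measurable_fun (cylinder Omega T) (fun z => u z.1 z.2).

(* L^infty_loc([0,T); X). For the separable spaces X below, joint measurability
   in (t, x) gives the strong measurability of t |-> u t into X. *)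
Definition Linfty_loc_time Omega T (X : (V -> R) -> Prop)
    (N : (V -> R) -> \bar R) u : Prop :=
  measurable_cylinder Omega T u /\
  forall T' : R, 0 < T' -> (T'%:E < T)%E -> exists M : R,
    {ae leb, forall t, 0 < t < T' -> X (u t) /\ (N (u t) <= M%:E)%E}.

(* v_t = w in the sense of distributions on Omega x (0,T) *)
Definition is_time_deriv Omega T v w : Prop :=
  forall phi : R * V -> R,
    test_fun (Ioo0 T `*` Omega : set (R * V)) phi ->
    \int[(leb \x mu)%E]_(z in cylinder Omega T) (v z.1 z.2 * 'D_(1, 0) phi z) =
    - \int[(leb \x mu)%E]_(z in cylinder Omega T) (w z.1 z.2 * phi z).

(* w is a jointly measurable version of (t, x) |-> (Delta v(t))(x). *)
Definition is_laplacian Omega T v w : Prop :=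
  measurable_cylinder Omega T w /\
  {ae leb, forall t, Ioo0 T t ->
    {ae mu, forall x, Omega x -> w t x = weak_laplacian Omega (v t) x}}.

Definition strong_solution Omega (tau alpha beta gamma : R) (f : R -> R)
    (u0 u1 u2 : V -> R) T u : Prop :=
  exists ut utt uttt Lu Lut : R -> V -> R,
  [/\ [/\ is_time_deriv Omega T u ut, is_time_deriv Omega T ut utt &
          is_time_deriv Omega T utt uttt],
      [/\ C0_time T (sobolev0C Omega) (sobolev0C_norm Omega) u,
          C0_time T (sobolev0C Omega) (sobolev0C_norm Omega) ut,
          Linfty_loc_time Omega T (sobolev Omega 2) (sobolev_norm Omega 2) u &
          Linfty_loc_time Omega T (sobolev Omega 2) (sobolev_norm Omega 2) ut],
      [/\ C0_time T (L2 Omega) (Lp_norm 2%:E Omega) utt,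
          Linfty_loc_time Omega T (sobolev0 Omega) (sobolev_norm Omega 1) utt &
          Linfty_loc_time Omega T (L2 Omega) (Lp_norm 2%:E Omega) uttt],
      {ae mu, forall x, Omega x ->
        [/\ u 0 x = u0 x, ut 0 x = u1 x & utt 0 x = u2 x]} &
      [/\ is_laplacian Omega T u Lu, is_laplacian Omega T ut Lut &
          {ae (leb \x mu)%E, forall z, cylinder Omega T z ->
            let: (t, x) := z in
            tau * uttt t x + alpha * utt t x =
            beta * Lut t x + gamma * Lu t x
            + derive1 f (u t x) * utt t x + derive1n 2 f (u t x) * (ut t x) ^+ 2}]].

Definition blows_up_at Omega u (Tmax : R) : Prop :=
  limf_esup (fun t => Lp_norm +oo Omega (u t)) (Tmax^'-) = +oo%E.

Definition maximal_strong_solution Omega (tau alpha beta gamma : R)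
    (f : R -> R) (u0 u1 u2 : V -> R) (Tmax : \bar R) u : Prop :=
  [/\ (0 < Tmax)%E,
      strong_solution Omega tau alpha beta gamma f u0 u1 u2 Tmax u &
      (Tmax < +oo)%E -> blows_up_at Omega u (fine Tmax)].

End spacetime.

(* Main.v *)
Require Import Defs.
From mathcomp Require Import all_boot all_order all_algebra.
From mathcomp Require Import all_classical all_reals all_analysis.
From mathcomp Require Import measurable_realfun.
From mathcomp Require Import ring lra.
Import numFieldNormedType.Exports.
Import Order.TTheory GRing.Theory Num.Theory.
Set Implicit Arguments.
Unset Strict Implicit.
Unset Printing Implicit Defensive.
Local Open Scope classical_set_scope.
Local Open Scope ring_scope.

(** The first moment y(t) = int u(t) e_0 of a solution against the positive
    principal eigenfunction satisfies a scalar differential inequality whose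
    solutions become infinite before time T0.

    By Green's identity (green_identity) the eigenfunction turns the Laplacians
    of the equation into multiples of the moments, so that with lambda the
    principal eigenvalue and F(t) = int f(u(t)) e_0 the equation becomes
      tau y''' + alpha y'' = - lambda beta y' - lambda gamma y + F''.
    Two integrations in time give
      tau y' + alpha y + lambda beta int y + lambda gamma int int y
        = F + C0 + C1 t,
    where C0 and C1 depend on the initial data and are positive as soon as the
    moments of u1 and of u2 are large enough compared with u0 and with (u0, u1).
    As f is convex, Jensen's inequality (jensen_eigen) gives F >= c f(y / c),
    c = int e_0. While y increases, the linear terms are at most A y with A
    depending on T0 and the coefficients only (absorbed), and by superlinearity
    they are at most half of c f(y / c) once y / c is beyond some b. Hence tau y' >= (c / 2) f(y / c)
    (velocity_lower); in particular y' cannot vanish a first time, so y increases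
    for ever (velocity_gt0). For a primitive Phi of 1 / f this says that
    Phi(y / c) grows at least at the rate 1 / (2 tau), while by integrability of
    1 / f the total growth of Phi beyond b is as small as desired
    (osgood_primitive, osgood_time). A large b, that is a large moment of u0,
    thus excludes existence up to T0, and the blow-up alternative for the maximal
    solution gives the divergence of the L^infinity norm.

    What remains is to justify the scalar system for strong solutions, whose
    derivatives in time and space are weak ones. In space, test functions are
    obtained from the eigenfunctions themselves by a smooth truncation of their
    values (test_fun_cutoff): near the boundary an eigenfunction is small, so the
    truncated function has compact support. Green's identity and, by completeness
    of the eigenfunctions, the uniqueness of weak derivatives follow from
    there. In time, testing with smooth steps shows that the increments
    of the solution are time integrals of its weak derivative
    (weak_time_increment), so that u and u_t are differentiable as maps into
    L^1(Omega) (weak_time_L1_derivative). Together with the continuity of u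
    and u_t in the supremum norm this suffices to differentiate int f(u) e_0
    twice (has_derivative_f, has_derivative_f1). The equation itself then yields the
    derivative of the moment of u_tt (is_derive_moment2), which holds at every
    time because its right-hand side is continuous. *)

(** * Integration of real-valued functions *)

Section integration.
Context d (T : measurableType d) (R : realType).
Context (mu : {measure set T -> \bar R}).
Implicit Types (D : set T) (f g : T -> R).

Lemma le_integrable_real D f g : measurable D -> measurable_fun D f ->
  mu.-integrable D (EFin \o g) -> (forall x, D x -> `|f x| <= g x) ->
  mu.-integrable D (EFin \o f).
Proof.
move=> mD mf ig fg; apply: le_integrable ig => //; first exact/measurable_EFinP.
by move=> x Dx /=; rewrite lee_fin (le_trans (fg _ Dx))// ler_norm.
Qed.

Lemma integrableZl_real D (a : R) f : measurable D -> mu.-integrable D (EFin \o f) ->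
  mu.-integrable D (EFin \o (fun x => a * f x)).
Proof. by move=> mD /(integrableZl mD a); apply: eq_integrable => // x _ /=; rewrite EFinM. Qed.

Lemma integrableZr_real D (a : R) f : measurable D -> mu.-integrable D (EFin \o f) ->
  mu.-integrable D (EFin \o (fun x => f x * a)).
Proof. by move=> mD /(integrableZr mD a); apply: eq_integrable => // x _ /=; rewrite EFinM. Qed.

Lemma integrableD_real D f g : measurable D -> mu.-integrable D (EFin \o f) ->
  mu.-integrable D (EFin \o g) -> mu.-integrable D (EFin \o (fun x => f x + g x)).
Proof. by move=> mD i1 i2; have := integrableD mD i1 i2; apply: eq_integrable. Qed.

Lemma integrableB_real D f g : measurable D -> mu.-integrable D (EFin \o f) ->
  mu.-integrable D (EFin \o g) -> mu.-integrable D (EFin \o (fun x => f x - g x)).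
Proof. by move=> mD i1 i2; have := integrableB mD i1 i2; apply: eq_integrable. Qed.

Lemma Rintegral_lin D (a b : R) f g : measurable D ->
  mu.-integrable D (EFin \o f) -> mu.-integrable D (EFin \o g) ->
  mu.-integrable D (EFin \o (fun x => a * f x + b * g x)) /\
  \int[mu]_(x in D) (a * f x + b * g x) =
  a * \int[mu]_(x in D) f x + b * \int[mu]_(x in D) g x.
Proof.
move=> mD i1 i2; have j1 := integrableZl_real a mD i1; have j2 := integrableZl_real b mD i2.
by split; [exact: integrableD_real|rewrite RintegralD// !RintegralZl].
Qed.

Lemma integrable_cst_real D (k : R) : measurable D -> (mu D < +oo)%E ->
  mu.-integrable D (EFin \o cst k).
Proof.
move=> mD fD; apply: measurable_bounded_integrable => //.
by exists `|k|; split; [exact: num_real|move=> M kM x _ /=; exact: ltW].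
Qed.

Lemma bounded_integrable D f (M : R) : measurable D -> (mu D < +oo)%E ->
  measurable_fun D f -> (forall x, D x -> `|f x| <= M) ->
  mu.-integrable D (EFin \o f).
Proof.
move=> mD fD mf fM; apply: (@le_integrable_real _ _ (cst M)) => //.
exact: integrable_cst_real.
Qed.

Lemma integrable_mul_bounded D f g (M : R) : measurable D ->
  mu.-integrable D (EFin \o f) -> measurable_fun D g ->
  (forall x, D x -> `|g x| <= M) ->
  mu.-integrable D (EFin \o (fun x => f x * g x)).
Proof.
move=> mD intf mg gM.
have mf : measurable_fun D f by apply/measurable_EFinP; exact: measurable_int intf.
apply: (@le_integrable_real _ _ (fun x => M * `|f x|)) => //.
- exact: measurable_funM.
- have := integrableZl mD M (integrable_norm intf).
  by apply: eq_integrable => // x _ /=; rewrite EFinM.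
- by move=> x Dx; rewrite normrM mulrC ler_wpM2r// gM.
Qed.

Lemma Rintegral_cvg D (f_ : nat -> T -> R) f g : measurable D ->
  (forall k, measurable_fun D (f_ k)) ->
  (forall x, D x -> f_ ^~ x @ \oo --> f x) ->
  mu.-integrable D (EFin \o g) -> (forall k x, D x -> `|f_ k x| <= g x) ->
  (fun k => \int[mu]_(x in D) f_ k x) @ \oo --> \int[mu]_(x in D) f x.
Proof.
move=> mD mf_ f_f ig f_g.
have mf : measurable_fun D f by exact: (measurable_fun_cvg mf_).
have [|||||i1 _ i2] := @dominated_convergence _ T R mu D mD
  (fun k => EFin \o f_ k) (EFin \o f) (EFin \o g).
- by move=> k; apply/measurable_EFinP.
- exact/measurable_EFinP.
- by apply: aeW => x Dx; apply/cvg_EFin; [near=> k|exact: f_f].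
- exact: ig.
- by apply: aeW => x k Dx /=; rewrite lee_fin f_g.
by apply: fine_cvg; rewrite fineK//; exact: integrable_fin_num.
Unshelve. all: by end_near. Qed.

Lemma ae_eq_Rintegral_real D f g : measurable D ->
  measurable_fun D f -> measurable_fun D g ->
  {ae mu, forall x, D x -> f x = g x} ->
  \int[mu]_(x in D) f x = \int[mu]_(x in D) g x.
Proof.
move=> mD mf mg fg; congr fine; apply: ae_eq_integral => //; try exact/measurable_EFinP.
by apply: filterS fg => x h Dx /=; rewrite h.
Qed.

Lemma ae_integrable_le D f g : measurable D -> measurable_fun D f ->
  mu.-integrable D (EFin \o g) -> {ae mu, forall x, D x -> `|f x| <= g x} ->
  mu.-integrable D (EFin \o f) /\
  `|\int[mu]_(x in D) f x| <= \int[mu]_(x in D) g x.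
Proof.
move=> mD mf ig fg.
have mg : measurable_fun D g by apply/measurable_EFinP; exact: measurable_int ig.
have le1 : (\int[mu]_(x in D) `|(f x)%:E| <= \int[mu]_(x in D) `|(g x)%:E|)%E.
  apply: ae_ge0_le_integral => //.
  - by apply/measurableT_comp => //; exact/measurable_EFinP.
  - by apply/measurableT_comp => //; exact/measurable_EFinP.
  - apply: filterS fg => x h Dx; rewrite lee_fin (le_trans (h Dx))//.
    exact: ler_norm.
have intf : mu.-integrable D (EFin \o f).
  apply/integrableP; split; first exact/measurable_EFinP.
  by apply: le_lt_trans le1 _; case/integrableP: ig.
split=> //; apply: (le_trans (le_normr_Rintegral mD intf)).
rewrite /Rintegral.
rewrite [leRHS](_ : _ = fine (\int[mu]_(x in D) (`|g x|%:E))); last first.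
  congr fine; apply: ae_eq_integral => //; first exact/measurable_EFinP.
    by apply/measurable_EFinP; exact: measurableT_comp.
  apply: filterS fg => x h Dx /=; congr EFin; apply/esym/ger0_norm.
  by apply: le_trans (h Dx).
apply: fine_le => //.
- by apply: integrable_fin_num => //; exact: integrable_norm.
- by apply: integrable_fin_num => //; exact: integrable_norm.
Qed.

Lemma Rintegral_sum_seq D (I : Type) (r : seq I) (F : I -> T -> R) : measurable D ->
  (forall i, mu.-integrable D (EFin \o F i)) ->
  mu.-integrable D (EFin \o (fun x => \sum_(i <- r) F i x)) /\
  \int[mu]_(x in D) (\sum_(i <- r) F i x) = \sum_(i <- r) \int[mu]_(x in D) F i x.
Proof.
move=> mD iF; elim: r => [|i r [IH1 IH2]].
  have -> : (fun x => \sum_(i <- [::]) F i x) = cst 0 by apply/funext => x; rewrite big_nil.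
  split; first exact: integrable0.
  by rewrite big_nil Rintegral_cst// mul0r.
have -> : (fun x => \sum_(j <- i :: r) F j x) = (fun x => F i x + \sum_(j <- r) F j x).
  by apply/funext => x; rewrite big_cons.
split; last by rewrite RintegralD// IH2 big_cons.
by have := integrableD mD (iF i) IH1; apply: eq_integrable.
Qed.

(** The Cauchy-Schwarz inequality against the constant 1, from the integrals of
    2 c |f| <= f^2 + c^2 with c the mean value of |f|. *)
Lemma sqr_Rintegral_le D f : measurable D -> (mu D < +oo)%E ->
  measurable_fun D f -> mu.-integrable D (EFin \o (fun x => f x ^+ 2)) ->
  mu.-integrable D (EFin \o f) /\
  (\int[mu]_(x in D) `|f x|) ^+ 2 <= fine (mu D) * \int[mu]_(x in D) (f x ^+ 2).
Proof.
move=> mD fD mf if2.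
have i1 : mu.-integrable D (EFin \o cst 1) by exact: integrable_cst_real.
have i1f : mu.-integrable D (EFin \o (fun x => 1 + f x ^+ 2)).
  by have := integrableD mD i1 if2; apply: eq_integrable.
have intf : mu.-integrable D (EFin \o f).
  apply: (le_integrable_real mD mf i1f) => x Dx.
  rewrite -[X in _ <= _ + X]real_normK ?num_real//.
  have := sqr_ge0 (`|f x| - 1); have := normr_ge0 (f x); nra.
split=> //.
set J := \int[mu]_(x in D) `|f x|; set Q := \int[mu]_(x in D) (f x ^+ 2).
set m := fine (mu D).
have J0 : 0 <= J by apply: Rintegral_ge0.
have Q0 : 0 <= Q by apply: Rintegral_ge0 => x _; exact: sqr_ge0.
have m0 : 0 <= m by exact: fine_ge0.
have key c : 2 * c * J <= Q + c ^+ 2 * m.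
  have ia : mu.-integrable D (EFin \o (fun x => 2 * c * `|f x|)).
    have := integrableZl mD (2 * c) (integrable_norm intf).
    by apply: eq_integrable => // x _ /=; rewrite EFinM.
  have ib : mu.-integrable D (EFin \o (fun x => f x ^+ 2 + c ^+ 2)).
    have ic : mu.-integrable D (EFin \o cst (c ^+ 2)).
      exact: integrable_cst_real.
    by have := integrableD mD if2 ic; apply: eq_integrable.
  rewrite /J -RintegralZl//; last exact: integrable_norm.
  rewrite /Q /m -Rintegral_cst// -RintegralD//; last exact: integrable_cst_real.
  apply: le_Rintegral => // x Dx.
  by rewrite -[X in _ <= X + _]real_normK ?num_real//; have := sqr_ge0 (`|f x| - c); lra.
have [m_0|mneq] := eqVneq m 0.
  rewrite m_0 mul0r; have [->|Jn0] := eqVneq J 0; first by rewrite expr0n.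
  have Jp : 0 < J by rewrite lt_neqAle eq_sym Jn0.
  exfalso; have := key ((Q + 1) / (2 * J)).
  rewrite m_0 mulr0 addr0 (_ : 2 * _ * J = Q + 1); first by lra.
  by field.
have mp : 0 < m by rewrite lt_neqAle eq_sym mneq.
have := key (J / m); rewrite (_ : 2 * _ * J = 2 * (J ^+ 2 / m)); last by field.
rewrite (_ : (J / m) ^+ 2 * m = J ^+ 2 / m); last by field.
move=> h; rewrite mulrC -ler_pdivrMr//; lra.
Qed.

(** The partial integrals of an integrable function may be infinite on a null
    set; taking fine there keeps them integrable with the same integral. *)
Lemma Rintegral_restrict D (G h : T -> \bar R) : measurable D -> mu.-integrable setT G ->
  (forall x, D x -> G x = h x) -> (forall x, ~ D x -> G x = 0%E) ->
  {ae mu, forall x, D x -> h x \is a fin_num} ->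
  mu.-integrable D (EFin \o (fine \o h)) /\
  fine (\int[mu]_x G x)%E = \int[mu]_(x in D) fine (h x).
Proof.
move=> mD iG GD GnD hfin.
have iGD : mu.-integrable D G by exact: integrableS iG.
have mh : measurable_fun D (fine \o h).
  apply: (eq_measurable_fun (fine \o G)); first by move=> x /set_mem Dx /=; rewrite GD.
  by apply: measurableT_comp => //; exact: measurable_int iGD.
split.
  apply: le_integrable iGD => //; first exact/measurable_EFinP.
  move=> x Dx /=; rewrite GD//.
  by case: (h x) => //=; rewrite normr0 leey.
congr fine; rewrite (_ : (\int[mu]_x G x)%E = (\int[mu]_(x in D) G x)%E).
  apply: ae_eq_integral => //; [exact: measurable_int iGD|exact/measurable_EFinP|].
  by apply: filterS hfin => x hx Dx /=; rewrite fineK ?GD// hx.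
rewrite [RHS]integral_mkcond; apply: eq_integral => x _; rewrite patchE.
by case: ifPn => // /negP xD; apply: GnD => Dx; apply: xD; exact: mem_set.
Qed.

End integration.

Section fubini_real.
Context d1 d2 (T1 : measurableType d1) (T2 : measurableType d2) (R : realType).
Context (m1 : {sigma_finite_measure set T1 -> \bar R}).
Context (m2 : {sigma_finite_measure set T2 -> \bar R}).
Context (A : set T1) (B : set T2) (mA : measurable A) (mB : measurable B).
Implicit Types f : T1 * T2 -> R.
Local Notation m12 := (m1 \x m2)%E.

Lemma measurable_section2 f y : measurable_fun (A `*` B) f -> B y ->
  measurable_fun A (fun x => f (x, y)).
Proof.
move=> mf By mA' Y mY.
have mAB : measurable (A `*` B) by exact: measurableX.
have := measurable_ysection y (mf mAB Y mY).
rewrite (_ : ysection _ y = A `&` (fun x => f (x, y)) @^-1` Y)//.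
apply/seteqP; split => x /=; rewrite /ysection/= inE /=.
  by move=> [[? _] ?].
by move=> [? ?].
Qed.

Let patchX f x y : ((EFin \o f) \_ (A `*` B)) (x, y) =
  if x \in A then ((fun y => (f (x, y))%:E) \_ B) y else 0%E.
Proof.
rewrite !patchE in_setX/=; case: ifPn => [/andP[-> ->]//|].
by rewrite negb_and; case: (x \in A) => //= /negbTE ->.
Qed.

Let patchX2 f x y : ((EFin \o f) \_ (A `*` B)) (x, y) =
  if y \in B then ((fun x => (f (x, y))%:E) \_ A) x else 0%E.
Proof.
rewrite !patchE in_setX/=; case: ifPn => [/andP[-> ->]//|].
by rewrite negb_and; case: (y \in B); rewrite ?orbF// => /negbTE ->.
Qed.

Let int2E f x : A x ->
  (\int[m2]_y ((EFin \o f) \_ (A `*` B)) (x, y) = \int[m2]_(y in B) (f (x, y))%:E)%E.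
Proof.
move=> Ax; rewrite [RHS]integral_mkcond.
by apply: eq_integral => y _; rewrite patchX mem_set.
Qed.

Let int1E f y : B y ->
  (\int[m1]_x ((EFin \o f) \_ (A `*` B)) (x, y) = \int[m1]_(x in A) (f (x, y))%:E)%E.
Proof.
move=> By; rewrite [RHS]integral_mkcond.
by apply: eq_integral => x _; rewrite patchX2 mem_set.
Qed.

Lemma ae_integrable_section1 f : m12.-integrable (A `*` B) (EFin \o f) ->
  {ae m1, forall x, A x -> m2.-integrable B (fun y => (f (x, y))%:E)}.
Proof.
rewrite integrable_mkcond; last exact: measurableX.
move=> /ae_integrable1; apply: filterS => x ix Ax.
apply/(integrable_mkcond _ mB); apply: eq_integrable ix => // y _.
by rewrite patchX mem_set.
Qed.

Lemma ae_integrable_section2 f : m12.-integrable (A `*` B) (EFin \o f) ->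
  {ae m2, forall y, B y -> m1.-integrable A (fun x => (f (x, y))%:E)}.
Proof.
rewrite integrable_mkcond; last exact: measurableX.
move=> /ae_integrable2; apply: filterS => y iy By.
apply/(integrable_mkcond _ mA); apply: eq_integrable iy => // x _.
by rewrite patchX2 mem_set.
Qed.

Lemma Rintegral_fubini1 f : m12.-integrable (A `*` B) (EFin \o f) ->
  m1.-integrable A (EFin \o (fun x => \int[m2]_(y in B) f (x, y))) /\
  \int[m12]_(z in A `*` B) f z = \int[m1]_(x in A) \int[m2]_(y in B) f (x, y).
Proof.
move=> intf; have sec := ae_integrable_section1 intf.
have intf' := intf; rewrite integrable_mkcond in intf'; last exact: measurableX.
have [||i1 <-] := Rintegral_restrict mA (integrable_fubini_F intf') (int2E f).
- by move=> x nAx; apply: integral0_eq => y _; rewrite patchX ifF//; apply/negbTE/negP => /set_mem.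
- by apply: filterS sec => x ix Ax; exact: integrable_fin_num (ix Ax).
by split=> //; rewrite /Rintegral integral_mkcond -(integral12_prod_meas1 intf').
Qed.

Lemma Rintegral_fubini2 f : m12.-integrable (A `*` B) (EFin \o f) ->
  m2.-integrable B (EFin \o (fun y => \int[m1]_(x in A) f (x, y))) /\
  \int[m12]_(z in A `*` B) f z = \int[m2]_(y in B) \int[m1]_(x in A) f (x, y).
Proof.
move=> intf; have sec := ae_integrable_section2 intf.
have intf' := intf; rewrite integrable_mkcond in intf'; last exact: measurableX.
set g := (EFin \o f) \_ (A `*` B) in intf'.
have mg : measurable_fun setT g by exact: measurable_int intf'.
have iF : m2.-integrable setT (fubini_G m1 g).
  apply/integrableP; split; first exact: measurable_fubini_G intf'.
  apply: le_lt_trans ((integrable21ltyP _ _ mg).1 intf').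
  apply: ge0_le_integral => //.
  - by apply: measurableT_comp => //; exact: measurable_fubini_G intf'.
  - apply: (measurable_fun_fubini_tonelli_G (abse \o g)) => //=.
    exact: measurableT_comp.
  - move=> y _; apply: le_abse_integral => //.
    exact: (measurableT_comp mg (measurable_pair2 y)).
have [||i1 <-] := Rintegral_restrict mB iF (int1E f).
- by move=> y nBy; apply: integral0_eq => x _; rewrite /g patchX2 ifF//; apply/negbTE/negP => /set_mem.
- by apply: filterS sec => y iy By; exact: integrable_fin_num (iy By).
by split=> //; rewrite /Rintegral integral_mkcond -(integral21_prod_meas1 intf').
Qed.

Lemma integrable_prod_bounded f (M : R) : (m1 A < +oo)%E ->
  measurable_fun (A `*` B) f ->
  {ae m1, forall x, A x -> (\int[m2]_(y in B) `|f (x, y)|%:E <= M%:E)%E} ->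
  m12.-integrable (A `*` B) (EFin \o f).
Proof.
move=> fA mf fM; have mAB : measurable (A `*` B) by exact: measurableX.
apply/(integrable_mkcond _ mAB).
set g := (EFin \o f) \_ (A `*` B).
have mg : measurable_fun setT g.
  by apply/(measurable_restrictT _ mAB)/measurable_EFinP.
apply/(integrable12ltyP _ _ mg).
have sec x : (\int[m2]_y `|g (x, y)| =
   ((fun x => \int[m2]_(y in B) `|f (x, y)|%:E) \_ A) x)%E.
  rewrite patchE; case: ifPn => xA.
    rewrite [RHS]integral_mkcond; apply: eq_integral => y _.
    by rewrite /g patchX xA !patchE; case: ifPn => //; rewrite abse0.
  by apply: integral0_eq => y _; rewrite /g patchX (negbTE xA) abse0.
have mMA : measurable_fun setT ((cst M%:E : T1 -> \bar R) \_ A).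
  exact/(measurable_restrictT _ mA).
apply: (@le_lt_trans _ _ (\int[m1]_x `|((cst M%:E : T1 -> \bar R) \_ A) x|)%E).
  apply: ae_ge0_le_integral => //.
  - by move=> x _; apply: integral_ge0.
  - apply: (measurable_fun_fubini_tonelli_F (abse \o g)) => //=.
    exact: measurableT_comp.
  - exact: measurableT_comp.
  apply: filterS fM => x h _; rewrite sec !patchE; case: ifPn => xA; last by rewrite abse0.
  by apply: le_trans (h (set_mem xA)) _; rewrite /= lee_fin ler_norm.
have : m1.-integrable A (EFin \o cst M) by exact: integrable_cst_real.
by rewrite integrable_mkcond// => /integrableP[].
Qed.

Lemma ae_prod_section (P : T1 * T2 -> Prop) : {ae m12, forall z, P z} ->
  {ae m1, forall x, {ae m2, forall y, P (x, y)}}.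
Proof.
move=> [N [mN N0 PN]].
have mx : measurable_fun setT (m2 \o xsection N) by exact: measurable_fun_xsection.
have /ae_eq_integral_abs : (\int[m1]_(x in setT) `|(m2 \o xsection N) x| = 0)%E.
  by rewrite -[RHS]N0; apply: eq_integral => x _; rewrite gee0_abs.
move=> /(_ measurableT mx); apply: filterS => x /(_ I) /= N0x.
exists (xsection N x); split => //; first exact: measurable_xsection.
by move=> y nP; rewrite /xsection /=; apply/mem_set/PN.
Qed.

Lemma product_measure_lty : (m1 A < +oo)%E -> (m2 B < +oo)%E -> (m12 (A `*` B) < +oo)%E.
Proof. by move=> fA fB; rewrite product_measure1E// lte_mul_pinfty// ge0_fin_numE. Qed.

End fubini_real.

Section L2_integrals.
Context {R : realType} {n : nat}.
Local Notation V := 'rV[R]_n.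
Local Notation mu := (@lebesgue_rV R n).
Implicit Types (Omega : set V) (g h : V -> R).

Lemma Lp_norm2E Omega g :
  Lp_norm 2%:E Omega g = ((\int[mu]_(x in Omega) (g x ^+ 2)%:E) `^ (2^-1))%E.
Proof.
rewrite /Lp_norm unlock/=; congr poweR.
rewrite [RHS]integral_mkcond; apply: eq_integral => x _.
rewrite !patchE; case: ifPn => _ /=; last first.
  by rewrite normr0 powR0// pnatr_eq0.
by rewrite powR_mulrn// real_normK// num_real.
Qed.

Lemma L2P Omega g : measurable Omega ->
  L2 Omega g <-> measurable_fun Omega g /\
    mu.-integrable Omega (EFin \o (fun x => g x ^+ 2)).
Proof.
move=> mO; rewrite /L2 Lp_norm2E; split => -[mg h]; split => //.
  apply/integrableP; split; first by apply/measurable_EFinP; exact: measurable_funX.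
  rewrite (eq_integral (fun x => (g x ^+ 2)%:E)); last first.
    by move=> x _ /=; rewrite ger0_norm// sqr_ge0.
  rewrite ltey; apply/eqP => E; move: h; rewrite E.
  by rewrite poweRyr ?ltxx// invr_eq0 pnatr_eq0.
have h1 : (\int[mu]_(x in Omega) (g x ^+ 2)%:E \is a fin_num)%E.
  exact: integrable_fin_num h.
by rewrite -(fineK h1) poweR_EFin ltey.
Qed.

Lemma Lp_norm2_le Omega g (M : R) : measurable Omega -> measurable_fun Omega g ->
  (Lp_norm 2%:E Omega g <= M%:E)%E ->
  mu.-integrable Omega (EFin \o (fun x => g x ^+ 2)) /\
  \int[mu]_(x in Omega) (g x ^+ 2) <= M ^+ 2.
Proof.
move=> mO mg gM.
have L2g : L2 Omega g by split => //; apply: le_lt_trans gM _; rewrite ltey.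
have [_ i2] := (L2P g mO).1 L2g; split=> //.
have h1 : (\int[mu]_(x in Omega) (g x ^+ 2)%:E \is a fin_num)%E.
  exact: integrable_fin_num i2.
move: gM; rewrite Lp_norm2E -(fineK h1) poweR_EFin lee_fin.
rewrite -/(Rintegral _ _ _); set J := Rintegral _ _ _.
have J0 : 0 <= J by apply: Rintegral_ge0 => x _; exact: sqr_ge0.
rewrite powR12_sqrt// => h.
rewrite -(sqr_sqrtr J0) ler_sqr// nnegrE ?sqrtr_ge0//.
by apply: le_trans h; exact: sqrtr_ge0.
Qed.

Lemma L1_le_Lp_norm2 Omega g (M : R) : measurable Omega -> (mu Omega < +oo)%E ->
  measurable_fun Omega g -> (Lp_norm 2%:E Omega g <= M%:E)%E ->
  mu.-integrable Omega (EFin \o g) /\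
  \int[mu]_(x in Omega) `|g x| <= Num.sqrt (fine (mu Omega)) * M.
Proof.
move=> mO fO mg gM; have [i2 J2] := Lp_norm2_le mO mg gM.
have [ig J1] := sqr_Rintegral_le mO fO mg i2; split => //.
have M0 : 0 <= M by rewrite -lee_fin; apply: le_trans gM; exact: Lnorm_ge0.
have m0 : 0 <= fine (mu Omega) by exact: fine_ge0.
rewrite -ler_sqr ?nnegrE ?Rintegral_ge0//; last by rewrite mulr_ge0 ?sqrtr_ge0.
rewrite exprMn sqr_sqrtr//; apply: le_trans J1 _; exact: ler_wpM2l.
Qed.

Lemma L2_integrable Omega g : measurable Omega -> (mu Omega < +oo)%E ->
  L2 Omega g -> mu.-integrable Omega (EFin \o g).
Proof.
move=> mO fO /(L2P _ mO)[mg i2].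
by have [] := sqr_Rintegral_le mO fO mg i2.
Qed.

End L2_integrals.

(** * Lebesgue measure on row vectors *)

Section lebesgue_on_rV.
Context {R : realType}.

Lemma lebesgue_itv_lty (a b : R) (x y : bool) :
  (@lebesgue_measure R [set` Interval (BSide x a) (BSide y b)] < +oo)%E.
Proof. by rewrite lebesgue_measure_itv/=; case: ifP => // _; rewrite -EFinD ltey. Qed.

Lemma ler_coord_norm n (v : 'rV[R]_n) i : `|v ord0 i| <= `|v|.
Proof.
rewrite [leRHS]/Num.norm /= mx_normrE; apply/bigmax_geP; right => /=.
by exists (ord0, i) => //; rewrite mem_index_enum.
Qed.

Lemma measurable_ball_rV n (x : 'rV[R]_n) (r : R) : 0 < r -> measurable (ball x r).
Proof.
move=> r0.
have -> : ball x r = \bigcap_(i in [set: 'I_n])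
    ((fun v : 'rV[R]_n => v ord0 i) @^-1` ball (x ord0 i) r).
  apply/seteqP; split => [y [_ xy] i _|y xy]; first exact: xy.
  by split => // i j; rewrite ord1; exact: xy.
apply: fin_bigcap_measurable => [|i _]; first exact: finite_finset.
rewrite -[X in measurable X]setTI; apply: measurable_coord => //.
exact: measurable_ball.
Qed.

(** The sigma-algebra is generated by the coordinates, hence contains the balls,
    and an open set is a countable union of balls with rational centres. *)
Lemma open_measurable_rV n (U : set 'rV[R]_n) : open U -> measurable U.
Proof.
move=> oU.
pose c (q : 'rV[rat]_n) : 'rV[R]_n := map_mx ratr q.
pose F (p : 'rV[rat]_n * nat) : set 'rV[R]_n :=
  if pselect (ball (c p.1) (p.2.+1%:R^-1) `<=` U) then ball (c p.1) (p.2.+1%:R^-1) else set0.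
suff -> : U = \bigcup_(p in [set: 'rV[rat]_n * nat]) F p.
  apply: countable_bigcupT_measurable => [|p]; first exact: countableP.
  rewrite /F; case: pselect => /= _; last exact: measurable0.
  by apply: measurable_ball_rV; rewrite invr_gt0 ltr0n.
apply/seteqP; split => [x Ux|x [p _]]; last first.
  by rewrite /F; case: pselect => // s; exact: s.
have [e /= e0 eU] := (@nbhs_ballP _ _ x U).1 (open_nbhs_nbhs (conj oU Ux)).
pose k := Num.trunc (2 / e).
pose r : R := k.+1%:R^-1.
have r0 : 0 < r by rewrite invr_gt0 ltr0n.
have r2e : r + r < e.
  rewrite (_ : r + r = 2 * r); last by ring.
  by rewrite ltr_pdivrMr ?ltr0n// mulrC -ltr_pdivrMr// truncnS_gt.
have Hq i : exists q : rat, ball (x ord0 i) r (ratr q).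
  have /rat_in_itvoo[q] : x ord0 i - r < x ord0 i + r by lra.
  rewrite in_itv/= => /andP[q1 q2]; exists q.
  by rewrite /ball/= ltr_distlC q1.
pose q : 'rV[rat]_n := \row_i xchoose (Hq i).
have xq : ball x r (c q).
  split => // i j; rewrite ord1 !mxE; exact: (xchooseP (Hq j)).
exists (q, k) => //; rewrite /F/=; case: pselect => h; first exact: ball_sym.
exfalso; apply: h => y qy; apply: eU; apply: (@le_ball _ _ _ (r + r)); first exact: ltW.
exact: ball_triangle xq qy.
Qed.

Lemma continuous_measurable_rV n (U : set 'rV[R]_n) (g : 'rV[R]_n -> R) :
  open U -> {in U, continuous g} -> measurable_fun U g.
Proof.
move=> oU cg; apply: (measurability _ (RGenOpens.measurableE R)) => //.
move=> _ [_ [a [b ->] <-]]; apply: open_measurable_rV.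
rewrite openE => x [Ux gx]; apply: filterI; first exact: open_nbhs_nbhs.
by apply: (cg x (mem_set Ux)); apply: open_nbhs_nbhs; split.
Qed.

Lemma lebesgue_rVS_setX n (A : set (measurableTypeR R)) (B : set 'rV[R]_n) C :
  measurable A -> measurable B ->
  (@cons_rV R n) @^-1` C = A `*` B ->
  lebesgue_rV n.+1 C = (lebesgue_measure A * lebesgue_rV n B)%E.
Proof. by move=> mA mB E; rewrite /= /lebesgue_cons /pushforward E product_measure1E. Qed.

Definition cube n (M : R) : set 'rV[R]_n := [set v | forall i, v ord0 i \in `[-M, M]].
Arguments cube : clear implicits.

Lemma cubeS n M : (@cons_rV R n) @^-1` (cube n.+1 M) =
  (`[-M, M]%classic : set (measurableTypeR R)) `*` cube n M.
Proof.
apply/seteqP; split => [[t x] h|[t x] [/= ht hx] i] /=.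
  split => /=.
    have := h (lshift n ord0 : 'I_(1 + n)).
    by rewrite [cons_rV _ _ _]row_mxEl mxE.
  by move=> i; have := h (rshift 1 i : 'I_(1 + n)); rewrite [cons_rV _ _ _]row_mxEr.
case: (split_ordP (i : 'I_(1 + n))) => j ->.
  by rewrite [cons_rV _ _ _]row_mxEl mxE.
by rewrite [cons_rV _ _ _]row_mxEr; exact: hx.
Qed.

Lemma measurable_cube n M : measurable (cube n M).
Proof.
have -> : cube n M = \bigcap_(i in [set: 'I_n])
    ((fun v : 'rV[R]_n => v ord0 i) @^-1` `[-M, M]%classic).
  by apply/seteqP; split => [y xy i _|y xy i]; exact: xy.
apply: fin_bigcap_measurable => [|i _]; first exact: finite_finset.
by rewrite -[X in measurable X]setTI; apply: measurable_coord.
Qed.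

Lemma lebesgue_cube_lty n M : (lebesgue_rV n (cube n M) < +oo)%E.
Proof.
elim: n => [|n IH].
  by rewrite /= diracE; case: (_ \in _); rewrite ltey.
rewrite (lebesgue_rVS_setX _ _ (cubeS n M))//; last exact: measurable_cube.
by rewrite lte_mul_pinfty// ?ge0_fin_numE//; exact: lebesgue_itv_lty.
Qed.

Lemma bounded_sub_cube n (A : set 'rV[R]_n) : bounded_set A -> exists M, A `<=` cube n M.
Proof.
move=> [M [_ AM]]; exists (M + 1) => x Ax i.
by rewrite in_itv/= -ler_norml (le_trans (ler_coord_norm _ _))// AM// ltrDl.
Qed.

Lemma bounded_lebesgue_lty n (A : set 'rV[R]_n) : measurable A -> bounded_set A ->
  (lebesgue_rV n A < +oo)%E.
Proof.
move=> mA /bounded_sub_cube[M AM]; apply: le_lt_trans (lebesgue_cube_lty n M).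
by apply: le_measure; rewrite ?inE//; exact: measurable_cube.
Qed.

End lebesgue_on_rV.
Arguments cube {R} n M.

(** * Calculus of smooth functions *)

Section smooth_calculus.
Context {R : realType} {V : normedModType R}.
Implicit Types (U : set V) (f g : V -> R) (s : seq V).

Lemma iter_derive_rcons s v f : iter_derive (rcons s v) f = iter_derive s ('D_v f).
Proof. by rewrite /iter_derive foldr_rcons. Qed.

Lemma smooth_onP U f : smooth_on U f <->
  forall x, U x -> {for x, continuous f} /\ forall v, derivable f x v /\ smooth_on U ('D_v f).
Proof.
split=> [sf x Ux|h s x Ux].
  split=> [|v]; first exact: (sf [::] x Ux).1.
  split=> [|s y Uy]; first exact: (sf [::] x Ux).2.
  by rewrite -iter_derive_rcons; exact: sf.
have [cx dx] := h x Ux.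
elim/last_ind: s => [|s v _]; first by split => // v; have [] := dx v.
by rewrite iter_derive_rcons; exact: (dx v).2.
Qed.

Lemma eq_iter_derive U f g s : open U -> {in U, f =1 g} ->
  {in U, iter_derive s f =1 iter_derive s g}.
Proof.
move=> oU; elim: s => [//|v s IH] fg x /set_mem Ux /=.
apply: near_eq_derive; have : nbhs x U by exact: open_nbhs_nbhs.
by apply: filterS => y Uy; apply: IH => //; exact: mem_set.
Qed.

Lemma smooth_on_local U f : (forall x, U x -> exists W, [/\ open W, W x & smooth_on W f]) ->
  smooth_on U f.
Proof. by move=> h s x /h[W [_ Wx sW]]; exact: sW. Qed.

Lemma smooth_onS U W f : U `<=` W -> smooth_on W f -> smooth_on U f.
Proof. by move=> UW sf s x /UW; exact: sf. Qed.

(** smooth_on has no rank to induct on, and the derivative of a product or of a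
    composition involves the undifferentiated factors again: the Leibniz and
    chain rules are therefore proved by induction on the order k. *)
Definition smooth_upto k U f := forall s x, (size s <= k)%N -> U x ->
  {for x, continuous (iter_derive s f)} /\ forall v, derivable (iter_derive s f) x v.

Lemma smooth_uptoS k U f : smooth_upto k.+1 U f <->
  forall x, U x -> {for x, continuous f} /\
    forall v, derivable f x v /\ smooth_upto k U ('D_v f).
Proof.
split=> [sf x Ux|h s x sk Ux].
  split=> [|v]; first exact: (sf [::] x isT Ux).1.
  split=> [|s y sk Uy]; first exact: (sf [::] x isT Ux).2.
  by rewrite -iter_derive_rcons; apply: sf => //; rewrite size_rcons.
have [cx dx] := h x Ux; move: sk.
elim/last_ind: s => [_|s v _]; first by split => // v; have [] := dx v.
by rewrite size_rcons ltnS iter_derive_rcons => sk; exact: (dx v).2.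
Qed.

Lemma smooth_upto_le k l U f : (k <= l)%N -> smooth_upto l U f -> smooth_upto k U f.
Proof. by move=> kl sf s x sk; apply: sf; exact: leq_trans sk kl. Qed.

Lemma smooth_on_upto U f : smooth_on U f <-> forall k, smooth_upto k U f.
Proof. by split=> [sf k s x _|sf s x]; [exact: sf|exact: (sf (size s))]. Qed.

Lemma eq_smooth_upto k U f g : open U -> {in U, f =1 g} ->
  smooth_upto k U f -> smooth_upto k U g.
Proof.
move=> oU fg sf s x sk Ux; have [cx dx] := sf s x sk Ux.
have E : \forall y \near x, iter_derive s f y = iter_derive s g y.
  have : nbhs x U by exact: open_nbhs_nbhs.
  by apply: filterS => y Uy; apply: eq_iter_derive fg _ _ => //; exact: mem_set.
split=> [|v]; last exact: near_eq_derivable (dx v).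
rewrite /prop_for /continuous_at -(nbhs_singleton E); apply: cvg_trans cx.
exact: near_eq_cvg.
Qed.

Lemma eq_smooth_on U f g : open U -> {in U, f =1 g} -> smooth_on U f -> smooth_on U g.
Proof.
by move=> oU fg /smooth_on_upto sf; apply/smooth_on_upto => k; exact: eq_smooth_upto (sf k).
Qed.

Lemma smooth_uptoD k U f g : open U ->
  smooth_upto k U f -> smooth_upto k U g -> smooth_upto k U (f \+ g).
Proof.
move=> oU; elim: k f g => [|k IH] f g sf sg.
  case=> // x _ Ux; have [cf df] := sf [::] x isT Ux; have [cg dg] := sg [::] x isT Ux.
  by split=> [|v]; [exact: cvgD|exact: derivableD].
apply/smooth_uptoS => x Ux.
have [cf df] := (smooth_uptoS _ _ _).1 sf x Ux.
have [cg dg] := (smooth_uptoS _ _ _).1 sg x Ux.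
split=> [|v]; first exact: cvgD.
have [dfv sfv] := df v; have [dgv sgv] := dg v.
split; first exact: derivableD.
apply: (eq_smooth_upto _ _ (IH _ _ sfv sgv)) => // y /set_mem Uy /=.
have [_ /(_ v)[dfy _]] := (smooth_uptoS _ _ _).1 sf y Uy.
have [_ /(_ v)[dgy _]] := (smooth_uptoS _ _ _).1 sg y Uy.
by rewrite deriveD.
Qed.

Lemma smooth_uptoM k U f g : open U ->
  smooth_upto k U f -> smooth_upto k U g -> smooth_upto k U (f \* g).
Proof.
move=> oU; elim: k f g => [|k IH] f g sf sg.
  case=> // x _ Ux; have [cf df] := sf [::] x isT Ux; have [cg dg] := sg [::] x isT Ux.
  by split=> [|v]; [exact: cvgM|exact: derivableM].
apply/smooth_uptoS => x Ux.
have [cf df] := (smooth_uptoS _ _ _).1 sf x Ux.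
have [cg dg] := (smooth_uptoS _ _ _).1 sg x Ux.
split=> [|v]; first exact: cvgM.
have [dfv sfv] := df v; have [dgv sgv] := dg v.
split; first exact: derivableM.
have sf' := smooth_upto_le (leqnSn k) sf; have sg' := smooth_upto_le (leqnSn k) sg.
apply: (eq_smooth_upto _ _ (smooth_uptoD oU (IH _ _ sf' sgv) (IH _ _ sg' sfv))) => //.
move=> y /set_mem Uy /=.
have [_ /(_ v)[dfy _]] := (smooth_uptoS _ _ _).1 sf y Uy.
have [_ /(_ v)[dgy _]] := (smooth_uptoS _ _ _).1 sg y Uy.
by rewrite deriveM.
Qed.

Lemma smooth_onD U f g : open U -> smooth_on U f -> smooth_on U g -> smooth_on U (f \+ g).
Proof.
by move=> oU /smooth_on_upto sf /smooth_on_upto sg; apply/smooth_on_upto => k; exact: smooth_uptoD.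
Qed.

Lemma smooth_onM U f g : open U -> smooth_on U f -> smooth_on U g -> smooth_on U (f \* g).
Proof.
by move=> oU /smooth_on_upto sf /smooth_on_upto sg; apply/smooth_on_upto => k; exact: smooth_uptoM.
Qed.

Lemma iter_derive_cst s (a : R) : exists b, iter_derive s (fun _ : V => a) = fun=> b.
Proof.
elim: s => [|v s [b IH]]; first by exists a.
by exists 0; rewrite /= IH; apply/funext => x; exact: derive_cst.
Qed.

Lemma smooth_on_cst U (a : R) : smooth_on U (fun=> a).
Proof.
move=> s x _; have [b ->] := iter_derive_cst s a.
by split=> [|v]; [exact: cvg_cst|exact: derivable_cst].
Qed.

(** The case V = R, U = setT of smooth_on, in the form that chain rules use. *)
Definition smooth1 (psi : R -> R) := forall k x, derivable (derive1n k psi) x 1.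

Lemma smooth1_derive1 psi : smooth1 psi -> smooth1 (derive1 psi).
Proof. by move=> sp k x; have := sp k.+1 x; rewrite derive1Sn. Qed.

Lemma smooth1_continuous psi : smooth1 psi -> continuous psi.
Proof.
move=> sp x; apply: differentiable_continuous; apply/derivable1_diffP.
exact: (sp 0%N).
Qed.

(** A directional derivative is a derivative along a line, which reduces product
    and chain rules to one real variable. *)
Lemma is_derive_lineP f x v d :
  is_derive x v f d <-> is_derive (0 : R) 1 (fun h : R => f (h *: v + x)) d.
Proof.
have E : 'D_v f x = 'D_1 (fun h : R => f (h *: v + x)) (0 : R).
  rewrite /derive; set g1 := fun h => _; set g2 := fun h => _.
  suff -> : g1 = g2 by []; apply/funext => h; rewrite /g1 /g2 /=.
  by rewrite addr0 scale0r add0r [_%:A]mulr1.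
split=> -[df dE].
  by apply: DeriveDef; [exact: (derivable1P _ _ _).1|rewrite -E].
by apply: DeriveDef; [exact: (derivable1P _ _ _).2|rewrite E].
Qed.

Lemma is_derive_line f x v d :
  is_derive x v f d -> is_derive (0 : R) 1 (fun h : R => f (h *: v + x)) d.
Proof. exact: (is_derive_lineP f x v d).1. Qed.

Lemma is_derive_of_line f x v d :
  is_derive (0 : R) 1 (fun h : R => f (h *: v + x)) d -> is_derive x v f d.
Proof. exact: (is_derive_lineP f x v d).2. Qed.

Lemma is_derive_comp1 (psi : R -> R) f x v :
  derivable psi (f x) 1 -> derivable f x v ->
  is_derive x v (psi \o f) (derive1 psi (f x) * 'D_v f x).
Proof.
move=> dp df; apply: is_derive_of_line.
apply: (@is_derive1_comp _ psi (fun h : R => f (h *: v + x))).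
  rewrite scale0r add0r; apply: DeriveDef => //.
  by rewrite derive1E.
by apply: is_derive_line; exact: derivableP.
Qed.

Lemma smooth_upto_comp k U (psi : R -> R) f : open U -> smooth1 psi ->
  smooth_upto k U f -> smooth_upto k U (psi \o f).
Proof.
move=> oU; elim: k psi f => [|k IH] psi f sp sf.
  case=> // x _ Ux; have [cf df] := sf [::] x isT Ux.
  split=> [|v]; first by apply: continuous_comp => //; exact: smooth1_continuous.
  by have [] := is_derive_comp1 (sp 0%N (f x)) (df v).
apply/smooth_uptoS => x Ux.
have [cf df] := (smooth_uptoS _ _ _).1 sf x Ux.
split=> [|v]; first by apply: continuous_comp => //; exact: smooth1_continuous.
have [dfv sfv] := df v.
split; first by have [] := is_derive_comp1 (sp 0%N (f x)) dfv.
have sf' := smooth_upto_le (leqnSn k) sf.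
have := smooth_uptoM oU (IH _ _ (smooth1_derive1 sp) sf') sfv.
apply: eq_smooth_upto => // y /set_mem Uy /=.
have [_ /(_ v)[dfy _]] := (smooth_uptoS _ _ _).1 sf y Uy.
by have [_ ->] := is_derive_comp1 (sp 0%N (f y)) dfy.
Qed.

Lemma smooth_on_comp U (psi : R -> R) f : open U -> smooth1 psi ->
  smooth_on U f -> smooth_on U (psi \o f).
Proof.
by move=> oU sp /smooth_on_upto sf; apply/smooth_on_upto => k; exact: smooth_upto_comp.
Qed.

End smooth_calculus.

Section smooth_product.
Context {R : realType} {V : normedModType R}.

Lemma smooth1_smooth_on (psi : R -> R) (U : set R) : smooth1 psi -> smooth_on U psi.
Proof.
move=> sp; apply: (@smooth_onS _ _ U setT) => //.
apply: (@smooth_on_comp R R setT psi id) => //; first exact: openT.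
apply/smooth_onP => x _; split; first exact: cvg_id.
move=> v; split; first exact: derivable_id.
rewrite (_ : 'D_v id = fun=> v); first exact: smooth_on_cst.
by apply/funext => y; rewrite derive_id.
Qed.

Lemma iter_derive_fst (eta : R -> R) (s : seq (R * V)) :
  iter_derive s (eta \o fst) = iter_derive (map fst s) eta \o fst.
Proof. by elim: s => [//|v s /= ->]; apply/funext => z. Qed.

Lemma iter_derive_snd (chi : V -> R) (s : seq (R * V)) :
  iter_derive s (chi \o snd) = iter_derive (map snd s) chi \o snd.
Proof. by elim: s => [//|v s /= ->]; apply/funext => z. Qed.

Lemma smooth_fst (eta : R -> R) : smooth_on setT eta -> smooth_on setT (eta \o (@fst R V)).
Proof.
move=> se s z _; rewrite iter_derive_fst.
have [ce de] := se (map fst s) z.1 I.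
split=> [|v].
  exact: (@continuous_comp (R * V)%type R R fst (iter_derive (map fst s) eta) z cvg_fst ce).
exact: de v.1.
Qed.

Lemma smooth_snd (chi : V -> R) : smooth_on setT chi -> smooth_on setT (chi \o (@snd R V)).
Proof.
move=> se s z _; rewrite iter_derive_snd.
have [ce de] := se (map snd s) z.2 I.
split=> [|v].
  exact: (@continuous_comp (R * V)%type V R snd (iter_derive (map snd s) chi) z cvg_snd ce).
exact: de v.2.
Qed.

Lemma test_fun_prod (A : set R) (B : set V) (eta : R -> R) (chi : V -> R) :
  test_fun A eta -> test_fun B chi ->
  test_fun (A `*` B : set (R * V)) (fun z => eta z.1 * chi z.2).
Proof.
move=> [se [K [cK KA eK]]] [sc [L [cL LB cLz]]]; split.
  have := smooth_onM openT (smooth_fst se) (smooth_snd sc).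
  by apply: eq_smooth_on => //; exact: openT.
exists (K `*` L); split; first exact: compact_setX.
  by move=> z [/KA ? /LB ?].
move=> z /= nz; have [Kz|nKz] := pselect (K z.1).
  have [Lz|nLz] := pselect (L z.2); first by exfalso; apply: nz.
  by rewrite cLz// mulr0.
by rewrite eK// mul0r.
Qed.

Lemma derive_prod_time (eta : R -> R) (chi : V -> R) (z : R * V) :
  derivable eta z.1 1 ->
  'D_(1, 0) (fun z : R * V => eta z.1 * chi z.2) z = derive1 eta z.1 * chi z.2.
Proof.
move=> de; have [_ <-] : is_derive z ((1, 0) : R * V)
    (fun z : R * V => eta z.1 * chi z.2) (derive1 eta z.1 * chi z.2); last by [].
apply/is_derive_lineP.
rewrite (_ : (fun h => _) = (fun h : R => chi z.2 *: eta (h *: 1 + z.1))); last first.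
  by apply/funext => h /=; rewrite scaler0 add0r mulrC.
rewrite mulrC; apply: is_deriveZ; apply: (is_derive_lineP eta z.1 1 _).1.
by apply: DeriveDef => //; rewrite derive1E.
Qed.

End smooth_product.

(** * A smooth cut-off of the real line *)

Section cutoff.
Context {R : realType}.
Implicit Types (q : {poly R}) (x : R).

(** The family of these functions is stable under derivation, which makes each
    of them smooth; theta is smooth because its derivative belongs to it. *)
Definition flat q x : R := if 0 < x then q.[x^-1] * expR (- x^-1) else 0.

Definition theta x : R := if 0 < x then x * expR (- x^-1) else 0.

Lemma expR_ge_pow (k : nat) x : 0 <= x -> (x / k.+1%:R) ^+ k.+1 <= expR x.
Proof.
move=> x0; have {2}-> : x = k.+1%:R * (x / k.+1%:R) by rewrite mulrC divfK// pnatr_eq0.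
rewrite expRM_natl.
rewrite lerXn2r ?nnegrE ?expR_ge0// ?divr_ge0//.
by apply: le_trans (expR_ge1Dx _); rewrite lerDr.
Qed.

Lemma horner_le_pow q : exists C, 0 <= C /\ forall y, 1 <= y -> `|q.[y]| <= C * y ^+ (size q).
Proof.
exists (\sum_(i < size q) `|q`_i|); split; first exact: sumr_ge0.
move=> y y1; have y0 : 0 <= y by exact: le_trans y1.
rewrite horner_coef mulr_suml; apply: le_trans (ler_norm_sum _ _ _) _.
apply: ler_sum => i _; rewrite normrM ler_wpM2l// normrX ger0_norm//.
by apply: ler_weXn2l => //; exact: ltnW.
Qed.

Lemma flat_le q : exists C, forall x, `|x| <= 1 -> `|flat q x| <= C * x ^+ 2.
Proof.
have [C [C0 qC]] := horner_le_pow q.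
set N := size q in qC.
exists (C * N.+2%:R ^+ N.+2) => x x1; rewrite /flat; case: ifPn => x0; last first.
  by rewrite normr0 mulr_ge0 ?sqr_ge0// mulr_ge0// exprn_ge0.
have xi1 : 1 <= x^-1.
  by rewrite invf_ge1//; rewrite ger0_norm// in x1; exact: ltW.
have xi0 : 0 < x^-1 by rewrite invr_gt0.
rewrite normrM (ger0_norm (expR_ge0 _)) expRN.
apply: (@le_trans _ _ (C * x^-1 ^+ N * (x^-1 / N.+2%:R) ^- N.+2)).
  rewrite ler_pM ?invr_ge0 ?expR_ge0// ?qC//.
  rewrite lef_pV2 ?posrE ?expR_gt0 ?exprn_gt0 ?divr_gt0//.
  exact/expR_ge_pow/ltW.
have -> : x ^+ 2 = x^-1 ^- 2 by rewrite exprVn invrK.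
set y := x^-1; have y0 : y != 0 by rewrite gt_eqF.
have yN : y ^+ N != 0 by rewrite expf_neq0.
have M0 : N.+2%:R ^+ N.+2 != 0 :> R by rewrite expf_neq0// pnatr_eq0.
rewrite expr_div_n (_ : y ^+ N.+2 = y ^+ N * y ^+ 2); last by rewrite -exprD addn2.
rewrite le_eqVlt; apply/orP; left; apply/eqP; field.
by rewrite yN M0 y0.
Qed.

Lemma is_derive0_sqr (g : R -> R) (C : R) : g 0 = 0 ->
  (forall x, `|x| <= 1 -> `|g x| <= C * x ^+ 2) -> is_derive (0 : R) (1 : R) g 0.
Proof.
move=> g0 gC.
have C0 : 0 <= C by have := gC 1; rewrite normr1 expr1n mulr1 => /(_ (lexx _)); exact: le_trans.
suff h : h^-1 *: ((g \o shift 0) (h *: 1) - g 0) @[h --> 0^'] --> (0 : R).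
  by apply: DeriveDef; [apply/cvg_ex; exists 0|exact: cvg_lim].
apply/cvgr0Pnorm_lt => e e0 /=.
near=> h.
have hn0 : h != 0 by near: h; exact: nbhs_dnbhs_neq.
have h1 : `|h| <= 1.
  by near: h; apply: dnbhs0_le.
have h2 : `|h| < e / (C + 1).
  by near: h; apply: dnbhs0_lt; rewrite divr_gt0// ltr_wpDl.
rewrite addr0 g0 subr0 [h%:A]mulr1 normrZ normfV.
rewrite mulrC ltr_pdivrMr ?normr_gt0//.
apply: le_lt_trans (gC _ h1) _.
rewrite -real_normK ?num_real// expr2 mulrA ltr_pM2r ?normr_gt0//.
rewrite ltr_pdivlMr in h2; last by rewrite ltr_wpDl.
apply: le_lt_trans h2; rewrite mulrC ler_wpM2l// lerDl//.
Unshelve. all: by end_near. Qed.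

Lemma near_pos x : 0 < x -> \forall y \near x, 0 < y.
Proof. by move=> x0; apply: lt_nbhsr. Qed.

Lemma near_neg x : x < 0 -> \forall y \near x, (0 < y) = false.
Proof.
move=> x0; near=> y; apply/negbTE; rewrite -leNgt ltW//; near: y.
exact: lt_nbhsl.
Unshelve. all: by end_near. Qed.

Lemma is_derive_invr x : x != 0 -> is_derive x 1 (fun y : R => y^-1) (- x ^- 2).
Proof.
move=> x0; have := @is_deriveV R id x 1 1 x0 (is_derive_id _ _).
by move/is_derive_eq; apply; rewrite [_ *: _]mulr1.
Qed.

Lemma is_derive_expRNV x : x != 0 ->
  is_derive x 1 (fun y : R => expR (- y^-1)) (expR (- x^-1) * x ^- 2).
Proof.
move=> x0.
have := @is_derive1_comp R expR (fun y => - y^-1) x _ _ (is_derive_expR _)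
  (is_deriveN (is_derive_invr x0)).
by rewrite opprK.
Qed.

Lemma near_is_derive0 (g : R -> R) x : (\forall y \near x, g y = 0) -> is_derive x 1 g 0.
Proof.
move=> g0; apply: (@near_eq_is_derive R R R (cst 0) g x 1 0).
by apply: filterS g0 => y ->.
Qed.

Lemma is_derive_flat q x : is_derive x 1 (flat q) (flat ('X^2 * (q - q^`())) x).
Proof.
have [x0|x0|->] := ltgtP x 0.
- rewrite [flat _ x]/flat ltNge (ltW x0)/=; apply: near_is_derive0.
  by apply: filterS (near_neg x0) => y; rewrite /flat => ->.
- rewrite [flat _ x]/flat x0.
  apply: (@near_eq_is_derive R R R (fun y => q.[y^-1] * expR (- y^-1))).
    by apply: filterS (near_pos x0) => y; rewrite /flat => ->.
  have xn0 : x != 0 by rewrite gt_eqF.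
  have dq := @is_derive1_comp R (horner q) (fun y => y^-1) x _ _
    (is_derive_poly q x^-1) (is_derive_invr xn0).
  have := is_deriveM dq (is_derive_expRNV xn0); move/is_derive_eq; apply.
  rewrite /= !hornerE/= -![_ *: _]/(_ * _); field.
  by rewrite xn0.
- rewrite [flat _ 0]/flat ltxx; have [C fC] := flat_le q.
  by apply: is_derive0_sqr fC; rewrite /flat ltxx.
Qed.

Lemma smooth1_flat q : smooth1 (flat q).
Proof.
have E p : derive1 (flat p) = flat ('X^2 * (p - p^`())).
  by apply/funext => x; rewrite derive1E; have [_ ->] := is_derive_flat p x.
have H k p : exists p', derive1n k (flat p) = flat p'.
  elim: k p => [|k IH] p; first by exists p; rewrite derive1n0.
  by rewrite derive1Sn E; exact: IH.
by move=> k x; have [p ->] := H k q; have [] := is_derive_flat p x.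
Qed.

Lemma theta0 x : x <= 0 -> theta x = 0.
Proof. by rewrite /theta ltNge => ->. Qed.

Lemma theta_gt0 x : 0 < x -> 0 < theta x.
Proof. by move=> x0; rewrite /theta x0 mulr_gt0// expR_gt0. Qed.

Lemma theta_ge0 x : 0 <= theta x.
Proof. by have [/theta0->//|/theta_gt0/ltW] := leP x 0. Qed.

Lemma theta_le x : 0 <= x -> theta x <= x.
Proof.
move=> x0; rewrite /theta; case: ifPn => // xp.
rewrite ger_pMr// -[leRHS]expR0 ler_expR oppr_le0 invr_ge0//.
Qed.

Lemma is_derive_theta x : is_derive x 1 theta (flat (1 + 'X) x).
Proof.
have [x0|x0|->] := ltgtP x 0.
- rewrite /flat ltNge (ltW x0)/=; apply: near_is_derive0.
  by apply: filterS (near_neg x0) => y; rewrite /theta => ->.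
- rewrite /flat x0.
  apply: (@near_eq_is_derive R R R (fun y => y * expR (- y^-1))).
    by apply: filterS (near_pos x0) => y; rewrite /theta => ->.
  have xn0 : x != 0 by rewrite gt_eqF.
  have := is_deriveM (is_derive_id x 1) (is_derive_expRNV xn0); move/is_derive_eq; apply.
  rewrite /= !hornerE/= -![_ *: _]/(_ * _); field.
  by rewrite xn0.
- rewrite /flat ltxx; have [C fC] := flat_le 1.
  apply: (@is_derive0_sqr _ C); first by rewrite theta0.
  move=> y y1; apply: le_trans (fC y y1).
  rewrite /theta /flat; case: ifPn => // y0; rewrite hornerE mul1r normrM.
  by rewrite ler_piMl.
Qed.

Lemma derive1_theta : derive1 theta = flat (1 + 'X).
Proof. by apply/funext => x; rewrite derive1E; have [_ ->] := is_derive_theta x. Qed.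

Lemma smooth1_theta : smooth1 theta.
Proof.
case=> [|k] x; first by have [] := is_derive_theta x.
by rewrite derive1Sn derive1_theta; exact: smooth1_flat.
Qed.

Lemma derive1_theta_ge0 x : 0 <= derive1 theta x.
Proof.
rewrite derive1_theta /flat; case: ifPn => // x0; rewrite !hornerE.
by rewrite mulr_ge0 ?expR_ge0// addr_ge0// invr_ge0 ltW.
Qed.

Lemma derive1_theta_le1 x : derive1 theta x <= 1.
Proof.
rewrite derive1_theta /flat; case: ifPn => // x0; rewrite !hornerE.
rewrite expRN ler_pdivrMr ?expR_gt0// mul1r; exact: expR_ge1Dx.
Qed.

Lemma theta_lower x : 0 < x -> x - 1 <= theta x.
Proof.
move=> x0; rewrite /theta x0.
have := expR_ge1Dx (- x^-1); rewrite -(ler_pM2l x0) mulrDr mulr1 mulrN divff ?gt_eqF//.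
Qed.

Lemma derive1_theta_lower x : 0 < x -> 1 - x^-1 <= derive1 theta x.
Proof.
move=> x0; rewrite derive1_theta /flat x0 !hornerE.
have xi : 0 < x^-1 by rewrite invr_gt0.
apply: le_trans (expR_ge1Dx _) _; rewrite ler_peMl ?expR_ge0//.
by rewrite lerDl ltW.
Qed.

End cutoff.

(** * Integration by parts *)

Section integration_by_parts_rV.
Context {R : realType}.

Lemma smooth_on_continuous {V : normedModType R} (U : set V) (f : V -> R) :
  smooth_on U f -> {in U, continuous f}.
Proof. by move=> sf x /set_mem Ux; exact: (sf [::] x Ux).1. Qed.

Lemma smooth_on_derive {V : normedModType R} (U : set V) (f : V -> R) v :
  smooth_on U f -> smooth_on U ('D_v f).
Proof. by move=> sf s x Ux; have := sf (rcons s v) x Ux; rewrite iter_derive_rcons. Qed.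

Lemma derive_outside {V : normedModType R} (K : set V) (F : V -> R) v x :
  closed K -> (forall x, ~ K x -> F x = 0) -> ~ K x -> 'D_v F x = 0.
Proof.
move=> cK F0 Kx; rewrite -[RHS](derive_cst (0 : R) x v); apply: near_eq_derive.
have : nbhs x (~` K) by apply: open_nbhs_nbhs; split => //; exact: closed_openC.
by apply: filterS => y /F0.
Qed.

Lemma within_continuous_compact_bounded {T : topologicalType} (K : set T) (F : T -> R) :
  compact K -> {within K, continuous F} -> exists M : R, 0 <= M /\ forall x, K x -> `|F x| <= M.
Proof.
move=> cK cF; have /compact_bounded[M [_ FM]] := continuous_compact cF cK.
exists (`|M| + 1); split=> [|x Kx]; first by rewrite addr_ge0.
have MM : M < `|M| + 1 by have := ler_norm M; lra.
by apply: (FM _ MM); exists x.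
Qed.

Lemma continuous_bounded_itv (h : R -> R) (a b : R) : continuous h ->
  exists K : R, 0 <= K /\ forall x, a <= x <= b -> `|h x| <= K.
Proof.
move=> ch; have [K [K0 hK]] := within_continuous_compact_bounded (@segment_compact R a b)
  (continuous_subspaceT ch).
by exists K; split => // x xab; apply: hK; rewrite /= in_itv.
Qed.

Lemma cons_rV_lshift n (p : measurableTypeR R * 'rV[R]_n) (j : 'I_1) :
  cons_rV p ord0 (lshift n j : 'I_n.+1) = p.1.
Proof. by rewrite [LHS]row_mxEl mxE. Qed.

Lemma cons_rV_rshift n (p : measurableTypeR R * 'rV[R]_n) (j : 'I_n) :
  cons_rV p ord0 (rshift 1 j : 'I_n.+1) = p.2 ord0 j.
Proof. by rewrite [LHS]row_mxEr. Qed.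

Lemma cons_rV_addl n (t : R) (x : 'rV[R]_n) h :
  cons_rV (h + t, x) = h *: basis_vec (@lshift 1 n ord0 : 'I_n.+1) + cons_rV (t, x).
Proof.
apply/rowP => i; rewrite [RHS]mxE [X in _ = X + _]mxE.
case: (split_ordP (i : 'I_(1 + n))) => j ->.
  by rewrite !cons_rV_lshift /basis_vec mxE (ord1 j) !eqxx/= mulr1.
rewrite !cons_rV_rshift /basis_vec mxE eqxx/=.
by rewrite mulr0 add0r.
Qed.

Lemma cons_rV_addr n (t : R) (x : 'rV[R]_n) j h :
  cons_rV (t, h *: basis_vec j + x) = h *: basis_vec (rshift 1 j : 'I_n.+1) + cons_rV (t, x).
Proof.
apply/rowP => i; rewrite [RHS]mxE [X in _ = X + _]mxE.
case: (split_ordP (i : 'I_(1 + n))) => k ->.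
  rewrite !cons_rV_lshift /basis_vec mxE eqxx/=.
  rewrite (_ : (_ == _) = false) ?mulr0 ?add0r//; apply/negbTE/eqP => /(congr1 val)/=.
  by rewrite ord1.
rewrite !cons_rV_rshift /basis_vec !mxE/= (inj_eq (@rshift_inj 1 n)).
by [].
Qed.

Lemma continuous_cons_rVl n (x : 'rV[R]_n) : continuous (fun t : R => cons_rV (t, x)).
Proof.
move=> t; apply/cvg_ballP => e e0.
have : nbhs t (ball t e) by exact: nbhsx_ballx.
apply: filterS => w h; split => // i j; rewrite ord1.
by case: (split_ordP (j : 'I_(1 + n))) => k ->;
  rewrite ?cons_rV_lshift ?cons_rV_rshift//; exact: ballxx.
Qed.

Lemma continuous_cons_rVr n (t : R) : continuous (fun x : 'rV[R]_n => cons_rV (t, x)).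
Proof.
move=> x; have Fx : Filter (nbhs x) by exact: nbhs_filter.
apply/cvg_ballP => e e0.
have : nbhs x (ball x e) by exact: nbhsx_ballx.
apply: filterS => w [_ h]; split => // i j; rewrite ord1.
by case: (split_ordP (j : 'I_(1 + n))) => k ->;
  rewrite ?cons_rV_lshift ?cons_rV_rshift//; exact: ballxx.
Qed.

Lemma Rintegral_derive_itv (F : R -> R) (M : R) :
  (forall t, derivable F t 1) -> continuous (derive1 F) ->
  (forall t, M <= `|t| -> F t = 0) -> 0 < M ->
  \int[@lebesgue_measure R]_(t in `[- M, M]) derive1 F t = 0.
Proof.
move=> dF cF F0 M0; rewrite /Rintegral (@continuous_FTC2 _ _ F).
- by rewrite !F0 ?normrN//= ?subrr// ger0_norm// ltW.
- lra.
- exact: continuous_subspaceT.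
- have cFx t : {for t, continuous F}.
    by apply: differentiable_continuous; exact/derivable1_diffP.
  split=> [x _|//|]; first exact: dF.
  + exact: cvg_at_right_filter (cFx _).
  + exact: cvg_at_left_filter (cFx _).
- by [].
Qed.

Lemma compact_cube n (M : R) : compact (cube n M).
Proof. apply: (@rV_compact _ _ (fun=> `[- M, M]%classic)).
by move=> _; exact: segment_compact. Qed.

Lemma Rintegral_cube_cons n (M : R) (G : 'rV[R]_n.+1 -> R) : continuous G ->
  let G' z := G (cons_rV z) in
  (@lebesgue_measure R \x lebesgue_rV n)%E.-integrable
     ((`[- M, M]%classic : set (measurableTypeR R)) `*` cube n M) (EFin \o G') /\
  \int[lebesgue_rV n.+1]_(x in cube n.+1 M) G x =
  \int[(@lebesgue_measure R \x lebesgue_rV n)%E]_(z in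
     (`[- M, M]%classic : set (measurableTypeR R)) `*` cube n M) G' z.
Proof.
move=> cG G'.
have mG : measurable_fun setT G.
  by apply: continuous_measurable_rV; [exact: openT|move=> x _; exact: cG].
have [K [_ cGK]] := within_continuous_compact_bounded (@compact_cube n.+1 M) (continuous_subspaceT cG).
have mC := @measurable_cube R n.+1 M.
have iG : (lebesgue_rV n.+1).-integrable (cube n.+1 M) (EFin \o G).
  by apply: (bounded_integrable mC (lebesgue_cube_lty _ _) _ cGK); exact: measurable_funTS.
have mA : measurable (`[- M, M]%classic : set (measurableTypeR R)) by [].
have mAB : measurable ((`[- M, M]%classic : set (measurableTypeR R)) `*` cube n M).
  by apply: measurableX => //; exact: measurable_cube.
have mG' : measurable_fun setT G'.
  by apply: (@measurableT_comp _ _ _ _ _ _ G _ (@cons_rV R n)) => //; exact: measurable_cons_rV.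
have iG' : (@lebesgue_measure R \x lebesgue_rV n)%E.-integrable
     ((`[- M, M]%classic : set (measurableTypeR R)) `*` cube n M) (EFin \o G').
  apply: (@bounded_integrable _ _ _ _ _ _ K) => //.
  - apply: product_measure_lty => //; [exact: measurable_cube| |exact: lebesgue_cube_lty].
    exact: lebesgue_itv_lty.
  - exact: measurable_funTS.
  - by move=> z Cz; apply: cGK; rewrite -(cubeS n M) in Cz; exact: Cz.
split=> //; congr fine.
rewrite -(cubeS n M).
have := @integral_pushforward _ _ _ _ _ _ (@measurable_cons_rV R n)
  (@lebesgue_measure R \x lebesgue_rV n)%E (cube n.+1 M) (EFin \o G).
move=> <- //; last by rewrite cubeS.
exact/measurable_EFinP.
Qed.

(** Fubini's theorem isolates one coordinate: for the coordinate i it leaves the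
    fundamental theorem of calculus, for another one the same statement in one
    dimension less. *)
Lemma Rintegral_derive_cube n (F : 'rV[R]_n -> R) (i : 'I_n) (M : R) : 0 < M ->
  (forall x, derivable F x (basis_vec i)) -> continuous ('D_(basis_vec i) F) ->
  (forall x : 'rV[R]_n, (exists j, M <= `|x ord0 j|) -> F x = 0) ->
  \int[lebesgue_rV n]_(x in cube n M) 'D_(basis_vec i) F x = 0.
Proof.
move=> M0; elim: n F i => [|n IH] F i; first by case: i.
move=> dF cF F0.
have [iG ->] := Rintegral_cube_cons M cF.
have mA : measurable (`[- M, M]%classic : set (measurableTypeR R)) by [].
have mB := @measurable_cube R n M.
case: (split_ordP (i : 'I_(1 + n))) => j E.
  have [_ ->] := Rintegral_fubini2 mA mB iG.
  rewrite (@eq_Rintegral _ _ _ _ _ (fun=> 0)); first by rewrite Rintegral_cst// mul0r.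
  move=> x _.
  pose f (t : R) := F (cons_rV (t, x)).
  have df (t : R) : is_derive t 1 f ('D_(basis_vec i) F (cons_rV (t, x))).
    apply: is_derive_of_line.
    rewrite (_ : (fun h => _) = fun h => F (h *: basis_vec i + cons_rV (t, x))).
      by apply: is_derive_line; exact: derivableP.
    apply/funext => h; rewrite /f [_%:A]mulr1 cons_rV_addl E.
    by rewrite (_ : j = ord0)// ord1.
  have df1 : derive1 f = fun t => 'D_(basis_vec i) F (cons_rV (t, x)).
    by apply/funext => t; rewrite derive1E; have [_ ->] := df t.
  rewrite -df1; apply: Rintegral_derive_itv => //.
  - rewrite df1 => t; exact: (continuous_comp (@continuous_cons_rVl _ x t) (cF _)).
  - move=> t Mt; apply: F0; exists (@lshift 1 n ord0 : 'I_n.+1).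
    by rewrite cons_rV_lshift.
have [_ ->] := Rintegral_fubini1 mA mB iG.
rewrite (@eq_Rintegral _ _ _ _ _ (fun=> 0)); first by rewrite Rintegral_cst// mul0r.
move=> t _.
pose f x := F (cons_rV (t, x)).
have df x : is_derive x (basis_vec j) f ('D_(basis_vec i) F (cons_rV (t, x))).
  apply: is_derive_of_line.
  rewrite (_ : (fun h => _) = fun h => F (h *: basis_vec i + cons_rV (t, x))).
    by apply: is_derive_line; exact: derivableP.
  by apply/funext => h; rewrite /f cons_rV_addr E.
have df1 : 'D_(basis_vec j) f = fun x => 'D_(basis_vec i) F (cons_rV (t, x)).
  by apply/funext => x; have [_ ->] := df x.
rewrite -df1; apply: IH.
- by move=> x; have [] := df x.
- rewrite df1 => x; exact: (continuous_comp (@continuous_cons_rVr _ t x) (cF _)).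
- move=> x [k Mk]; apply: F0; exists (rshift 1 k : 'I_n.+1).
  by rewrite cons_rV_rshift.
Qed.

Lemma test_fun_derive {V : normedModType R} (U : set V) (phi : V -> R) v :
  test_fun U phi -> test_fun U ('D_v phi).
Proof.
move=> [sp [K [cK KU pK]]]; split; first exact: smooth_on_derive.
exists K; split => // x Kx; apply: derive_outside pK Kx.
by apply: compact_closed => //; exact: norm_hausdorff.
Qed.

Lemma test_fun_mulr {V : normedModType R} (U : set V) (phi g : V -> R) :
  open U -> test_fun U phi -> smooth_on U g -> test_fun U (phi \* g).
Proof.
move=> oU [sp [K [cK KU pK]]] sg; split; last first.
  by exists K; split => // x Kx /=; rewrite pK// mul0r.
have clK : closed K by apply: compact_closed => //; exact: norm_hausdorff.
apply: smooth_on_local => x _; have [Kx|Kx] := pselect (K x).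
  exists U; split => //; first exact: KU.
  by apply: smooth_onM => //; apply: smooth_onS sp.
exists (~` K); split => //; first exact: closed_openC.
apply: (@eq_smooth_on _ _ _ (fun=> 0)); first exact: closed_openC.
  by move=> y /set_mem /= Ky; rewrite pK// mul0r.
exact: smooth_on_cst.
Qed.

Lemma test_fun_bounded {V : normedModType R} (U : set V) (phi : V -> R) :
  test_fun U phi -> exists M : R, forall x, `|phi x| <= M.
Proof.
move=> [sp [K [cK KU pK]]].
have cp : continuous phi by move=> x; exact: (sp [::] x I).1.
have [M [M0 pM]] := within_continuous_compact_bounded cK (continuous_subspaceT cp).
by exists M => x; have [/pM//|/pK->] := pselect (K x); rewrite normr0.
Qed.

Lemma test_fun_outside {V : normedModType R} (U : set V) (phi : V -> R) x :
  test_fun U phi -> ~ U x -> phi x = 0.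
Proof. by move=> [sp [K [cK KU pK]]] Ux; apply: pK => /KU. Qed.

Section on_rV.
Context {n : nat}.
Local Notation V := 'rV[R]_n.
Local Notation mu := (@lebesgue_rV R n).
Implicit Types (Omega : set V) (phi g : V -> R).

Lemma smooth_measurable Omega g : open Omega -> smooth_on Omega g -> measurable_fun Omega g.
Proof. by move=> oO sg; apply: continuous_measurable_rV => //; exact: smooth_on_continuous. Qed.

Lemma test_fun_measurable Omega phi D : measurable D -> test_fun Omega phi -> measurable_fun D phi.
Proof.
move=> mD [sp _]; apply: (@measurable_funS _ _ _ _ setT) => //.
by apply: smooth_measurable sp; exact: openT.
Qed.

Lemma test_fun_integrable Omega phi : open Omega -> bounded_set Omega ->
  test_fun Omega phi -> mu.-integrable Omega (EFin \o phi).
Proof.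
move=> oO bO tp; have mO := open_measurable_rV oO.
have [M pM] := test_fun_bounded tp.
apply: (@bounded_integrable _ _ _ _ _ _ M) => //; first exact: bounded_lebesgue_lty.
exact: test_fun_measurable tp.
Qed.

Lemma Rintegral_derive_test Omega phi i : open Omega -> test_fun Omega phi ->
  \int[mu]_(x in Omega) 'D_(basis_vec i) phi x = 0.
Proof.
move=> oO tp; have mO := open_measurable_rV oO.
have [sp [K [cK KO pK]]] := tp.
have clK : closed K by apply: compact_closed => //; exact: norm_hausdorff.
have [N KN] := bounded_sub_cube (compact_bounded cK).
pose M : R := `|N| + 1.
have NM : N < M by rewrite /M; have := ler_norm N; lra.
have M0 : 0 < M by rewrite /M; have := normr_ge0 N; lra.
have out (x : V) : (exists j, M <= `|x ord0 j|) -> ~ K x.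
  move=> [j Mj] /KN/(_ j); rewrite in_itv/= -ler_norml; lra.
have D0 x : ~ K x -> 'D_(basis_vec i) phi x = 0 by exact: derive_outside.
have <- := @Rintegral_derive_cube n phi i M M0.
- rewrite Rintegral_mkcond [RHS]Rintegral_mkcond; congr Rintegral.
  apply/funext => x; rewrite !patchE; case: ifPn => xO; case: ifPn => xC //.
    apply: D0 => Kx; move: xC => /negP; apply; apply/mem_set => j.
    by have := KN _ Kx j; rewrite !in_itv/= -!ler_norml; lra.
  rewrite D0// => /KO Ox; move: xO => /negP; apply; exact: mem_set.
- by move=> x; exact: (sp [::] x I).2.
- by move=> x; exact: (sp [:: basis_vec i] x I).1.
- by move=> x /out/pK.
Qed.

(** The product of a test function and a smooth function is a test function, and
    the integral of a derivative of a test function vanishes. *)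
Lemma integration_by_parts_test Omega phi g i : open Omega -> bounded_set Omega ->
  test_fun Omega phi -> smooth_on Omega g ->
  \int[mu]_(x in Omega) (phi x * 'D_(basis_vec i) g x) =
  - \int[mu]_(x in Omega) ('D_(basis_vec i) phi x * g x).
Proof.
move=> oO bO tp sg; have mO := open_measurable_rV oO.
have tpg := test_fun_mulr oO tp sg.
have := Rintegral_derive_test i oO tpg.
have i1 := test_fun_integrable oO bO (test_fun_mulr oO tp (smooth_on_derive (basis_vec i) sg)).
have i2 := test_fun_integrable oO bO (test_fun_mulr oO (test_fun_derive (basis_vec i) tp) sg).
rewrite (@eq_Rintegral _ _ _ _ _ (fun x => phi x * 'D_(basis_vec i) g x + 'D_(basis_vec i) phi x * g x)).
  by rewrite RintegralD// => /eqP; rewrite addr_eq0 => /eqP.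
move=> x /set_mem Ox; rewrite deriveM.
- by rewrite /= [X in _ + X]mulrC.
- exact: (tp.1 [::] x I).2.
- exact: (sg [::] x Ox).2.
Qed.

End on_rV.

End integration_by_parts_rV.

(** * Truncated eigenfunctions *)

Lemma cvg_seq_unique (R : realType) (u : nat -> R) (a b : R) :
  u @ \oo --> a -> u @ \oo --> b -> a = b.
Proof. by apply: cvg_unique; exact: norm_hausdorff. Qed.

Section truncation.
Context {R : realType}.
Implicit Types (delta y : R).

Lemma derive1n_iter_derive k (psi : R -> R) : derive1n k psi = iter_derive (nseq k (1 : R)) psi.
Proof.
elim: k => [|k IH]; first by rewrite derive1n0.
by rewrite derive1nS IH; apply/funext => x; rewrite derive1E.
Qed.

Lemma smooth_on_smooth1 (psi : R -> R) : smooth_on setT psi -> smooth1 psi.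
Proof. by move=> sp k x; rewrite derive1n_iter_derive; exact: (sp _ x I).2. Qed.

(** A smooth soft threshold: it vanishes for |y| <= delta, which turns a function
    vanishing on the boundary into one of compact support, and it is within
    2 delta of the identity. *)
Definition trunc delta y : R := delta * (theta (y / delta - 1) - theta (- y / delta - 1)).

Lemma smooth_on_affine (a b : R) : smooth_on setT (fun y : R => a * y + b).
Proof.
apply: smooth_onD; [exact: openT| |exact: smooth_on_cst].
apply: smooth_onM; [exact: openT|exact: smooth_on_cst|].
apply/smooth_onP => x _; split; first exact: cvg_id.
move=> v; split; first exact: derivable_id.
rewrite (_ : 'D_v _ = fun=> v); first exact: smooth_on_cst.
by apply/funext => y; rewrite derive_id.
Qed.

Lemma smooth1_trunc delta : smooth1 (trunc delta).
Proof.
apply: smooth_on_smooth1.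
have s1 := smooth_on_comp openT smooth1_theta (smooth_on_affine delta^-1 (-1)).
have s2 := smooth_on_comp openT smooth1_theta (smooth_on_affine (- delta^-1) (-1)).
have s3 := smooth_onM openT (@smooth_on_cst R R setT delta)
  (smooth_onD openT s1 (smooth_onM openT (@smooth_on_cst R R setT (-1)) s2)).
apply: (eq_smooth_on openT _ s3) => y _ /=; rewrite /trunc; congr (_ * _).
rewrite mulN1r; congr (theta _ - theta _); rewrite mulrC//.
by rewrite mulNr mulrN.
Qed.

Lemma is_derive_trunc delta y : delta != 0 -> is_derive y 1 (trunc delta)
  (derive1 theta (y / delta - 1) + derive1 theta (- y / delta - 1)).
Proof.
move=> d0.
have da (a : R) : is_derive y 1 (fun y => theta (a * y - 1)) (derive1 theta (a * y - 1) * a).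
  have dt := is_derive_theta (a * y - 1); rewrite -derive1_theta in dt.
  apply: (@is_derive1_comp R theta (fun y => a * y - 1)).
  have := is_deriveB (is_deriveZ a (is_derive_id y 1)) (is_derive_cst (1 : R) y 1).
  by move/is_derive_eq; apply; rewrite subr0 [_ *: _]mulr1.
have := is_deriveZ delta (is_deriveB (da delta^-1) (da (- delta^-1))).
rewrite (_ : (_ \*: _)%R = trunc delta); last first.
  apply/funext => z; rewrite /trunc -[LHS]/(delta * (theta _ - theta _)).
  by rewrite ![_ / delta]mulrC mulrN mulNr.
move/is_derive_eq; apply; rewrite -[LHS]/(delta * _).
have -> : y / delta = delta^-1 * y by rewrite mulrC.
have -> : - y / delta = - delta^-1 * y by rewrite mulrC mulrN mulNr.
by field.
Qed.

Lemma divN_subr1_le0 delta y : 0 < delta -> 0 <= y -> - y / delta - 1 <= 0.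
Proof.
move=> d0 y0; have : 0 <= y / delta by rewrite divr_ge0// ltW.
rewrite mulNr; lra.
Qed.

Lemma natSinv_lt (eps : R) : 0 < eps -> \forall k \near \oo, k.+1%:R^-1 < eps.
Proof. by move=> e0; exact: (near_infty_natSinv_lt (PosNum e0)). Qed.

Lemma derive1_theta0 y : y <= 0 -> derive1 theta y = 0.
Proof. by rewrite derive1_theta /flat ltNge => ->. Qed.

Lemma derive1_trunc delta y : delta != 0 -> derive1 (trunc delta) y =
  derive1 theta (y / delta - 1) + derive1 theta (- y / delta - 1).
Proof. by move=> d0; rewrite derive1E; have [_ ->] := is_derive_trunc y d0. Qed.

Lemma derive1_trunc_le1 delta y : 0 < delta -> `|derive1 (trunc delta) y| <= 1.
Proof.
move=> d0; rewrite derive1_trunc ?gt_eqF//.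
rewrite ger0_norm ?addr_ge0 ?derive1_theta_ge0//.
have [y0|/ltW y0] := leP 0 y.
  rewrite [X in _ + X]derive1_theta0 ?addr0 ?derive1_theta_le1//.
  exact: divN_subr1_le0.
rewrite [X in X + _]derive1_theta0 ?add0r ?derive1_theta_le1//.
have : y / delta <= 0 by rewrite pmulr_lle0// invr_gt0.
lra.
Qed.

Lemma trunc_small delta y : 0 < delta -> `|y| <= delta -> trunc delta y = 0.
Proof.
move=> d0; rewrite ler_norml => /andP[y1 y2]; rewrite /trunc !theta0 ?subrr ?mulr0//.
  by rewrite subr_le0 ler_pdivrMr// mul1r lerNl.
by rewrite subr_le0 ler_pdivrMr// mul1r.
Qed.

Lemma truncN delta y : trunc delta (- y) = - trunc delta y.
Proof. by rewrite /trunc opprK -mulrN opprB. Qed.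

Lemma trunc_ge0 delta y : 0 < delta -> 0 <= y -> trunc delta y = delta * theta (y / delta - 1).
Proof.
move=> d0 y0; rewrite /trunc [X in _ - X]theta0 ?subr0//.
exact: divN_subr1_le0.
Qed.

Lemma trunc_dist_ge0 delta y : 0 < delta -> 0 <= y -> 0 <= trunc delta y <= y /\ y - 2 * delta <= trunc delta y.
Proof.
move=> d0 y0; rewrite trunc_ge0//.
have [yd|yd] := leP (y / delta - 1) 0.
  rewrite theta0// mulr0; move: yd; rewrite subr_le0 ler_pdivrMr// mul1r => yd.
  by split; [rewrite lexx|lra].
have h1 := theta_le (ltW yd); have h2 := theta_lower yd.
have E : delta * (y / delta) = y by field; rewrite gt_eqF.
split.
  apply/andP; split; first by rewrite mulr_ge0 ?theta_ge0// ltW.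
  apply: (@le_trans _ _ (delta * (y / delta - 1))); last by rewrite mulrBr E; lra.
  by rewrite ler_pM2l.
by apply: (@le_trans _ _ (delta * (y / delta - 1 - 1))); [rewrite !mulrBr E; lra|rewrite ler_pM2l].
Qed.

Lemma trunc_dist delta y : 0 < delta -> `|trunc delta y| <= `|y| /\ `|trunc delta y - y| <= 2 * delta.
Proof.
move=> d0; wlog y0 : y / 0 <= y => [H|].
  have [/H//|/ltW y0] := leP 0 y.
  have := H (- y); rewrite oppr_ge0 truncN => /(_ y0).
  by rewrite !normrN opprK (addrC (- _)) distrC.
have [/andP[h1 h2] h3] := trunc_dist_ge0 d0 y0.
rewrite (ger0_norm h1) (ger0_norm y0) distrC ger0_norm ?subr_ge0//; split => //; lra.
Qed.

Lemma trunc_cvg y : (fun k : nat => trunc k.+1%:R^-1 y) @ \oo --> y.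
Proof.
apply/cvgrPdist_le => e e0.
near=> k.
have k0 : 0 < k.+1%:R^-1 :> R by rewrite invr_gt0.
have [_] := trunc_dist y k0; rewrite distrC => /le_trans; apply.
rewrite -ler_pdivlMl// mulrC.
apply: ltW; near: k; apply: natSinv_lt; exact: divr_gt0.
Unshelve. all: by end_near. Qed.

Lemma derive1_trunc_cvg y : 0 < y -> (fun k : nat => derive1 (trunc k.+1%:R^-1) y) @ \oo --> (1 : R).
Proof.
move=> y0; apply/cvgrPdist_le => e e0.
near=> k.
have k0 : 0 < k.+1%:R^-1 :> R by rewrite invr_gt0.
have d0 : k.+1%:R^-1 != 0 :> R by rewrite gt_eqF.
have := derive1_trunc_le1 y k0; rewrite ler_norml => /andP[_ h1].
rewrite ger0_norm ?subr_ge0//.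
rewrite derive1_trunc// [X in _ - (_ + X)]derive1_theta0 ?addr0; last first.
  by apply: divN_subr1_le0 => //; exact: ltW.
have hk : k.+1%:R^-1 <= y * e / (1 + e).
  by apply: ltW; near: k; apply: natSinv_lt; rewrite divr_gt0 ?mulr_gt0// addr_gt0.
set z := y / _ - 1.
have hz : e^-1 <= z.
  rewrite /z invrK lerBrDr.
  rewrite ler_pdivlMr ?addr_gt0// in hk.
  have k1 : 0 < k.+1%:R :> R by rewrite ltr0n.
  have : k.+1%:R * (k.+1%:R^-1 * (1 + e)) <= k.+1%:R * (y * e) by rewrite ler_pM2l.
  rewrite mulrA divff ?gt_eqF// mul1r => h.
  rewrite -(ler_pM2r e0) mulrDl mulVf ?gt_eqF// mul1r (le_trans h)//.
  by rewrite le_eqVlt; apply/orP; left; apply/eqP; ring.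
have z0 : 0 < z by apply: lt_le_trans hz; rewrite invr_gt0.
have := derive1_theta_lower z0.
have : z^-1 <= e by rewrite -[leRHS]invrK lef_pV2 ?posrE// invr_gt0.
lra.
Unshelve. all: by end_near. Qed.

End truncation.

Section dirichlet_smooth.
Context {R : realType} {n : nat}.
Local Notation V := 'rV[R]_n.
Local Notation mu := (@lebesgue_rV R n).
Context (Omega : set V) (oO : open Omega) (bO : bounded_set Omega).
Implicit Types (g h phi : V -> R).

Definition dirichlet_smooth g :=
  smooth_closure Omega g /\ forall x, closure Omega x -> ~ Omega x -> g x = 0.

Let mO : measurable Omega := open_measurable_rV oO.
Let fO : (mu Omega < +oo)%E := bounded_lebesgue_lty mO bO.

Lemma compact_closure_bounded : compact (closure Omega).
Proof.
have [N ON] := bounded_sub_cube bO.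
have clC : closed (cube n N).
  by apply: compact_closed; [exact: norm_hausdorff|exact: compact_cube].
apply: subclosed_compact (@compact_cube R n N) _; first exact: closed_closure.
by move=> x /(closureS ON); rewrite -(closure_id _).1.
Qed.

Lemma smooth_closure_bounded g s : smooth_closure Omega g ->
  exists M : R, forall x, Omega x -> `|iter_derive s g x| <= M.
Proof.
move=> [_ _ /(_ s)[h [ch hE]]]; 
  have [M [_ hM]] := within_continuous_compact_bounded compact_closure_bounded ch.
by exists M => x Ox; rewrite -hE// hM//; exact: subset_closure.
Qed.

Definition cutoff (g : V -> R) (delta : R) : V -> R := (trunc delta \o g) \_ Omega.

Lemma cutoffE g delta x : Omega x -> cutoff g delta x = trunc delta (g x).
Proof. by move=> Ox; rewrite /cutoff patchE mem_set. Qed.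

(** The set where |g| >= delta is a compact subset of Omega, because g vanishes
    on the boundary. *)
Lemma test_fun_cutoff g delta : dirichlet_smooth g -> 0 < delta -> test_fun Omega (cutoff g delta).
Proof.
move=> [[sg cg _] g0] d0.
pose K := closure Omega `&` [set x | delta <= `|g x|].
have KO : K `<=` Omega.
  move=> x [Cx gx]; apply: contrapT => nOx.
  by move: gx; rewrite /= g0// normr0 leNgt d0.
have cK : compact K.
  have clD : closed [set y : R | delta <= `|y|].
    rewrite (_ : [set _ | _] = Num.norm @^-1` [set y : R | delta <= y])//.
    by apply: closed_comp; [move=> x _; exact: norm_continuous|exact: closed_ge].
  have : closed ((g : subspace (closure Omega) -> R) @^-1` [set y : R | delta <= `|y|]).
    by move/continuous_closedP : cg; exact.
  move=> h; have [W clW WE] := (closed_subspaceP _ _).1 h.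
  have -> : K = W `&` closure Omega by rewrite WE /K setIC.
  apply: subclosed_compact compact_closure_bounded _; last exact: subIsetr.
  by apply: closedI => //; exact: closed_closure.
have K0 x : ~ K x -> cutoff g delta x = 0.
  move=> nK; rewrite /cutoff patchE; case: ifPn => // /set_mem Ox /=.
  apply: trunc_small => //; rewrite leNgt; apply/negP => /ltW h; apply: nK.
  by split => //; exact: subset_closure.
split; last by exists K.
have clK : closed K by apply: compact_closed => //; exact: norm_hausdorff.
apply: smooth_on_local => x _; have [Kx|Kx] := pselect (K x).
  exists Omega; split => //; first exact: KO.
  apply: (eq_smooth_on oO _ (smooth_on_comp oO (@smooth1_trunc R delta) sg)).
  by move=> y /set_mem Oy; rewrite cutoffE.
exists (~` K); split => //; first exact: closed_openC.
apply: (@eq_smooth_on _ _ _ (fun=> 0)); first exact: closed_openC.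
  by move=> y /set_mem /= Ky; rewrite K0.
exact: smooth_on_cst.
Qed.

Lemma derive_cutoff g delta x v : dirichlet_smooth g -> 0 < delta -> Omega x ->
  'D_v (cutoff g delta) x = derive1 (trunc delta) (g x) * 'D_v g x.
Proof.
move=> [[sg _ _] _] d0 Ox.
rewrite (@near_eq_derive _ _ _ _ (trunc delta \o g)).
  have [_ ->//] := is_derive_comp1 (@smooth1_trunc R delta 0%N (g x)) ((sg [::] x Ox).2 v).
have : nbhs x Omega by exact: open_nbhs_nbhs.
by apply: filterS => y Oy; rewrite cutoffE.
Qed.

Lemma Rintegral_cutoff_cvg g f : dirichlet_smooth g -> mu.-integrable Omega (EFin \o f) ->
  (fun k : nat => \int[mu]_(x in Omega) (f x * cutoff g k.+1%:R^-1 x)) @ \oo -->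
  \int[mu]_(x in Omega) (f x * g x).
Proof.
move=> dg intf; have [M gM] := smooth_closure_bounded [::] dg.1.
have mf : measurable_fun Omega f by apply/measurable_EFinP; exact: measurable_int intf.
have k0 (k : nat) : 0 < k.+1%:R^-1 :> R by rewrite invr_gt0.
apply: (@Rintegral_cvg _ _ _ _ _ _ _ (fun x => `|f x| * M)) => //.
- move=> k; apply: measurable_funM => //.
  by apply: test_fun_measurable => //; exact: test_fun_cutoff.
- move=> x Ox; apply: cvgM; first exact: cvg_cst.
  rewrite (_ : (fun k => _) = (fun k : nat => trunc k.+1%:R^-1 (g x))).
    exact: trunc_cvg.
  by apply/funext => k; rewrite cutoffE.
- exact: (integrableZr_real M mO (integrable_norm intf)).
- move=> k x Ox; rewrite normrM ler_wpM2l// cutoffE//.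
  have [h _] := trunc_dist (g x) (k0 k).
  exact: le_trans h (gM x Ox).
Qed.

(** The derivative of trunc delta tends to 1 away from 0 only, whence the
    positivity of g. *)
Lemma Rintegral_derive_cutoff_cvg g f v : dirichlet_smooth g ->
  (forall x, Omega x -> 0 < g x) -> mu.-integrable Omega (EFin \o f) ->
  (fun k : nat => \int[mu]_(x in Omega) (f x * 'D_v (cutoff g k.+1%:R^-1) x)) @ \oo -->
  \int[mu]_(x in Omega) (f x * 'D_v g x).
Proof.
move=> dg gp intf; have [M gM] := smooth_closure_bounded [:: v] dg.1.
have mf : measurable_fun Omega f by apply/measurable_EFinP; exact: measurable_int intf.
have k0 (k : nat) : 0 < k.+1%:R^-1 :> R by rewrite invr_gt0.
apply: (@Rintegral_cvg _ _ _ _ _ _ _ (fun x => `|f x| * M)) => //.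
- move=> k; apply: measurable_funM => //.
  apply: test_fun_measurable => //; apply: test_fun_derive; exact: test_fun_cutoff.
- move=> x Ox; apply: cvgM; first exact: cvg_cst.
  rewrite (_ : (fun k => _) = (fun k : nat => derive1 (trunc k.+1%:R^-1) (g x) * 'D_v g x)).
    rewrite -[X in _ --> X]mul1r; apply: cvgM; last exact: cvg_cst.
    by apply: derive1_trunc_cvg; exact: gp.
  by apply/funext => k; rewrite derive_cutoff.
- exact: (integrableZr_real M mO (integrable_norm intf)).
- move=> k x Ox; rewrite normrM ler_wpM2l// derive_cutoff// normrM.
  apply: le_trans (gM x Ox) => /=; rewrite ler_piMl//.
  exact: derive1_trunc_le1.
Qed.

Lemma dirichlet_smooth_measurable g s D : dirichlet_smooth g -> D = Omega ->
  measurable_fun D (iter_derive s g).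
Proof.
move=> [[sg _ _] _] ->; apply: smooth_measurable => //.
elim/last_ind: s g sg => [//|s v IH] g sg.
by rewrite iter_derive_rcons; apply: IH; exact: smooth_on_derive.
Qed.

(** Square integrable functions orthogonal to all test functions vanish, by
    completeness of the eigenfunctions and their approximation by cut-offs. *)
Lemma L2_test_orthogonal e lambda r : dirichlet_eigensystem Omega e lambda -> L2 Omega r ->
  (forall phi, test_fun Omega phi -> \int[mu]_(x in Omega) (r x * phi x) = 0) ->
  {ae mu, forall x, Omega x -> r x = 0}.
Proof.
move=> [se de oe [_ ce] _] L2r rt; apply: ce => // i.
have dei : dirichlet_smooth (e i) by split; [exact: se|exact: (de i).2].
have := Rintegral_cutoff_cvg dei (L2_integrable mO fO L2r).
rewrite (_ : (fun k => _) = fun=> 0).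
  by move=> h; apply/esym; apply: cvg_seq_unique h; exact: cvg_cst.
by apply/funext => k; apply: rt; apply: test_fun_cutoff => //; rewrite invr_gt0.
Qed.

End dirichlet_smooth.

(** * Weak derivatives and the Green identity *)

Section weak_derivatives.
Context {R : realType} {n : nat}.
Local Notation V := 'rV[R]_n.
Local Notation mu := (@lebesgue_rV R n).
Context (Omega : set V) (oO : open Omega) (bO : bounded_set Omega).
Implicit Types (g h phi : V -> R).

Let mO : measurable Omega := open_measurable_rV oO.
Let fO : (mu Omega < +oo)%E := bounded_lebesgue_lty mO bO.

Lemma L2_test phi : test_fun Omega phi -> L2 Omega phi.
Proof.
move=> tp; have mp := test_fun_measurable mO tp; apply/(L2P _ mO); split => //.
have [M pM] := test_fun_bounded tp.
apply: (@bounded_integrable _ _ _ _ _ _ (M ^+ 2)) => //; first exact: measurable_funX.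
move=> x _; rewrite normrX ler_sqr ?nnegrE//.
exact: le_trans (pM x).
Qed.

Lemma L2_lin (a b : R) g h : L2 Omega g -> L2 Omega h -> L2 Omega (fun x => a * g x + b * h x).
Proof.
move=> /(L2P _ mO)[mg ig] /(L2P _ mO)[mh ih]; apply/(L2P _ mO).
have m1 : measurable_fun Omega (fun x => a * g x + b * h x).
  by apply: measurable_funD; apply: measurable_funM.
split=> //.
have iS : mu.-integrable Omega (EFin \o (fun x => 2 * a ^+ 2 * g x ^+ 2 + 2 * b ^+ 2 * h x ^+ 2)).
  have := integrableD mO (integrableZl mO (2 * a ^+ 2) ig) (integrableZl mO (2 * b ^+ 2) ih).
  by apply: eq_integrable => // x _ /=.
apply: (le_integrable_real mO _ iS); first exact: measurable_funX.
move=> x _; rewrite ger0_norm ?sqr_ge0//.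
have := sqr_ge0 (a * g x - b * h x); nra.
Qed.

Lemma integrable_mul_test g phi : L2 Omega g -> test_fun Omega phi ->
  mu.-integrable Omega (EFin \o (fun x => g x * phi x)).
Proof.
move=> L2g tp; have [M pM] := test_fun_bounded tp.
apply: (@integrable_mul_bounded _ _ _ _ _ _ _ M) => //; first exact: L2_integrable.
exact: test_fun_measurable tp.
Qed.

Lemma test_fun_iter_derive phi s : test_fun Omega phi -> test_fun Omega (iter_derive s phi).
Proof. by move=> tp; elim: s => [//|v s IH]; exact: test_fun_derive. Qed.

Lemma weak_derivP k g s : sobolev Omega k g -> (size s <= k)%N ->
  L2 Omega (weak_deriv Omega s g) /\ is_weak_deriv Omega s g (weak_deriv Omega s g).
Proof.
move=> [_ sg] sk; have [h [L2h wh]] := sg s sk.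
by apply: (@getPex _ [set h | L2 Omega h /\ is_weak_deriv Omega s g h]); exists h.
Qed.

Lemma weak_deriv_test phi s : (size s <= 1)%N -> test_fun Omega phi ->
  is_weak_deriv Omega s phi (iter_derive (map basis_vec s) phi).
Proof.
move=> s1 tp chi tc; case: s s1 => [|i [|//]] _ /=; first by rewrite expr0 mul1r.
rewrite expr1 mulN1r (integration_by_parts_test i oO bO tp)//.
by apply: (smooth_onS _ tc.1).
Qed.

Lemma is_weak_deriv_sub s g g' h h' : L2 Omega g -> L2 Omega g' -> L2 Omega h -> L2 Omega h' ->
  is_weak_deriv Omega s g h -> is_weak_deriv Omega s g' h' ->
  is_weak_deriv Omega s (g \- g') (h \- h').
Proof.
move=> L2g L2g' L2h L2h' wg wg' phi tp.
have tD := test_fun_iter_derive (map basis_vec s) tp.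
under eq_Rintegral do rewrite mulrBl.
under [in RHS]eq_Rintegral do rewrite mulrBl.
rewrite !RintegralB//; try exact: integrable_mul_test.
by rewrite wg// wg'// mulrBr.
Qed.

Section uniqueness.
Context (e : nat -> V -> R) (lambda : nat -> R).
Context (eig : dirichlet_eigensystem Omega e lambda).

(** The difference of two weak derivatives is orthogonal to all test functions. *)
Lemma weak_deriv_unique s g h h' : L2 Omega h -> L2 Omega h' ->
  is_weak_deriv Omega s g h -> is_weak_deriv Omega s g h' ->
  {ae mu, forall x, Omega x -> h x = h' x}.
Proof.
move=> L2h L2h' wh wh'.
have L2r : L2 Omega (fun x => 1 * h x + (-1) * h' x) by exact: L2_lin.
have := L2_test_orthogonal oO bO eig L2r.
have rt phi : test_fun Omega phi ->
    \int[mu]_(x in Omega) ((1 * h x + (-1) * h' x) * phi x) = 0.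
  move=> tp; under eq_Rintegral do rewrite mul1r mulN1r mulrBl.
  rewrite RintegralB//; try exact: integrable_mul_test.
  have := wh phi tp; rewrite (wh' phi tp) => /mulfI.
  by rewrite signr_eq0 => /(_ isT) ->; rewrite subrr.
move=> /(_ rt); apply: filterS => x H Ox; apply/eqP; rewrite -subr_eq0.
by have := H Ox; rewrite mul1r mulN1r => ->.
Qed.

(** By uniqueness, the weak derivative of v - phi is the difference of the two
    derivatives; its norm in L^2(Omega) dominates the one in L^1(Omega). *)
Lemma sobolev_norm_L1 (v phi : V -> R) (s : seq 'I_n) (eps : R) :
  sobolev Omega 1 v -> test_fun Omega phi -> (size s <= 1)%N ->
  (sobolev_norm Omega 1 (v \- phi)%R <= eps%:E)%E ->
  \int[mu]_(x in Omega) `|weak_deriv Omega s v x - iter_derive (map basis_vec s) phi x|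
    <= Num.sqrt (fine (mu Omega)) * eps.
Proof.
move=> sv tp s1 Neps.
have [L2w ww] := weak_derivP sv s1.
have L2d : L2 Omega (iter_derive (map basis_vec s) phi).
  exact/L2_test/test_fun_iter_derive.
have L2v : L2 Omega v := sv.1.
have L2p := L2_test tp.
have wd := is_weak_deriv_sub L2v L2p L2w L2d ww (weak_deriv_test s1 tp).
have L2wd : L2 Omega (weak_deriv Omega s v \- iter_derive (map basis_vec s) phi).
  have := L2_lin 1 (-1) L2w L2d; congr L2; apply/funext => x.
  by rewrite mul1r mulN1r.
have [L2h wh] : [set h | L2 Omega h /\ is_weak_deriv Omega s (v \- phi) h]
    (weak_deriv Omega s (v \- phi)).
  by apply: getPex; exists (weak_deriv Omega s v \- iter_derive (map basis_vec s) phi).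
have ae := weak_deriv_unique L2h L2wd wh wd.
have Nle : (Lp_norm 2%:E Omega (weak_deriv Omega s (v \- phi)%R) <= eps%:E)%E.
  apply: le_trans Neps.
  have pos j (t : j.-tuple 'I_n) :
     (0 <= Lp_norm 2%:E Omega (weak_deriv Omega t (v \- phi)%R))%E by exact: Lnorm_ge0.
  have sz : (size s < 2)%N by [].
  rewrite /sobolev_norm (bigD1 (Ordinal sz))//= (bigD1 (in_tuple s))//=.
  rewrite -addeA leeDl// adde_ge0//.
    by apply: sume_ge0 => t _; exact: pos.
  by apply: sume_ge0 => j _; apply: sume_ge0 => t _; exact: pos.
have [ih Jh] := L1_le_Lp_norm2 mO fO L2h.1 Nle.
rewrite (@ae_eq_Rintegral_real _ _ _ _ _ _ (fun x => `|weak_deriv Omega s (v \- phi) x|))//.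
- by apply: measurableT_comp => //; exact: L2wd.1.
- by apply: measurableT_comp => //; exact: L2h.1.
- by apply: filterS ae => x H Ox; rewrite H.
Qed.

Lemma weak_deriv0 g : L2 Omega g ->
  {ae mu, forall x, Omega x -> weak_deriv Omega [::] g x = g x}.
Proof.
move=> L2g.
have w0 : is_weak_deriv Omega [::] g g by move=> phi _ /=; rewrite expr0 mul1r.
have [L2h wh] : [set h | L2 Omega h /\ is_weak_deriv Omega [::] g h] (weak_deriv Omega [::] g).
  by apply: getPex; exists g.
exact: weak_deriv_unique wh w0.
Qed.

Lemma Rintegral_test_cvg (v : V -> R) (phi : nat -> V -> R) (s : seq 'I_n) (q : V -> R) (M : R) :
  sobolev Omega 1 v -> (forall k, test_fun Omega (phi k)) -> (size s <= 1)%N ->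
  (fun k => sobolev_norm Omega 1 (v \- phi k)) @ \oo --> 0%E ->
  measurable_fun Omega q -> (forall x, Omega x -> `|q x| <= M) ->
  (fun k => \int[mu]_(x in Omega) (iter_derive (map basis_vec s) (phi k) x * q x)) @ \oo -->
  \int[mu]_(x in Omega) (weak_deriv Omega s v x * q x).
Proof.
move=> sv tp s1 Ncv mq qM.
have [L2w ww] := weak_derivP sv s1.
have tD k := test_fun_iter_derive (map basis_vec s) (tp k).
have iw := L2_integrable mO fO L2w.
have iwq := integrable_mul_bounded mO iw mq qM.
apply/cvgrPdist_le => eps eps0.
pose c := Num.sqrt (fine (mu Omega)) * `|M| + 1.
have c0 : 0 < c by rewrite ltr_wpDl// mulr_ge0// sqrtr_ge0.
have d0 : 0 < eps / c by exact: divr_gt0.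
have : \forall k \near \oo, (sobolev_norm Omega 1 (v \- phi k)%R <= (eps / c)%:E)%E.
  have nb : nbhs (0 : \bar R)%E [set y | (y < (eps / c)%:E)%E].
    by apply: open_nbhs_nbhs; split; [exact: open_ereal_lt_ereal|rewrite /= lte_fin].
  have H : \forall k \near \oo, (sobolev_norm Omega 1 (v \- phi k)%R < (eps / c)%:E)%E := Ncv _ nb.
  by apply: filterS H => k; exact: ltW.
apply: filterS => k Nk.
have id := test_fun_integrable oO bO (tD k).
have idq := integrable_mul_bounded mO id mq qM.
rewrite -RintegralB//.
have idiff : mu.-integrable Omega (EFin \o (fun x => weak_deriv Omega s v x - iter_derive (map basis_vec s) (phi k) x)).
  exact: (integrableB_real mO iw id).
apply: le_trans (le_normr_Rintegral mO _) _.
  exact: (integrableB_real mO iwq idq).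
apply: (@le_trans _ _ (\int[mu]_(x in Omega) (`|weak_deriv Omega s v x - iter_derive (map basis_vec s) (phi k) x| * `|M|))).
  apply: le_Rintegral => //.
  - have := integrable_norm (integrableB mO iwq idq).
    by apply: eq_integrable.
  - exact: (integrableZr_real `|M| mO (integrable_norm idiff)).
  - move=> x Ox; rewrite -mulrBl normrM ler_wpM2l//.
    by apply: le_trans (qM x Ox) _; exact: ler_norm.
rewrite RintegralZr//; last exact: integrable_norm.
have := sobolev_norm_L1 sv (tp k) s1 Nk => h.
apply: le_trans (_ : Num.sqrt (fine (mu Omega)) * (eps / c) * `|M| <= _).
  exact: ler_wpM2r.
rewrite mulrAC mulrA ler_pdivrMr// mulrC ler_pM2l// /c lerDl//.
Qed.

(** Two integrations by parts, each the limit of one without boundary terms: in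
    the first one g is approximated by truncations, which are test functions,
    in the second one v by the test functions that converge to it. *)
Lemma green_identity v g (l : R) : sobolev Omega 2 v -> sobolev0 Omega v ->
  dirichlet_smooth Omega g -> (forall x, Omega x -> 0 < g x) ->
  (forall x, Omega x -> - laplacian g x = l * g x) ->
  (forall i, mu.-integrable Omega (EFin \o (fun x => weak_deriv Omega [:: i; i] v x * g x))) /\
  \int[mu]_(x in Omega) (weak_laplacian Omega v x * g x) =
  - l * \int[mu]_(x in Omega) (v x * g x).
Proof.
move=> sv2 [sv1 [phi [tp Ncv]]] dg gp Lg.
have [[sg _ _] _] := dg.
have [M0 gM0] := smooth_closure_bounded bO [::] dg.1.
have mg : measurable_fun Omega g by exact: (dirichlet_smooth_measurable oO [::] dg).
have iv : mu.-integrable Omega (EFin \o v) by exact: L2_integrable sv1.1.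
have iwd s : (size s <= 2)%N -> mu.-integrable Omega (EFin \o weak_deriv Omega s v).
  by move=> s2; have [L2w _] := weak_derivP sv2 s2; exact: L2_integrable.
have i2g i : mu.-integrable Omega (EFin \o (fun x => weak_deriv Omega [:: i; i] v x * g x)).
  exact: (integrable_mul_bounded mO (iwd [:: i; i] isT) mg gM0).
have ivD i : mu.-integrable Omega (EFin \o (fun x => v x * iter_derive [:: basis_vec i; basis_vec i] g x)).
  have [M2 gM2] := smooth_closure_bounded bO [:: basis_vec i; basis_vec i] dg.1.
  apply: (integrable_mul_bounded mO iv _ gM2).
  exact: (dirichlet_smooth_measurable oO _ dg).
have k0 (k : nat) : 0 < k.+1%:R^-1 :> R by rewrite invr_gt0.
have step1 i : \int[mu]_(x in Omega) (weak_deriv Omega [:: i; i] v x * g x) =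
    - \int[mu]_(x in Omega) (weak_deriv Omega [:: i] v x * 'D_(basis_vec i) g x).
  have c1 := Rintegral_cutoff_cvg oO bO dg (iwd [:: i; i] isT).
  have c2 := Rintegral_derive_cutoff_cvg oO bO (v := basis_vec i) dg gp (iwd [:: i] isT).
  apply: cvg_seq_unique c1 _.
  rewrite (_ : (fun k => _) = (fun k : nat => - \int[mu]_(x in Omega) (weak_deriv Omega [:: i] v x *
    'D_(basis_vec i) (cutoff Omega g k.+1%:R^-1) x))); first exact: cvgN.
  apply/funext => k; have tc := test_fun_cutoff oO bO dg (k0 k).
  have [_ w2] := weak_derivP sv2 (isT : (size [:: i; i] <= 2)%N).
  have [_ w1] := weak_derivP sv2 (isT : (size [:: i] <= 2)%N).
  have := w2 _ tc; rewrite /= expr2 mulrNN mulr1 mul1r => <-.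
  by have := w1 _ (test_fun_derive (basis_vec i) tc); rewrite /= expr1 mulN1r => ->.
have step2 i : \int[mu]_(x in Omega) (weak_deriv Omega [:: i] v x * 'D_(basis_vec i) g x) =
    - \int[mu]_(x in Omega) (v x * iter_derive [:: basis_vec i; basis_vec i] g x).
  have [M1 gM1] := smooth_closure_bounded bO [:: basis_vec i] dg.1.
  have [M2 gM2] := smooth_closure_bounded bO [:: basis_vec i; basis_vec i] dg.1.
  have m1 := dirichlet_smooth_measurable oO [:: basis_vec i] dg (erefl _).
  have m2 := dirichlet_smooth_measurable oO [:: basis_vec i; basis_vec i] dg (erefl _).
  have c1 := Rintegral_test_cvg sv1 tp (isT : (size [:: i] <= 1)%N) Ncv m1 gM1.
  have c2 := Rintegral_test_cvg sv1 tp (isT : (size ([::] : seq 'I_n) <= 1)%N) Ncv m2 gM2.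
  apply: cvg_seq_unique c1 _.
  rewrite (_ : (fun k => _) = (fun k : nat => - \int[mu]_(x in Omega) (phi k x *
     iter_derive [:: basis_vec i; basis_vec i] g x))).
    have -> : \int[mu]_(x in Omega) (v x * iter_derive [:: basis_vec i; basis_vec i] g x) =
       \int[mu]_(x in Omega) (weak_deriv Omega [::] v x * iter_derive [:: basis_vec i; basis_vec i] g x).
      apply: ae_eq_Rintegral_real => //.
      - by apply: measurable_funM => //; exact: sv1.1.1.
      - by apply: measurable_funM => //; exact: (weak_derivP sv1 (isT : (size ([::] : seq 'I_n) <= 1)%N)).1.1.
      - by apply: filterS (weak_deriv0 sv1.1) => x H Ox; rewrite H.
    exact: cvgN.
  apply/funext => k /=.
  by rewrite (integration_by_parts_test i oO bO (tp k) (smooth_on_derive (basis_vec i) sg)) opprK.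
split=> //.
have -> : \int[mu]_(x in Omega) (weak_laplacian Omega v x * g x) =
    \sum_(i < n) \int[mu]_(x in Omega) (weak_deriv Omega [:: i; i] v x * g x).
  have [_ <-] := Rintegral_sum_seq (index_enum 'I_n) mO i2g.
  by apply: eq_Rintegral => x _; rewrite /weak_laplacian mulr_suml.
under eq_bigr do rewrite step1 step2 opprK.
have <- : \int[mu]_(x in Omega) (v x * laplacian g x) =
    \sum_(i < n) \int[mu]_(x in Omega) (v x * iter_derive [:: basis_vec i; basis_vec i] g x).
  have [_ <-] := Rintegral_sum_seq (index_enum 'I_n) mO ivD.
  by apply: eq_Rintegral => x _; rewrite /laplacian mulr_sumr.
rewrite -RintegralZl//; last first.
  exact: (integrable_mul_bounded mO iv mg gM0).
apply: eq_Rintegral => x /set_mem Ox; have := Lg x Ox.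
by move/eqP; rewrite eqr_oppLR => /eqP ->; rewrite mulrN mulrCA mulNr.
Qed.

End uniqueness.

End weak_derivatives.

(** * A smooth step function *)

Section step.
Context {R : realType}.
Local Notation leb := (@lebesgue_measure R).

Definition bump (s : R) : R := theta s * theta (1 - s).

Lemma smooth1_bump : smooth1 bump.
Proof.
apply: smooth_on_smooth1.
have s1 : smooth_on setT theta := smooth1_smooth_on (@smooth1_theta R).
have s2 := smooth_on_comp openT (@smooth1_theta R) (smooth_on_affine (-1) 1).
apply: (eq_smooth_on openT _ (smooth_onM openT s1 s2)) => y _ /=.
by rewrite /bump; congr (_ * theta _); ring.
Qed.

Lemma bump_ge0 s : 0 <= bump s.
Proof. by rewrite mulr_ge0 ?theta_ge0. Qed.

Lemma bump_gt0 s : 0 < s < 1 -> 0 < bump s.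
Proof. by move=> /andP[s0 s1]; rewrite mulr_gt0 ?theta_gt0// subr_gt0. Qed.

Lemma bump_le0 s : s <= 0 -> bump s = 0.
Proof. by move=> s0; rewrite /bump theta0// mul0r. Qed.

Lemma bump_ge1 s : 1 <= s -> bump s = 0.
Proof. by move=> s1; rewrite /bump [X in _ * X]theta0 ?mulr0// subr_le0. Qed.

(** Starting the integral at -1, where bump vanishes, puts 0 in the interior of
    the interval on which the fundamental theorem of calculus applies. *)
Definition bump_int (s : R) : R := \int[leb]_(t in `[-1, s]) bump t.

Lemma continuous_bump : continuous bump.
Proof. exact/smooth1_continuous/smooth1_bump. Qed.

Lemma bump_integrable (a b : R) : leb.-integrable `[a, b] (EFin \o bump).
Proof.
apply: continuous_compact_integrable; first exact: segment_compact.
by apply: continuous_subspaceT; exact: continuous_bump.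
Qed.

Lemma bump_int_le0 s : s <= 0 -> bump_int s = 0.
Proof.
move=> s0; rewrite /bump_int (@eq_Rintegral _ _ _ _ _ (fun=> 0)).
  by rewrite Rintegral_cst// mul0r.
move=> t /set_mem /=; rewrite in_itv/= => /andP[_ ts].
by apply: bump_le0; exact: le_trans ts s0.
Qed.

Lemma bump_int_ge1 s : 1 <= s -> bump_int s = bump_int 1.
Proof.
move=> s1; rewrite /bump_int Rintegral_mkcond [RHS]Rintegral_mkcond; congr Rintegral.
apply/funext => t; rewrite !patchE; case: ifPn; case: ifPn => //; rewrite ?inE ?notin_setE/= !in_itv/=.
  move=> h /andP[t1 ts]; apply: bump_ge1; rewrite leNgt; apply/negP => t1'.
  by apply: h; rewrite t1 ltW.
by move=> /andP[h1 h2] h; exfalso; apply: h; rewrite h1 (le_trans h2).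
Qed.

Lemma is_derive_bump_int (s : R) : is_derive s 1 bump_int (bump s).
Proof.
have [s0|s0] := ltP s 0.
  rewrite bump_le0 ?ltW//; apply: near_is_derive0.
  have : nbhs s [set t | t < 0] by exact: lt_nbhsl.
  by apply: filterS => t /= t0; rewrite bump_int_le0// ltW.
have s1 : s < s + 1 by lra.
have s2 : -1 < s by lra.
have [d e] := @continuous_FTC1_closed R bump (-1) s (s + 1) s1
  (bump_integrable _ _) s2 (@continuous_bump s).
by apply: DeriveDef; [exact: d|rewrite -derive1E; exact: e].
Qed.

Lemma continuous_bump_int : continuous bump_int.
Proof.
move=> s; apply: differentiable_continuous; apply/derivable1_diffP.
by have [] := is_derive_bump_int s.
Qed.

Lemma bump_int_nd s t : s <= t -> bump_int s <= bump_int t.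
Proof.
rewrite le_eqVlt => /predU1P[->//|st].
have [c _ E] := @MVT R bump_int bump s t st (fun x _ => is_derive_bump_int x)
  (continuous_subspaceT continuous_bump_int).
by rewrite -subr_ge0 E mulr_ge0 ?bump_ge0// subr_ge0 ltW.
Qed.

Lemma bump_int1_gt0 : 0 < bump_int 1.
Proof.
have [c c01 E] := @MVT R bump_int bump 0 1 ltr01 (fun x _ => is_derive_bump_int x)
  (continuous_subspaceT continuous_bump_int).
move: E; rewrite (@bump_int_le0 0)// !subr0 mulr1 => ->.
by apply: bump_gt0; move: c01; rewrite in_itv.
Qed.

Definition step (s : R) : R := (bump_int 1)^-1 * bump_int s.
Definition dstep (s : R) : R := (bump_int 1)^-1 * bump s.

Lemma is_derive_step (s : R) : is_derive s 1 step (dstep s).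
Proof. exact: (is_deriveZ (bump_int 1)^-1 (is_derive_bump_int s)). Qed.

Lemma derive1_step : derive1 step = dstep.
Proof. by apply/funext => s; rewrite derive1E; have [_ ->] := is_derive_step s. Qed.

Lemma smooth1_step : smooth1 step.
Proof.
case=> [|k] x; first by have [] := is_derive_step x.
rewrite derive1Sn derive1_step; move: k x.
apply: smooth_on_smooth1.
exact: (smooth_onM openT (@smooth_on_cst R R setT (bump_int 1)^-1)
  (smooth1_smooth_on smooth1_bump)).
Qed.

Lemma step_le0 s : s <= 0 -> step s = 0.
Proof. by move=> s0; rewrite /step (bump_int_le0 s0) mulr0. Qed.

Lemma step_ge1 s : 1 <= s -> step s = 1.
Proof. by move=> s0; rewrite /step (bump_int_ge1 s0) mulVf// gt_eqF// bump_int1_gt0. Qed.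

Lemma step_ge0 s : 0 <= step s.
Proof.
rewrite mulr_ge0 ?invr_ge0 ?(ltW bump_int1_gt0)//.
have [s0|/ltW s0] := leP 0 s; last by rewrite bump_int_le0.
by rewrite -(@bump_int_le0 0)// bump_int_nd.
Qed.

Lemma step_le1 s : step s <= 1.
Proof.
have [s1|/ltW s1] := leP 1 s; first by rewrite step_ge1.
by rewrite -(@step_ge1 1)// /step ler_pM2l ?invr_gt0 ?bump_int1_gt0// bump_int_nd.
Qed.

Lemma dstep_ge0 s : 0 <= dstep s.
Proof. by rewrite mulr_ge0 ?bump_ge0// invr_ge0 ltW// bump_int1_gt0. Qed.

Lemma dstep_eq0 s : (s <= 0) || (1 <= s) -> dstep s = 0.
Proof. by rewrite /dstep => /orP[/bump_le0|/bump_ge1] ->; rewrite mulr0. Qed.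

Lemma continuous_dstep : continuous dstep.
Proof. by move=> s; apply: cvgM; [exact: cvg_cst|exact: continuous_bump]. Qed.

(** A smooth version of the indicator of t >= a, equal to it outside ]a, a + eps[. *)
Definition astep (a eps t : R) : R := step (eps^-1 * t + - (eps^-1 * a)).
Definition dastep (a eps t : R) : R := dstep (eps^-1 * t + - (eps^-1 * a)) * eps^-1.

Lemma astep_argE (a eps t : R) : eps^-1 * t + - (eps^-1 * a) = (t - a) / eps.
Proof. by rewrite -mulrBr mulrC. Qed.

Lemma smooth_astep a eps : smooth_on setT (astep a eps).
Proof. exact: (smooth_on_comp openT smooth1_step (smooth_on_affine eps^-1 (- (eps^-1 * a)))). Qed.

Lemma is_derive_astep (a eps t : R) : is_derive t 1 (astep a eps) (dastep a eps t).
Proof.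
apply: (@is_derive1_comp R step (fun t => eps^-1 * t + - (eps^-1 * a))).
  exact: is_derive_step.
have := is_deriveD (is_deriveZ eps^-1 (is_derive_id t 1)) (is_derive_cst (- (eps^-1 * a)) t 1).
by move/is_derive_eq; apply; rewrite addr0 [_ *: _]mulr1.
Qed.

Lemma astep_le a eps t : 0 < eps -> t <= a -> astep a eps t = 0.
Proof.
move=> e0 ta; rewrite /astep step_le0// astep_argE pmulr_lle0 ?invr_gt0//.
by rewrite subr_le0.
Qed.

Lemma astep_ge a eps t : 0 < eps -> a + eps <= t -> astep a eps t = 1.
Proof.
move=> e0 ta; rewrite /astep step_ge1// astep_argE ler_pdivlMr// mul1r.
by rewrite lerBrDl.
Qed.

Lemma dastep_eq0 a eps t : 0 < eps -> (t <= a) || (a + eps <= t) -> dastep a eps t = 0.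
Proof.
move=> e0 h; rewrite /dastep dstep_eq0 ?mul0r// astep_argE.
rewrite pmulr_lle0 ?invr_gt0// subr_le0 ler_pdivlMr// mul1r lerBrDl.
by case/orP : h => ->//; rewrite orbT.
Qed.

Lemma dastep_ge0 a eps t : 0 < eps -> 0 <= dastep a eps t.
Proof. by move=> e0; rewrite mulr_ge0 ?dstep_ge0// invr_ge0 ltW. Qed.

Lemma continuous_dastep a eps : continuous (dastep a eps).
Proof.
move=> t; apply: cvgM; last exact: cvg_cst.
apply: (continuous_comp (f := fun t => eps^-1 * t + - (eps^-1 * a)) (g := dstep)).
  by apply: cvgD; [apply: cvgM; [exact: cvg_cst|exact: cvg_id]|exact: cvg_cst].
exact: continuous_dstep.
Qed.

Lemma dastep_integrable a eps (x y : R) : leb.-integrable `[x, y] (EFin \o dastep a eps).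
Proof.
apply: continuous_compact_integrable; first exact: segment_compact.
by apply: continuous_subspaceT; exact: continuous_dastep.
Qed.

Lemma Rintegral_dastep a eps (S : R) : 0 < eps -> 0 <= a -> a + eps <= S ->
  \int[leb]_(t in `]0, S[) dastep a eps t = 1.
Proof.
move=> e0 a0 aS; have S0 : 0 < S by apply: lt_le_trans aS; exact: ltr_wpDl.
have -> : \int[leb]_(t in `]0, S[) dastep a eps t = \int[leb]_(t in `[0, S]) dastep a eps t.
  rewrite Rintegral_mkcond [RHS]Rintegral_mkcond; congr Rintegral.
  apply/funext => t; rewrite !patchE; case: ifPn; case: ifPn => //.
    by move=> /negP h1 /set_mem h2; exfalso; apply: h1; apply/mem_set; exact: subset_itv_oo_cc h2.
  move=> /set_mem /=; rewrite in_itv/= => /andP[t0 tS].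
  rewrite notin_setE/= in_itv/= => /negP; rewrite negb_and -!leNgt => /orP[h|h].
    by rewrite dastep_eq0// (le_trans h a0).
  by rewrite dastep_eq0// (le_trans aS h) orbT.
rewrite /Rintegral (@continuous_FTC2 _ _ (astep a eps))//=.
- by rewrite astep_ge// astep_le// subr0.
- by apply: continuous_subspaceT; exact: continuous_dastep.
- have cF t : {for t, continuous (astep a eps)}.
    by apply: differentiable_continuous; apply/derivable1_diffP; have [] := is_derive_astep a eps t.
  split=> [t _||].
  + by have [] := is_derive_astep a eps t.
  + exact: cvg_at_right_filter (cF _).
  + exact: cvg_at_left_filter (cF _).
- by move=> t _; rewrite derive1E; have [_ ->] := is_derive_astep a eps t.
Qed.

(** A weight of integral 1 on [a, a + eps] averages the values of y near a. *)
Lemma Rintegral_dastep_dist a eps (S c : R) (y : R -> R) : 0 < eps -> 0 <= a -> a + eps <= S ->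
  leb.-integrable `]0, S[ (EFin \o (fun t => dastep a eps t * y t)) ->
  (forall t, a <= t <= a + eps -> `|y t - y a| <= c) ->
  `|\int[leb]_(t in `]0, S[) (dastep a eps t * y t) - y a| <= c.
Proof.
move=> e0 a0 aS iy yc.
have mI : measurable (`]0, S[%classic : set (measurableTypeR R)) by [].
have id : leb.-integrable `]0, S[ (EFin \o dastep a eps).
  by apply: integrableS (dastep_integrable a eps 0 S) => //; exact: subset_itv_oo_cc.
have idz (z : R) : leb.-integrable `]0, S[ (EFin \o (fun t => dastep a eps t * z)).
  exact: (integrableZr_real z mI id).
have E z : \int[leb]_(t in `]0, S[) (dastep a eps t * z) = z.
  by rewrite (RintegralZr _ mI)// Rintegral_dastep// mul1r.
rewrite -[X in _ - X](E (y a)) -RintegralB//.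
have iB : leb.-integrable `]0, S[ (EFin \o (fun t => dastep a eps t * y t - dastep a eps t * y a)).
  exact: (integrableB_real mI iy (idz (y a))).
apply: le_trans (le_normr_Rintegral mI iB) _.
rewrite -[leRHS](E c); apply: le_Rintegral => //; first exact: integrable_norm iB.
move=> t _; rewrite -mulrBr normrM ger0_norm ?dastep_ge0//.
have [h|] := boolP ((t <= a) || (a + eps <= t)); first by rewrite dastep_eq0// !mul0r.
rewrite negb_or -!ltNge => /andP[h1 h2].
by rewrite ler_wpM2l ?dastep_ge0// yc// !ltW.
Qed.

End step.

(** * Functions of time with values in L^1 *)

Section weighted_integrals.
Context {R : realType} {n : nat}.
Local Notation V := 'rV[R]_n.
Local Notation mu := (@lebesgue_rV R n).
Context (Omega : set V) (mO : measurable Omega) (fO : (mu Omega < +oo)%E).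
Context (S : R) (g : V -> R) (Mg : R).
Context (mg : measurable_fun Omega g) (gM : forall x, Omega x -> `|g x| <= Mg).

Definition in_oo (t : R) := 0 < t < S.
Definition in_cc (t : R) := 0 <= t <= S.

Lemma in_oo_cc t : in_oo t -> in_cc t.
Proof. by move=> /andP[h1 h2]; apply/andP; rewrite !ltW. Qed.

Lemma Rintegral_mul_weight_le (p D : V -> R) (C c : R) :
  mu.-integrable Omega (EFin \o p) -> mu.-integrable Omega (EFin \o D) ->
  (forall x, Omega x -> `|p x| <= C * D x + c) ->
  `|\int[mu]_(x in Omega) (p x * g x)| <=
    `|Mg| * (C * \int[mu]_(x in Omega) D x + c * fine (mu Omega)).
Proof.
move=> ip iD pD.
have iCD : mu.-integrable Omega (EFin \o (fun x => C * D x)).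
  exact: (integrableZl_real C mO iD).
have ic := integrable_cst_real c mO fO.
have iS : mu.-integrable Omega (EFin \o (fun x => C * D x + c)).
  exact: (integrableD_real mO iCD ic).
apply: le_trans (le_normr_Rintegral mO (integrable_mul_bounded mO ip mg gM)) _.
rewrite -RintegralZl// -Rintegral_cst// -RintegralD// -RintegralZl//.
apply: le_Rintegral => //.
- exact: integrable_norm (integrable_mul_bounded mO ip mg gM).
- exact: (integrableZl_real `|Mg| mO iS).
- move=> x Ox; rewrite normrM mulrC ler_pM// ?pD//.
  by apply: le_trans (gM Ox) _; exact: ler_norm.
Qed.

(** C^0([0, S]; L^1(Omega)) *)
Definition C0_int (w : R -> V -> R) :=
  (forall t, in_cc t -> mu.-integrable Omega (EFin \o w t)) /\
  forall t, in_cc t -> forall eps : R, 0 < eps -> exists delta : R, 0 < delta /\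
    forall s, in_cc s -> `|s - t| < delta -> \int[mu]_(x in Omega) `|w s x - w t x| <= eps.

Definition continuous_cc (P : R -> R) := forall t, in_cc t -> forall eps : R, 0 < eps ->
  exists delta : R, 0 < delta /\ forall s, in_cc s -> `|s - t| < delta -> `|P s - P t| <= eps.

Lemma continuous_cc_lin (a b : R) P Q : continuous_cc P -> continuous_cc Q ->
  continuous_cc (fun t => a * P t + b * Q t).
Proof.
move=> cP cQ t tS eps e0.
pose m := `|a| + `|b| + 1; have m0 : 0 < m by rewrite ltr_wpDl// addr_ge0.
have [d1 [d10 H1]] := cP t tS _ (divr_gt0 e0 m0); have [d2 [d20 H2]] := cQ t tS _ (divr_gt0 e0 m0).
exists (Num.min d1 d2); split; first by rewrite lt_min d10.
move=> s sS; rewrite lt_min => /andP[s1 s2].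
rewrite (_ : _ - _ = a * (P s - P t) + b * (Q s - Q t)); last by ring.
apply: le_trans (ler_normD _ _) _; rewrite !normrM.
have h1 : `|a| * `|P s - P t| <= `|a| * (eps / m) by rewrite ler_wpM2l// H1.
have h2 : `|b| * `|Q s - Q t| <= `|b| * (eps / m) by rewrite ler_wpM2l// H2.
have h3 : (`|a| + `|b|) / m <= 1 by rewrite ler_pdivrMr// mul1r /m; lra.
apply: (@le_trans _ _ (eps * ((`|a| + `|b|) / m))); last by apply: ler_piMr h3; exact: ltW.
by apply: le_trans (lerD h1 h2) _; rewrite -mulrDl mulrCA.
Qed.

Lemma C0_int_pairing w : C0_int w -> continuous_cc (fun s => \int[mu]_(x in Omega) (w s x * g x)).
Proof.
move=> [iw cw] t tS eps e0.
have M0 : 0 < `|Mg| + 1 by rewrite ltr_wpDl.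
have [delta [d0 H]] := cw t tS _ (divr_gt0 e0 M0); exists delta; split => // s sS st.
have id := integrableB_real mO (iw s sS) (iw t tS).
have -> : \int[mu]_(x in Omega) (w s x * g x) - \int[mu]_(x in Omega) (w t x * g x) =
    \int[mu]_(x in Omega) ((w s x - w t x) * g x).
  have i1 := integrable_mul_bounded mO (iw s sS) mg gM; have i2 := integrable_mul_bounded mO (iw t tS) mg gM.
  by rewrite -RintegralB//; apply: eq_Rintegral => x _; ring.
apply: le_trans (Rintegral_mul_weight_le (C := 1) (c := 0) id (integrable_norm id) _) _.
  by move=> x _ /=; rewrite mul1r addr0.
rewrite mul1r mul0r addr0; apply: (@le_trans _ _ (`|Mg| * (eps / (`|Mg| + 1)))).
  by rewrite ler_wpM2l//; exact: H.
have h1 : `|Mg| / (`|Mg| + 1) <= 1 by rewrite ler_pdivrMr// mul1r; lra.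
rewrite mulrCA; apply: ler_piMr h1; exact: ltW.
Qed.

End weighted_integrals.

(** * Weak time derivatives *)

Section time_derivative.
Context {R : realType} {n : nat}.
Local Notation V := 'rV[R]_n.
Local Notation mu := (@lebesgue_rV R n).
Local Notation leb := (@lebesgue_measure R).
Context (Omega : set V) (oO : open Omega) (bO : bounded_set Omega).
Context (S : R).
Implicit Types (v w : R -> V -> R) (g : V -> R).

Let mO : measurable Omega := open_measurable_rV oO.
Let fO : (mu Omega < +oo)%E := bounded_lebesgue_lty mO bO.

Definition oo_itv (a b : R) : set (measurableTypeR R) := `]a, b[%classic.
Definition oc_itv (a b : R) : set (measurableTypeR R) := `]a, b]%classic.
Local Notation I := (oo_itv 0 S).

Lemma measurable_oo_itv a b : measurable (oo_itv a b). Proof. by rewrite /oo_itv. Qed.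
Lemma measurable_oc_itv a b : measurable (oc_itv a b). Proof. by rewrite /oc_itv. Qed.
Hint Resolve measurable_oo_itv measurable_oc_itv : core.

Lemma oo_itv_lty a b : (leb (oo_itv a b) < +oo)%E. Proof. exact: lebesgue_itv_lty. Qed.
Lemma oc_itv_lty a b : (leb (oc_itv a b) < +oo)%E. Proof. exact: lebesgue_itv_lty. Qed.

Let mI : measurable (I `*` Omega) := measurableX (measurable_oo_itv 0 S) mO.

(** L^infty(0, S; L^2(Omega)), with joint measurability *)
Definition Linf_L2 v := measurable_fun (I `*` Omega) (fun z => v z.1 z.2) /\
  exists M : R, {ae leb, forall t, I t -> L2 Omega (v t) /\ (Lp_norm 2%:E Omega (v t) <= M%:E)%E}.

Lemma integral_norm_le d (T : measurableType d) (m : {measure set T -> \bar R}) (D : set T) (f : T -> R) (M : R) :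
  measurable D -> m.-integrable D (EFin \o f) -> \int[m]_(x in D) `|f x| <= M ->
  (\int[m]_(x in D) `|f x|%:E <= M%:E)%E.
Proof.
move=> mD intf fM; rewrite -[leLHS]fineK ?lee_fin//.
by have h := integrable_fin_num mD (integrable_norm intf); exact: h.
Qed.

Lemma Linf_L2_integrable v : Linf_L2 v ->
  (leb \x mu)%E.-integrable (I `*` Omega) (EFin \o (fun z => v z.1 z.2)) /\
  (leb \x mu)%E.-integrable (I `*` Omega) (EFin \o (fun z => v z.1 z.2 ^+ 2)).
Proof.
move=> [mv [M vM]]; split.
  apply: (@integrable_prod_bounded _ _ _ _ _ _ _ _ _ _ mO _ (Num.sqrt (fine (mu Omega)) * M)) => //.
    exact: oo_itv_lty.
  apply: filterS vM => t H It; have [L2v NM] := H It.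
  have [i1 J1] := L1_le_Lp_norm2 mO fO L2v.1 NM.
  exact: integral_norm_le mO i1 J1.
apply: (@integrable_prod_bounded _ _ _ _ _ _ _ _ _ _ mO _ (M ^+ 2)) => //.
- exact: oo_itv_lty.
- exact: measurable_funX.
apply: filterS vM => t H It; have [L2v NM] := H It.
have [i1 J1] := Lp_norm2_le mO L2v.1 NM.
apply: (integral_norm_le mO i1); rewrite (@eq_Rintegral _ _ _ _ _ (fun x => v t x ^+ 2))//.
by move=> x _; rewrite ger0_norm// sqr_ge0.
Qed.

Lemma Linf_L2_mul_integrable v (h : R -> R) g (Mh Mg : R) : Linf_L2 v ->
  measurable_fun I h -> (forall t, I t -> `|h t| <= Mh) ->
  measurable_fun Omega g -> (forall x, Omega x -> `|g x| <= Mg) ->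
  (leb \x mu)%E.-integrable (I `*` Omega) (EFin \o (fun z => v z.1 z.2 * (h z.1 * g z.2))).
Proof.
move=> Lv mh hM mg gM; have [iv _] := Linf_L2_integrable Lv.
apply: (@integrable_mul_bounded _ _ _ _ _ _ _ (Mh * Mg)) => //.
  apply: measurable_funM.
    by apply: (measurable_comp (F := I)) => //; [move=> _ [z [? ?] <-]|exact: measurable_funTS].
  by apply: (measurable_comp (F := Omega)) => //; [move=> _ [z [? ?] <-]|exact: measurable_funTS].
by move=> z [It Ox]; rewrite normrM ler_pM// ?hM// gM.
Qed.

(** The definition of the weak derivative is tested with eta(t) chi(x), where chi
    runs through truncations of g; dominated convergence replaces chi by g. *)
Lemma weak_time_derivative v w (T : \bar R) (eta : R -> R) g : (S%:E < T)%E ->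
  Linf_L2 v -> Linf_L2 w -> is_time_deriv Omega T v w ->
  test_fun I eta -> dirichlet_smooth Omega g ->
  \int[(leb \x mu)%E]_(z in I `*` Omega) (v z.1 z.2 * (derive1 eta z.1 * g z.2)) =
  - \int[(leb \x mu)%E]_(z in I `*` Omega) (w z.1 z.2 * (eta z.1 * g z.2)).
Proof.
move=> ST Lv Lw vw te dg.
have [M gM] := smooth_closure_bounded bO [::] dg.1.
have mg : measurable_fun Omega g by exact: (dirichlet_smooth_measurable oO [::] dg).
have k0 (k : nat) : 0 < k.+1%:R^-1 :> R by rewrite invr_gt0.
have tde : test_fun I (derive1 eta).
  have := test_fun_derive (1 : R) te; congr test_fun.
  by apply/funext => t; rewrite derive1E.
have mte (h : R -> R) : test_fun I h -> measurable_fun I h.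
  move=> [sh _]; apply: measurable_funTS; apply: continuous_measurable_fun => t.
  exact: (sh [::] t Logic.I).1.
have lim (h : R -> R) u : test_fun I h -> Linf_L2 u ->
    (fun k : nat => \int[(leb \x mu)%E]_(z in I `*` Omega) (u z.1 z.2 * (h z.1 * cutoff Omega g k.+1%:R^-1 z.2)))
    @ \oo --> \int[(leb \x mu)%E]_(z in I `*` Omega) (u z.1 z.2 * (h z.1 * g z.2)).
  move=> th Lu; have [Mh hM] := test_fun_bounded th.
  have ck (k : nat) x : Omega x -> `|cutoff Omega g k.+1%:R^-1 x| <= M.
    move=> Ox; rewrite cutoffE//; have [c1 _] := trunc_dist (g x) (k0 k).
    exact: le_trans c1 (gM x Ox).
  have iu k := Linf_L2_mul_integrable Lu (mte h th) (fun t _ => hM t)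
     (test_fun_measurable mO (test_fun_cutoff oO bO dg (k0 k))) (ck k).
  apply: (@Rintegral_cvg _ _ _ (leb \x mu)%E (I `*` Omega)
    (fun k z => u z.1 z.2 * (h z.1 * cutoff Omega g k.+1%:R^-1 z.2))
    (fun z => u z.1 z.2 * (h z.1 * g z.2))
    (fun z => `|u z.1 z.2| * (Mh * M))) => //.
  - by move=> k; apply/measurable_EFinP; exact: measurable_int (iu k).
  - move=> [t x] [It Ox] /=; apply: cvgM; first exact: cvg_cst.
    apply: cvgM; first exact: cvg_cst.
    rewrite (_ : (fun k => _) = (fun k : nat => trunc k.+1%:R^-1 (g x))).
      exact: trunc_cvg.
    by apply/funext => k; rewrite cutoffE.
  - have [iu1 _] := Linf_L2_integrable Lu.
    exact: (integrableZr_real (Mh * M) mI (integrable_norm iu1)).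
  - move=> k [t x] [It Ox] /=; rewrite normrM ler_wpM2l// normrM ler_pM//.
    exact: ck.
have l1 := lim _ v tde Lv; have l2 := lim _ w te Lw.
apply: cvg_seq_unique l1 _.
rewrite (_ : (fun k => _) = (fun k : nat => - \int[(leb \x mu)%E]_(z in I `*` Omega)
   (w z.1 z.2 * (eta z.1 * cutoff Omega g k.+1%:R^-1 z.2)))); first exact: cvgN.
apply/funext => k.
have tc := test_fun_cutoff oO bO dg (k0 k).
have IT : (I : set R) `<=` Ioo0 T.
  move=> t /=; rewrite /oo_itv/= in_itv/= => /andP[t0 tS]; split => //.
  by apply: lt_trans ST; rewrite lte_fin.
have te' : test_fun (Ioo0 T) eta.
  by case: te => se [K [cK KI K0]]; split => //; exists K; split => // t /KI/IT.
have := vw _ (test_fun_prod te' tc).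
have restr (f : R * V -> R) : (forall t x, ~ I t -> f (t, x) = 0) ->
    \int[(leb \x mu)%E]_(z in cylinder Omega T) f z = \int[(leb \x mu)%E]_(z in I `*` Omega) f z.
  move=> f0; rewrite Rintegral_mkcond [RHS]Rintegral_mkcond; congr Rintegral.
  apply/funext => -[t x]; rewrite !patchE; case: ifPn; case: ifPn => //.
    by move=> /negP h1 /set_mem [h2 h3]; apply: f0 => It; apply: h1; apply/mem_set; split.
  move=> /set_mem [It Ox] /negP h; exfalso; apply: h; apply/mem_set; split => //.
  exact: IT.
rewrite !restr.
- move=> E; rewrite -{}E; apply: eq_Rintegral => -[t x] _ /=.
  by rewrite derive_prod_time//=; exact: (te.1 [::] t Logic.I).2.
- by move=> t x nI /=; rewrite (test_fun_outside te nI) mul0r mulr0.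
- move=> t x nI; rewrite derive_prod_time/=; last exact: (te.1 [::] t Logic.I).2.
  by rewrite (test_fun_outside tde nI) mul0r mulr0.
Qed.

(** The values are square integrable, but continuity is only in L^1(Omega). *)
Definition C0_L1 v := (forall t, in_cc S t -> L2 Omega (v t)) /\ C0_int Omega S v.

Lemma C0_L1_integrable v t : C0_L1 v -> 0 <= t <= S -> mu.-integrable Omega (EFin \o v t).
Proof. by move=> [_ [iv _]]; exact: iv. Qed.

(** A continuous L^1-valued map with a bounded weak time derivative: tested
    against the difference of two steepening steps, the definition of the weak
    derivative turns into the fundamental theorem of calculus. *)
Lemma weak_time_increment v w (T : \bar R) g (t1 t2 : R) : (S%:E < T)%E ->
  Linf_L2 v -> Linf_L2 w -> C0_L1 v -> is_time_deriv Omega T v w ->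
  dirichlet_smooth Omega g -> 0 < t1 -> t1 < t2 -> t2 < S ->
  \int[mu]_(x in Omega) (v t2 x * g x) - \int[mu]_(x in Omega) (v t1 x * g x) =
  \int[(leb \x mu)%E]_(z in oc_itv t1 t2 `*` Omega) (w z.1 z.2 * g z.2).
Proof.
move=> ST Lv Lw cv vw dg t10 t12 t2S.
have [M gM] := smooth_closure_bounded bO [::] dg.1.
have mg : measurable_fun Omega g by exact: (dirichlet_smooth_measurable oO [::] dg).
pose y t := \int[mu]_(x in Omega) (v t x * g x).
(* widths for which both steps end before S *)
pose ep (k : nat) : R := (S - t2) * k.+2%:R^-1.
have ep0 k : 0 < ep k by rewrite mulr_gt0 ?subr_gt0.
have epS k : t2 + ep k < S.
  rewrite -ltrBrDl /ep gtr_pMr ?subr_gt0// invf_lt1 ?ltr0n// ltr1n.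
  by [].
have ep_small (c : R) : 0 < c -> \forall k \near \oo, ep k < c.
  move=> c0; have d0 : 0 < c / (S - t2) by rewrite divr_gt0// subr_gt0.
  apply: filterS (natSinv_lt d0) => k kc.
  rewrite /ep mulrC -ltr_pdivlMr ?subr_gt0//; apply: le_lt_trans kc.
  by rewrite lef_pV2 ?posrE ?ltr0n// ler_nat.
pose eta k t := astep t1 (ep k) t - astep t2 (ep k) t.
pose deta k t := dastep t1 (ep k) t - dastep t2 (ep k) t.
have deE k : derive1 (eta k) = deta k.
  apply/funext => t; rewrite derive1E.
  by have [_ ->] := is_deriveB (is_derive_astep t1 (ep k) t) (is_derive_astep t2 (ep k) t).
have te k : test_fun I (eta k).
  split.
    have s2 := smooth_onM openT (@smooth_on_cst R R setT (-1)) (smooth_astep t2 (ep k)).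
    apply: (eq_smooth_on openT _ (smooth_onD openT (smooth_astep t1 (ep k)) s2)) => t _ /=.
    by rewrite mulN1r.
  exists `[t1, t2 + ep k]%classic; split; first exact: segment_compact.
    move=> t /=; rewrite /oo_itv/= !in_itv/= => /andP[h1 h2].
    by rewrite (lt_le_trans t10 h1) (le_lt_trans h2 (epS k)).
  move=> t /=; rewrite in_itv/= => /negP; rewrite negb_and -!ltNge => /orP[h|h].
    by rewrite /eta !astep_le ?subrr// ltW// (lt_trans h t12).
  rewrite /eta !astep_ge ?subrr//; first exact: ltW.
  by apply: ltW; apply: le_lt_trans h; rewrite lerD2r ltW.
have md a k : measurable_fun I (dastep a (ep k)).
  by apply: measurable_funTS; apply: continuous_measurable_fun; exact: continuous_dastep.
have bd a k : exists Md : R, forall t, I t -> `|dastep a (ep k) t| <= Md.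
  have [Md [_ dM]] := continuous_bounded_itv 0 S (@continuous_dastep R a (ep k)).
  by exists Md => t It; apply: dM; move: It; rewrite /oo_itv/= in_itv/= => /andP[h1 h2]; rewrite !ltW.
have one a k : leb.-integrable `]0, S[ (EFin \o (fun t => dastep a (ep k) t * y t)) /\
    \int[(leb \x mu)%E]_(z in I `*` Omega) (v z.1 z.2 * (dastep a (ep k) z.1 * g z.2)) =
    \int[leb]_(t in `]0, S[) (dastep a (ep k) t * y t).
  have [Md dM] := bd a k.
  have iv := Linf_L2_mul_integrable Lv (md a k) dM mg gM.
  have [i1 E] := Rintegral_fubini1 (measurable_oo_itv 0 S) mO iv.
  have inner t : t \in I -> \int[mu]_(x in Omega) (v t x * (dastep a (ep k) t * g x)) =
      dastep a (ep k) t * y t.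
    move=> /set_mem It; have tS : 0 <= t <= S.
      by move: It; rewrite /oo_itv/= in_itv/= => /andP[h1 h2]; rewrite !ltW.
    rewrite /y -RintegralZl//; last first.
      exact: integrable_mul_bounded mO (C0_L1_integrable cv tS) mg gM.
    by apply: eq_Rintegral => x _; rewrite mulrCA.
  split; last by rewrite E; exact: eq_Rintegral.
  by apply: eq_integrable i1 => // t It /=; rewrite inner.
have LHS k : \int[(leb \x mu)%E]_(z in I `*` Omega) (v z.1 z.2 * (derive1 (eta k) z.1 * g z.2)) =
    \int[leb]_(t in `]0, S[) (dastep t1 (ep k) t * y t) -
    \int[leb]_(t in `]0, S[) (dastep t2 (ep k) t * y t).
  have [i1 E1] := one t1 k; have [i2 E2] := one t2 k.
  have [Md1 dM1] := bd t1 k; have [Md2 dM2] := bd t2 k.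
  have iv1 := Linf_L2_mul_integrable Lv (md t1 k) dM1 mg gM.
  have iv2 := Linf_L2_mul_integrable Lv (md t2 k) dM2 mg gM.
  rewrite -E1 -E2 -RintegralB//; apply: eq_Rintegral => z _.
  by rewrite deE /deta; ring.
have one_cv a : 0 < a -> a <= t2 -> (fun k => \int[leb]_(t in `]0, S[) (dastep a (ep k) t * y t)) @ \oo --> y a.
  move=> a0 at2; apply/cvgrPdist_le => c c0.
  have aS : 0 <= a <= S by rewrite ltW//= (le_trans at2 (ltW t2S)).
  have [delta [d0 H]] := C0_int_pairing mO fO mg gM cv.2 aS c0.
  apply: filterS (ep_small _ d0) => k kd.
  rewrite distrC; apply: Rintegral_dastep_dist => //; first exact: ltW.
  - by apply: ltW; apply: le_lt_trans (epS k); rewrite lerD2r.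
  - exact: (one a k).1.
  - move=> t /andP[at1 ta]; apply: H.
      rewrite /in_cc (le_trans (ltW a0) at1)/=; apply: le_trans ta _; apply: ltW.
      by apply: le_lt_trans (epS k); rewrite lerD2r.
    by rewrite ger0_norm ?subr_ge0//; lra.
have cL : (fun k => \int[(leb \x mu)%E]_(z in I `*` Omega) (v z.1 z.2 * (derive1 (eta k) z.1 * g z.2)))
    @ \oo --> y t1 - y t2.
  rewrite (_ : (fun k => _) = (fun k => \int[leb]_(t in `]0, S[) (dastep t1 (ep k) t * y t) -
    \int[leb]_(t in `]0, S[) (dastep t2 (ep k) t * y t))); last by apply/funext => k; exact: LHS.
  apply: cvgB; apply: one_cv => //; first exact: ltW.
  exact: lt_trans t10 t12.
have cR : (fun k => \int[(leb \x mu)%E]_(z in I `*` Omega) (w z.1 z.2 * (eta k z.1 * g z.2)))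
    @ \oo --> \int[(leb \x mu)%E]_(z in oc_itv t1 t2 `*` Omega) (w z.1 z.2 * g z.2).
  have -> : \int[(leb \x mu)%E]_(z in oc_itv t1 t2 `*` Omega) (w z.1 z.2 * g z.2) =
     \int[(leb \x mu)%E]_(z in I `*` Omega) (w z.1 z.2 * ((z.1 \in oc_itv t1 t2)%:R * g z.2)).
    rewrite Rintegral_mkcond [RHS]Rintegral_mkcond; congr Rintegral.
    apply/funext => -[t x]; rewrite !patchE !in_setX/=.
    have [h|_] := boolP (t \in oc_itv t1 t2); last by rewrite /= mul0r mulr0 if_same.
    rewrite mul1r/=; have -> : t \in I; last by [].
    apply/mem_set; move/set_mem : h; rewrite /oc_itv /oo_itv/= !in_itv/= => /andP[h1 h2].
    by rewrite (lt_trans t10 h1) (le_lt_trans h2 t2S).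
  have ieta k : forall t, I t -> `|eta k t| <= 2.
    move=> t _; rewrite /eta /astep; apply: le_trans (ler_normB _ _) _.
    by rewrite !ger0_norm ?step_ge0// [leRHS](_ : 2 = 1 + 1)// lerD ?step_le1.
  have meta k : measurable_fun I (eta k).
    by apply: measurable_funTS; apply: continuous_measurable_fun => t; exact: ((te k).1 [::] t Logic.I).1.
  have iw k := Linf_L2_mul_integrable Lw (meta k) (ieta k) mg gM.
  apply: (@Rintegral_cvg _ _ _ (leb \x mu)%E (I `*` Omega)
    (fun k z => w z.1 z.2 * (eta k z.1 * g z.2))
    (fun z => w z.1 z.2 * ((z.1 \in oc_itv t1 t2)%:R * g z.2))
    (fun z => `|w z.1 z.2| * (2 * M))) => //.
  - by move=> k; apply/measurable_EFinP; exact: measurable_int (iw k).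
  - move=> [t x] [It Ox] /=; apply: cvgM; first exact: cvg_cst.
    apply: cvgM; last exact: cvg_cst.
    apply: cvg_near_cst.
    have [tt1|tt1] := leP t t1.
      apply: nearW => k; rewrite /eta !astep_le ?subrr//; last exact: le_trans tt1 (ltW t12).
      rewrite (_ : t \in oc_itv t1 t2 = false)//; apply/negbTE/negP => /set_mem.
      by rewrite /oc_itv/= in_itv/= ltNge tt1.
    have [tt2|tt2] := leP t t2.
      have h0 : 0 < t - t1 by rewrite subr_gt0.
      apply: filterS (ep_small _ h0) => k hk.
      rewrite /eta astep_ge//; last lra.
      rewrite astep_le// subr0 (_ : t \in oc_itv t1 t2)//.
      by apply/mem_set; rewrite /oc_itv/= in_itv/= tt1.
    have h0 : 0 < t - t2 by rewrite subr_gt0.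
    apply: filterS (ep_small _ h0) => k hk.
    rewrite /eta !astep_ge ?subrr//; try lra.
    rewrite (_ : t \in oc_itv t1 t2 = false)//; apply/negbTE/negP => /set_mem.
    by rewrite /oc_itv/= in_itv/= [t <= t2]leNgt tt2 andbF.
  - have [iw1 _] := Linf_L2_integrable Lw.
    exact: (integrableZr_real (2 * M) mI (integrable_norm iw1)).
  - move=> k [t x] [It Ox] /=; rewrite normrM ler_wpM2l// normrM ler_pM//; last exact: gM.
    exact: ieta.
have cR' := cvgN cR.
have E : y t1 - y t2 = - \int[(leb \x mu)%E]_(z in oc_itv t1 t2 `*` Omega) (w z.1 z.2 * g z.2).
  apply: cvg_seq_unique cL _.
  rewrite (_ : (fun k => _) = (fun k => - \int[(leb \x mu)%E]_(z in I `*` Omega) (w z.1 z.2 * (eta k z.1 * g z.2)))).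
    exact: cR'.
  by apply/funext => k; rewrite (weak_time_derivative ST Lv Lw vw (te k) dg).
by rewrite -[RHS]opprK -E opprB.
Qed.

Context (e : nat -> V -> R) (lambda : nat -> R).
Context (eig : dirichlet_eigensystem Omega e lambda).

Lemma dirichlet_smooth_eigen i : dirichlet_smooth Omega (e i).
Proof. by case: eig => se de _ _ _; split; [exact: se|exact: (de i).2]. Qed.

Lemma oc_sub_I t1 t2 : 0 < t1 -> t2 < S -> oc_itv t1 t2 `<=` I.
Proof.
move=> t10 t2S t; rewrite /oc_itv /oo_itv/= !in_itv/= => /andP[h1 h2].
by rewrite (lt_trans t10 h1) (le_lt_trans h2 t2S).
Qed.

Lemma I_ge0_leS t : I t -> 0 <= t <= S.
Proof. by rewrite /oo_itv/= in_itv/= => /andP[h1 h2]; rewrite !ltW. Qed.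

(** Completeness of the eigenfunctions upgrades the identity tested with each
    eigenfunction to an identity at almost every point. *)
Lemma weak_time_increment_ae v w (T : \bar R) (t1 t2 : R) : (S%:E < T)%E ->
  Linf_L2 v -> Linf_L2 w -> C0_L1 v -> is_time_deriv Omega T v w ->
  0 < t1 -> t1 < t2 -> t2 < S ->
  {ae mu, forall x, Omega x ->
    v t2 x - v t1 x = \int[leb]_(s in oc_itv t1 t2) w s x}.
Proof.
move=> ST Lv Lw cv vw t10 t12 t2S.
have subI := oc_sub_I t10 t2S.
have subD : oc_itv t1 t2 `*` Omega `<=` I `*` Omega by move=> z [/subI h1 h2]; split.
have [iw0 iw20] := Linf_L2_integrable Lw.
have moc := measurable_oc_itv t1 t2.
have mD : measurable (oc_itv t1 t2 `*` Omega) by exact: measurableX.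
have iw : (leb \x mu)%E.-integrable (oc_itv t1 t2 `*` Omega) (EFin \o (fun z => w z.1 z.2)).
  exact: integrableS iw0.
have iw2 : (leb \x mu)%E.-integrable (oc_itv t1 t2 `*` Omega) (EFin \o (fun z => w z.1 z.2 ^+ 2)).
  exact: integrableS iw20.
have mw : measurable_fun (oc_itv t1 t2 `*` Omega) (fun z => w z.1 z.2).
  by apply/measurable_EFinP; exact: measurable_int iw.
have [iJ _] := Rintegral_fubini2 moc mO iw.
have [iJ2 _] := Rintegral_fubini2 moc mO iw2.
pose rho x := \int[leb]_(s in oc_itv t1 t2) w s x.
have mrho : measurable_fun Omega rho by apply/measurable_EFinP; exact: measurable_int iJ.
have sec1 := ae_integrable_section2 moc mO iw.
have sec2 := ae_integrable_section2 moc mO iw2.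
have t1S : 0 <= t1 <= S by rewrite ltW//= ltW// (lt_trans t12).
have t2S' : 0 <= t2 <= S by rewrite (ltW (lt_trans t10 t12)) ltW.
have L2rho : L2 Omega rho.
  apply/(L2P _ mO); split => //.
  have ic := integrableZl mO (fine (leb (oc_itv t1 t2))) iJ2.
  have [|||ir2 _] := @ae_integrable_le _ _ _ mu Omega (fun x => rho x ^+ 2)
    (fun x => fine (leb (oc_itv t1 t2)) * \int[leb]_(s in oc_itv t1 t2) (w s x ^+ 2)) mO.
  - exact: measurable_funX.
  - by apply: eq_integrable ic => // x _ /=; rewrite EFinM.
  - apply: filterS2 sec1 sec2 => x s1 s2 Ox.
    have mwx : measurable_fun (oc_itv t1 t2) (fun s => w s x) := measurable_section2 moc mO mw Ox.
    have [i1 J1] := sqr_Rintegral_le moc (oc_itv_lty t1 t2) mwx (s2 Ox).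
    rewrite ger0_norm ?sqr_ge0//; apply: le_trans J1.
    rewrite -[leLHS]real_normK ?num_real// ler_sqr ?nnegrE ?Rintegral_ge0//.
    exact: le_normr_Rintegral.
  exact: ir2.
have L2d : L2 Omega (fun x => 1 * v t2 x + (-1) * v t1 x).
  by apply: L2_lin => //; [exact: cv.1|exact: cv.1].
have L2r := L2_lin oO 1 (-1) L2d L2rho.
have [_ _ _ [_ complete] _] := eig.
have orth i : \int[mu]_(x in Omega) ((1 * (1 * v t2 x + (-1) * v t1 x) + (-1) * rho x) * e i x) = 0.
  have dg := dirichlet_smooth_eigen i.
  have [M gM] := smooth_closure_bounded bO [::] dg.1.
  have mg : measurable_fun Omega (e i) by exact: (dirichlet_smooth_measurable oO [::] dg).
  have i2 := integrable_mul_bounded mO (C0_L1_integrable cv t2S') mg gM.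
  have i1 := integrable_mul_bounded mO (C0_L1_integrable cv t1S) mg gM.
  have ir := integrable_mul_bounded mO (L2_integrable mO fO L2rho) mg gM.
  rewrite (@eq_Rintegral _ _ _ _ _ (fun x => (v t2 x * e i x - v t1 x * e i x) - rho x * e i x)); last first.
    by move=> x _; ring.
  rewrite RintegralB//; last exact: integrableB_real.
  rewrite RintegralB// (weak_time_increment ST Lv Lw cv vw dg)//.
  have iwe : (leb \x mu)%E.-integrable (oc_itv t1 t2 `*` Omega) (EFin \o (fun z => w z.1 z.2 * e i z.2)).
    apply: (@integrable_mul_bounded _ _ _ _ _ _ _ M) => //.
      by apply: (measurable_comp (F := Omega)) => //; [move=> _ [z [? ?] <-]|exact: measurable_funTS].
    by move=> z [_ Ox]; exact: gM.
  have [iJe ->] := Rintegral_fubini2 moc mO iwe.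
  apply/eqP; rewrite subr_eq0; apply/eqP; apply: ae_eq_Rintegral_real => //.
  - by apply/measurable_EFinP; exact: measurable_int iJe.
  - by apply/measurable_EFinP; exact: measurable_int ir.
  - by apply: filterS sec1 => x s1 Ox /=; rewrite /rho RintegralZr//; exact: s1.
have := complete _ L2r orth; apply: filterS => x H Ox.
have := H Ox; rewrite !mul1r !mulN1r => /eqP; rewrite subr_eq0 => /eqP ->.
by [].
Qed.

Lemma weak_time_L1_bound v w (T : \bar R) (t1 t2 c eps : R) : (S%:E < T)%E ->
  Linf_L2 v -> Linf_L2 w -> C0_L1 v -> C0_L1 w -> is_time_deriv Omega T v w ->
  0 < t1 -> t1 < t2 -> t2 < S -> 0 <= c <= S ->
  (forall s, t1 <= s <= t2 -> \int[mu]_(x in Omega) `|w s x - w c x| <= eps) ->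
  \int[mu]_(x in Omega) `|v t2 x - v t1 x - (t2 - t1) * w c x| <= (t2 - t1) * eps.
Proof.
move=> ST Lv Lw cv cw vw t10 t12 t2S cS weps.
have subI := oc_sub_I t10 t2S.
have subD : oc_itv t1 t2 `*` Omega `<=` I `*` Omega by move=> z [/subI h1 h2]; split.
have [iw0 _] := Linf_L2_integrable Lw.
have moc := measurable_oc_itv t1 t2.
have mD : measurable (oc_itv t1 t2 `*` Omega) by exact: measurableX.
have iw : (leb \x mu)%E.-integrable (oc_itv t1 t2 `*` Omega) (EFin \o (fun z => w z.1 z.2)).
  exact: integrableS iw0.
have mwc : measurable_fun Omega (w c) := (cw.1 c cS).1.
have iwc : (leb \x mu)%E.-integrable (oc_itv t1 t2 `*` Omega) (EFin \o (fun z => w c z.2)).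
  apply: (@integrable_prod_bounded _ _ _ _ _ _ _ _ _ _ mO _ (\int[mu]_(x in Omega) `|w c x|)) => //.
  - exact: oc_itv_lty.
  - by apply: (measurable_comp (F := Omega)) => //; [move=> _ [z [? ?] <-]|exact: measurable_funTS].
  - by apply: aeW => t _; apply: integral_norm_le => //; exact: C0_L1_integrable.
have id : (leb \x mu)%E.-integrable (oc_itv t1 t2 `*` Omega) (EFin \o (fun z => `|w z.1 z.2 - w c z.2|)).
  exact: integrable_norm (integrableB_real mD iw iwc).
have sec1 := ae_integrable_section2 moc mO iw.
have [iJ EJ] := Rintegral_fubini2 moc mO id.
have [iK EK] := Rintegral_fubini1 moc mO id.
have t1S : 0 <= t1 <= S by rewrite ltW//= ltW// (lt_trans t12).
have t2S' : 0 <= t2 <= S by rewrite (ltW (lt_trans t10 t12)) ltW.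
have i1 := C0_L1_integrable cv t1S; have i2 := C0_L1_integrable cv t2S'.
have ic := C0_L1_integrable cw cS.
have icz : mu.-integrable Omega (EFin \o (fun x => (t2 - t1) * w c x)).
  exact: (integrableZl_real (t2 - t1) mO ic).
have ilhs := integrableB_real mO (integrableB_real mO i2 i1) icz.
have lebE : fine (leb (oc_itv t1 t2)) = t2 - t1.
  by rewrite /oc_itv lebesgue_measure_itv/= lte_fin t12 -EFinB.
apply: (@le_trans _ _ (\int[mu]_(x in Omega) \int[leb]_(s in oc_itv t1 t2) `|w s x - w c x|)).
  have mlhs : measurable_fun Omega (fun x => `|v t2 x - v t1 x - (t2 - t1) * w c x|).
    by apply/measurable_EFinP; exact: measurable_int (integrable_norm ilhs).
  have [|_] := @ae_integrable_le _ _ _ mu Omega _ _ mO mlhs iJ.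
    apply: filterS2 sec1 (weak_time_increment_ae ST Lv Lw cv vw t10 t12 t2S) => x s1 H Ox.
    have icst : leb.-integrable (oc_itv t1 t2) (EFin \o cst (w c x)).
      by apply: integrable_cst_real => //; exact: oc_itv_lty.
    rewrite normr_id (H Ox) -lebE mulrC -Rintegral_cst//.
    rewrite -RintegralB//; last exact: s1.
    apply: le_normr_Rintegral => //.
    by apply: integrableB_real => //; exact: s1.
  rewrite ger0_norm// Rintegral_ge0//.
rewrite -EJ EK -lebE mulrC -Rintegral_cst//; apply: le_Rintegral => //.
  by apply: integrable_cst_real => //; exact: oc_itv_lty.
move=> s; rewrite /oc_itv/= in_itv/= => /andP[h1 h2].
by apply: weps; rewrite ltW.
Qed.

(** The increment of v is the time integral of w at almost every point, and w is
    continuous with values in L^1(Omega). *)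
Lemma weak_time_L1_derivative v w (T : \bar R) (t eps : R) : (S%:E < T)%E ->
  Linf_L2 v -> Linf_L2 w -> C0_L1 v -> C0_L1 w -> is_time_deriv Omega T v w ->
  I t -> 0 < eps -> exists delta : R, 0 < delta /\ forall s, I s -> `|s - t| < delta ->
    \int[mu]_(x in Omega) `|v s x - v t x - (s - t) * w t x| <= eps * `|s - t|.
Proof.
move=> ST Lv Lw cv cw vw It e0; have tS := I_ge0_leS It.
have [delta [d0 H]] := cw.2.2 t tS eps e0; exists delta; split => // s Is std.
have sS := I_ge0_leS Is.
have near r : Num.min s t <= r <= Num.max s t -> \int[mu]_(x in Omega) `|w r x - w t x| <= eps.
  rewrite ge_min le_max => /andP[h1 h2]; move: std; rewrite ltr_norml => /andP[h3 h4].
  apply: H; first by rewrite /in_cc; case/orP : h1 => h1; case/orP : h2 => h2; lra.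
  by rewrite ltr_norml; case/orP : h1 => h1; case/orP : h2 => h2; lra.
move: It Is; rewrite /oo_itv/= !in_itv/= => /andP[t0 tS'] /andP[s0 sS'].
have [st|st|st] := ltgtP s t.
- have := @weak_time_L1_bound v w T s t t eps ST Lv Lw cv cw vw s0 st tS' tS => h.
  rewrite distrC (@ger0_norm _ (t - s)); last by rewrite subr_ge0 ltW.
  rewrite (@eq_Rintegral _ _ _ _ _ (fun x => `|v t x - v s x - (t - s) * w t x|)); last first.
    by move=> x _; rewrite -normrN; congr (`| _ |); ring.
  rewrite mulrC; apply: h => r hr; apply: near.
  by rewrite (min_l (ltW st)) (max_r (ltW st)).
- have := @weak_time_L1_bound v w T t s t eps ST Lv Lw cv cw vw t0 st sS' tS.
  rewrite (@ger0_norm _ (s - t)); last by rewrite subr_ge0 ltW.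
  rewrite mulrC; apply => r hr; apply: near.
  by rewrite (min_r (ltW st)) (max_l (ltW st)).
- rewrite st subrr normr0 mulr0 (@eq_Rintegral _ _ _ _ _ (fun=> 0)) ?Rintegral_cst ?mul0r//.
  by move=> x _; rewrite subrr mul0r subrr normr0.
Qed.

End time_derivative.

(** * Convexity and Taylor bounds *)

Lemma derivable_is_derive1 (R : realType) (h : R -> R) (x : R) :
  derivable h x 1 -> is_derive x 1 h (derive1 h x).
Proof. by move=> dh; apply: DeriveDef => //; rewrite derive1E. Qed.

Section convexity.
Context {R : realType} (f : R -> R).
Context (C3f : C3 f).

Let d1 x : derivable f x 1.
Proof. by have := C3f.1 0%N x isT; rewrite derive1n0. Qed.

Let d2 x : derivable (derive1 f) x 1.
Proof. by have := C3f.1 1%N x isT; rewrite derive1n1. Qed.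

Let d3 x : derivable (derive1n 2 f) x 1.
Proof. by have := C3f.1 2%N x isT. Qed.

Lemma C3_is_derive (x : R) : is_derive x 1 f (derive1 f x).
Proof. exact: (@derivable_is_derive1 R f x (@d1 x)). Qed.

Lemma C3_is_derive1 (x : R) : is_derive x 1 (derive1 f) (derive1n 2 f x).
Proof. by rewrite derive1nS derive1n1; exact: (@derivable_is_derive1 R (derive1 f) x (@d2 x)). Qed.

Lemma C3_is_derive2 (x : R) : is_derive x 1 (derive1n 2 f) (derive1n 3 f x).
Proof. by rewrite (derive1nS f 2); exact: (@derivable_is_derive1 R (derive1n 2 f) x (@d3 x)). Qed.

Lemma derivable_continuous1 (h : R -> R) : (forall x, derivable h x 1) -> continuous h.
Proof. by move=> dh x; apply: differentiable_continuous; apply/derivable1_diffP. Qed.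

Lemma C3_continuous : continuous f.
Proof. exact: (derivable_continuous1 d1). Qed.

Lemma C3_continuous1 : continuous (derive1 f).
Proof. exact: (derivable_continuous1 d2). Qed.

Lemma C3_continuous2 : continuous (derive1n 2 f).
Proof. exact: (derivable_continuous1 d3). Qed.

Context (f''_ge0 : forall x, 0 <= derive1n 2 f x).

Lemma derive1_nd x y : x <= y -> derive1 f x <= derive1 f y.
Proof.
rewrite le_eqVlt => /predU1P[->//|xy].
have [c _ E] := @MVT R (derive1 f) (derive1n 2 f) x y xy (fun z _ => C3_is_derive1 z)
  (continuous_subspaceT C3_continuous1).
by rewrite -subr_ge0 E mulr_ge0// subr_ge0 ltW.
Qed.

Lemma convex_tangent m x : f m + derive1 f m * (x - m) <= f x.
Proof.
have [xm|mx|->] := ltgtP x m.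
- have [c] := @MVT R f (derive1 f) x m xm (fun z _ => C3_is_derive z)
    (continuous_subspaceT C3_continuous).
  rewrite in_itv/= => /andP[c1 c2] E.
  have h := derive1_nd (ltW c2).
  have : (derive1 f m - derive1 f c) * (m - x) >= 0.
    by rewrite mulr_ge0 ?subr_ge0// ltW.
  nra.
- have [c] := @MVT R f (derive1 f) m x mx (fun z _ => C3_is_derive z)
    (continuous_subspaceT C3_continuous).
  rewrite in_itv/= => /andP[c1 c2] E.
  have h := derive1_nd (ltW c1).
  have : (derive1 f c - derive1 f m) * (x - m) >= 0.
    by rewrite mulr_ge0 ?subr_ge0// ltW.
  nra.
- by rewrite subrr mulr0 addr0.
Qed.

End convexity.

Section taylor.
Context {R : realType}.

Lemma lipschitz_itv (h dh : R -> R) (a b : R) : (forall x : R, is_derive x 1 h (dh x)) ->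
  continuous dh -> exists K : R, 0 <= K /\ forall x y, a <= x <= b -> a <= y <= b ->
    `|h y - h x| <= K * `|y - x|.
Proof.
move=> dhE cdh; have [K [K0 hK]] := continuous_bounded_itv a b cdh.
have ch : continuous h by apply: derivable_continuous1 => x; have [] := dhE x.
exists K; split => // x y; wlog xy : x y / x < y => [H|].
  have [xy|yx|->] := ltgtP x y; first exact: H.
    by move=> hx hy; rewrite distrC (distrC y); exact: H.
  by rewrite !subrr normr0 mulr0.
move=> /andP[ax xb] /andP[ay yb].
have [c] := @MVT R h dh x y xy (fun z _ => dhE z) (continuous_subspaceT ch).
rewrite in_itv/= => /andP[c1 c2] ->; rewrite normrM ler_wpM2r// hK//.
by rewrite (le_trans ax (ltW c1)) (le_trans (ltW c2) yb).
Qed.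

(** By the mean value theorem the increment of h is a value of dh times the
    increment of the argument, and dh is Lipschitz continuous on the interval. *)
Lemma taylor_itv (h dh ddh : R -> R) (a b : R) : (forall x : R, is_derive x 1 h (dh x)) ->
  (forall x : R, is_derive x 1 dh (ddh x)) -> continuous ddh ->
  exists K : R, 0 <= K /\ forall x y, a <= x <= b -> a <= y <= b ->
    `|h y - h x - dh x * (y - x)| <= K * `|y - x| ^+ 2.
Proof.
move=> dhE ddhE cddh; have [K [K0 hK]] := lipschitz_itv a b ddhE cddh.
have ch : continuous h by apply: derivable_continuous1 => x; have [] := dhE x.
exists K; split => // x y hx hy.
have [c [hc cx E]] : exists c, [/\ a <= c <= b, `|c - x| <= `|y - x| & h y - h x = dh c * (y - x)].
  move: (hx) (hy) => /andP[ax xb] /andP[ay yb].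
  have [xy|yx|->] := ltgtP x y.
  - have [c] := @MVT R h dh x y xy (fun z _ => dhE z) (continuous_subspaceT ch).
    rewrite in_itv/= => /andP[c1 c2] E; exists c; split => //; first by apply/andP; split; lra.
    by rewrite !ger0_norm ?subr_ge0//; lra.
  - have [c] := @MVT R h dh y x yx (fun z _ => dhE z) (continuous_subspaceT ch).
    rewrite in_itv/= => /andP[c1 c2] E; exists c; split => //; first by apply/andP; split; lra.
      by rewrite !ler0_norm ?subr_le0//; lra.
    by rewrite -opprB E -mulrN opprB.
  - by exists y; rewrite !subrr normr0 mulr0; split => //; apply/andP.
rewrite E -mulrBl normrM expr2 mulrA ler_wpM2r//.
by apply: le_trans (hK _ _ hx hc) _; rewrite ler_wpM2l.
Qed.

End taylor.

(** * Differentiation under the integral sign *)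

Section superposition.
Context {R : realType} {n : nat}.
Local Notation V := 'rV[R]_n.
Local Notation mu := (@lebesgue_rV R n).
Context (Omega : set V) (mO : measurable Omega) (fO : (mu Omega < +oo)%E).
Context (S : R) (g : V -> R) (Mg : R).
Context (mg : measurable_fun Omega g) (gM : forall x, Omega x -> `|g x| <= Mg).

Local Notation in_oo := (in_oo S).
Local Notation in_cc := (in_cc S).
Local Notation C0_int := (C0_int Omega S).

(** Differentiability on ]0, S[ as an explicit estimate, the form in which
    integrals over Omega provide it. *)
Definition has_derivative_at (P : R -> R) (q t : R) := forall eps : R, 0 < eps ->
  exists delta : R, 0 < delta /\ forall s, in_oo s -> `|s - t| < delta ->
    `|P s - P t - (s - t) * q| <= eps * `|s - t|.

Lemma has_derivative_is_derive P q t : in_oo t -> has_derivative_at P q t -> is_derive t 1 P q.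
Proof.
move=> /andP[t0 tS] dP.
suff h : h^-1 *: ((P \o shift t) (h *: 1) - P t) @[h --> 0^'] --> q.
  by apply: DeriveDef; [apply/cvg_ex; exists q|exact: cvg_lim].
apply/cvgrPdist_le => eps e0; have [delta [d0 H]] := dP eps e0.
near=> h.
have hn0 : h != 0 by near: h; exact: nbhs_dnbhs_neq.
have hd : `|h| < delta by near: h; exact: dnbhs0_lt.
have h1 : `|h| < t by near: h; exact: dnbhs0_lt.
have h2 : `|h| < S - t by near: h; apply: dnbhs0_lt; rewrite subr_gt0.
have hs : in_oo (h + t).
  by move: h1 h2; rewrite !ltr_norml => /andP[a1 a2] /andP[a3 a4]; apply/andP; split; lra.
have := H _ hs; rewrite addrK => /(_ hd) hh.
rewrite /= [h%:A]mulr1 -[_ *: _]/(_ * _).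
rewrite -[X in X - _](mulKf hn0) -mulrBr normrM normfV distrC.
by rewrite ler_pdivrMl ?normr_gt0// [leRHS]mulrC.
Unshelve. all: by end_near. Qed.

Definition o_dist (D : R -> V -> R) (t : R) :=
  (forall s, in_oo s -> mu.-integrable Omega (EFin \o D s)) /\
  forall eps : R, 0 < eps -> exists delta : R, 0 < delta /\
    forall s, in_oo s -> `|s - t| < delta -> \int[mu]_(x in Omega) D s x <= eps * `|s - t|.

Lemma o_distD D D' t : o_dist D t -> o_dist D' t -> o_dist (fun s x => D s x + D' s x) t.
Proof.
move=> [iD oD] [iD' oD']; split.
  by move=> s Is; exact: (integrableD_real mO (iD s Is) (iD' s Is)).
move=> eps e0; have e2 : 0 < eps / 2 by rewrite divr_gt0.
have [d1 [d10 H1]] := oD _ e2; have [d2 [d20 H2]] := oD' _ e2.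
exists (Num.min d1 d2); split; first by rewrite lt_min d10.
move=> s Is; rewrite lt_min => /andP[s1 s2].
rewrite RintegralD//; [|exact: iD|exact: iD'].
have := H1 s Is s1; have := H2 s Is s2; lra.
Qed.

(** Differentiability at t of a map into L^1(Omega) *)
Definition L1_derivative_at (p q : R -> V -> R) (t : R) :=
  o_dist (fun s x => `|p s x - p t x - (s - t) * q t x|) t.

Lemma integrable_increment (p q : R -> V -> R) (t s : R) : C0_int p ->
  mu.-integrable Omega (EFin \o q t) -> in_oo t -> in_oo s ->
  mu.-integrable Omega (EFin \o (fun x => p s x - p t x - (s - t) * q t x)).
Proof.
move=> [ip _] iq It Is; apply: (integrableB_real mO _ (integrableZl_real (s - t) mO iq)).
exact: (integrableB_real mO (ip s (in_oo_cc Is)) (ip t (in_oo_cc It))).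
Qed.

(** An error bound that is pointwise in x may be small uniformly or through a
    function D which is only small in L^1(Omega). *)
Lemma L1_derivative_le (p q D : R -> V -> R) (t C : R) : in_oo t -> 0 <= C -> C0_int p ->
  mu.-integrable Omega (EFin \o q t) -> o_dist D t ->
  (forall eps : R, 0 < eps -> exists delta : R, 0 < delta /\
    forall s, in_oo s -> `|s - t| < delta -> forall x, Omega x ->
      `|p s x - p t x - (s - t) * q t x| <= C * D s x + eps * `|s - t|) ->
  L1_derivative_at p q t.
Proof.
move=> It C0 ip iq [iD oD] pD; have inc s (Is : in_oo s) := integrable_norm (integrable_increment ip iq It Is).
split=> [s Is|eps e0]; first exact: inc.
pose m := fine (mu Omega); have m0 : 0 <= m by exact: fine_ge0.
have A0 : 0 < C + m + 1 by rewrite ltr_wpDl// addr_ge0.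
have eA : 0 < eps / (C + m + 1) by exact: divr_gt0.
have [d1 [d10 H1]] := oD _ eA; have [d2 [d20 H2]] := pD _ eA.
exists (Num.min d1 d2); split; first by rewrite lt_min d10.
move=> s Is; rewrite lt_min => /andP[s1 s2].
pose c := eps / (C + m + 1) * `|s - t|.
have iCD := integrableZl_real C mO (iD s Is).
have ic := integrable_cst_real c mO fO.
apply: (@le_trans _ _ (\int[mu]_(x in Omega) (C * D s x + c))).
  by apply: le_Rintegral (integrableD_real mO iCD ic) (H2 s Is s2) => //; exact: inc.
rewrite RintegralD// RintegralZl//; last exact: iD.
rewrite Rintegral_cst// -/m; apply: (@le_trans _ _ (C * c + c * m)).
  by rewrite lerD2r ler_wpM2l//; exact: H1.
rewrite (_ : _ + _ = (C + m) / (C + m + 1) * (eps * `|s - t|)); last by rewrite /c; ring.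
have h1 : (C + m) / (C + m + 1) <= 1 by rewrite ler_pdivrMr// mul1r; lra.
by apply: ler_piMl h1; rewrite mulr_ge0// ltW.
Qed.

Lemma has_derivative_pairing (p q : R -> V -> R) (t : R) : in_oo t -> C0_int p ->
  mu.-integrable Omega (EFin \o q t) -> L1_derivative_at p q t ->
  has_derivative_at (fun s => \int[mu]_(x in Omega) (p s x * g x))
    (\int[mu]_(x in Omega) (q t x * g x)) t.
Proof.
move=> It ip iq [_ pq] eps e0.
have M0 : 0 < `|Mg| + 1 by rewrite ltr_wpDl.
have [delta [d0 H]] := pq _ (divr_gt0 e0 M0); exists delta; split => // s Is st.
have inc := integrable_increment ip iq It Is.
have -> : \int[mu]_(x in Omega) (p s x * g x) - \int[mu]_(x in Omega) (p t x * g x) -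
    (s - t) * \int[mu]_(x in Omega) (q t x * g x) =
    \int[mu]_(x in Omega) ((p s x - p t x - (s - t) * q t x) * g x).
  have i1 := integrable_mul_bounded mO (ip.1 s (in_oo_cc Is)) mg gM.
  have i2 := integrable_mul_bounded mO (ip.1 t (in_oo_cc It)) mg gM.
  have i3 := integrable_mul_bounded mO iq mg gM.
  have i4 := integrableZl_real (s - t) mO i3.
  rewrite -RintegralZl// -RintegralB// -RintegralB//; last exact: integrableB_real.
  by apply: eq_Rintegral => x _; ring.
apply: le_trans (Rintegral_mul_weight_le mO fO mg gM (C := 1) (c := 0) inc (integrable_norm inc) _) _.
  by move=> x _ /=; rewrite mul1r addr0.
rewrite mul1r mul0r addr0; apply: (@le_trans _ _ (`|Mg| * (eps / (`|Mg| + 1) * `|s - t|))).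
  by rewrite ler_wpM2l//; exact: H.
rewrite (_ : _ * _ = `|Mg| / (`|Mg| + 1) * (eps * `|s - t|)); last by ring.
have h1 : `|Mg| / (`|Mg| + 1) <= 1 by rewrite ler_pdivrMr// mul1r; lra.
by apply: ler_piMl h1; rewrite mulr_ge0// ltW.
Qed.

(** C^0([0, S]; B(Omega)) with B(Omega) the bounded measurable functions under the
    supremum norm *)
Definition C0_sup (v : R -> V -> R) :=
  (forall t, in_cc t -> measurable_fun Omega (v t) /\
     exists M : R, 0 <= M /\ forall x, Omega x -> `|v t x| <= M) /\
  forall t, in_cc t -> forall eps : R, 0 < eps -> exists delta : R, 0 < delta /\
    forall s, in_cc s -> `|s - t| < delta -> forall x, Omega x -> `|v s x - v t x| <= eps.

Lemma C0_sup_integrable v t : C0_sup v -> in_cc t -> mu.-integrable Omega (EFin \o v t).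
Proof.
move=> [bv _] tS; have [mv [M [_ vM]]] := bv t tS.
exact: bounded_integrable mO fO mv vM.
Qed.

Lemma C0_sup_int v : C0_sup v -> C0_int v.
Proof.
move=> cv; split=> [t tS|t tS eps e0]; first exact: C0_sup_integrable.
pose m := fine (mu Omega); have m0 : 0 <= m by exact: fine_ge0.
have m1 : 0 < m + 1 by rewrite ltr_wpDl.
have [delta [d0 H]] := cv.2 t tS _ (divr_gt0 e0 m1); exists delta; split => // s sS st.
apply: (@le_trans _ _ (\int[mu]_(x in Omega) (eps / (m + 1)))).
  apply: le_Rintegral => //; last by move=> x Ox; exact: H.
    apply: integrable_norm; apply: integrableB_real => //; exact: C0_sup_integrable.
  exact: integrable_cst_real.
rewrite Rintegral_cst// -/m.
have h1 : m / (m + 1) <= 1 by rewrite ler_pdivrMr// mul1r; lra.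
rewrite mulrAC -mulrA; apply: ler_piMr h1; exact: ltW.
Qed.

Lemma C0_sup_mul_int a w : C0_sup a -> C0_int w -> C0_int (fun t x => a t x * w t x).
Proof.
move=> ca [iw cw].
have iaw t : in_cc t -> mu.-integrable Omega (EFin \o (fun x => a t x * w t x)).
  move=> tS; have [ma [M [_ aM]]] := ca.1 t tS.
  have := integrable_mul_bounded mO (iw t tS) ma aM.
  by apply: eq_integrable => // x _ /=; rewrite mulrC.
split => // t tS eps e0; have [ma [M [M0 aM]]] := ca.1 t tS.
pose N := \int[mu]_(x in Omega) `|w t x|; have N0 : 0 <= N by exact: Rintegral_ge0.
have N1 : 0 < 2 * (N + 1) by lra.
have M1 : 0 < 2 * (M + 1) by lra.
have e1 : 0 < Num.min (eps / (2 * (N + 1))) 1 by rewrite lt_min divr_gt0// ltr01.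
have e2 : 0 < eps / (2 * (M + 1)) by rewrite divr_gt0.
have [d1 [d10 H1]] := ca.2 t tS _ e1; have [d2 [d20 H2]] := cw t tS _ e2.
exists (Num.min d1 d2); split; first by rewrite lt_min d10.
move=> s sS; rewrite lt_min => /andP[s1 s2].
have id := integrable_norm (integrableB_real mO (iw s sS) (iw t tS)).
have iwt := integrable_norm (iw t tS).
have id' : mu.-integrable Omega (EFin \o (fun x => (M + 1) * `|w s x - w t x|)).
  exact: (integrableZl_real (M + 1) mO id).
have iw' : mu.-integrable Omega (EFin \o (fun x => eps / (2 * (N + 1)) * `|w t x|)).
  exact: (integrableZl_real (eps / (2 * (N + 1))) mO iwt).
apply: (@le_trans _ _ (\int[mu]_(x in Omega) ((M + 1) * `|w s x - w t x| + eps / (2 * (N + 1)) * `|w t x|))).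
  apply: le_Rintegral => //.
  - by apply: integrable_norm; exact: integrableB_real (iaw s sS) (iaw t tS).
  - exact: (integrableD_real mO id' iw').
  move=> x Ox; have := H1 s sS s1 x Ox; rewrite le_min => /andP[h1 h2].
  have h3 : `|a s x| <= M + 1.
    by have := ler_normD (a s x - a t x) (a t x); rewrite subrK; have := aM x Ox; lra.
  rewrite (_ : _ - _ = a s x * (w s x - w t x) + (a s x - a t x) * w t x); last by ring.
  by apply: le_trans (ler_normD _ _) _; rewrite !normrM lerD// ler_wpM2r.
rewrite RintegralD// RintegralZl// RintegralZl// -/N.
have h1 := H2 s sS s2.
have h2 : (M + 1) * (\int[mu]_(x in Omega) `|w s x - w t x|) <= eps / 2.
  apply: (@le_trans _ _ ((M + 1) * (eps / (2 * (M + 1))))); first by rewrite ler_wpM2l//; lra.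
  by rewrite le_eqVlt; apply/orP; left; apply/eqP; field; lra.
have h3 : eps / (2 * (N + 1)) * N <= eps / 2.
  rewrite mulrAC ler_pdivrMr// (_ : _ / 2 * _ = eps * (N + 1)); last by field.
  by rewrite ler_wpM2l ?ltW//; lra.
lra.
Qed.

Lemma C0_int_add w w' : C0_int w -> C0_int w' -> C0_int (fun t x => w t x + w' t x).
Proof.
move=> [iw cw] [iw' cw']; split=> [t tS|t tS eps e0].
  exact: (integrableD_real mO (iw t tS) (iw' t tS)).
have e2 : 0 < eps / 2 by rewrite divr_gt0.
have [d1 [d10 H1]] := cw t tS _ e2; have [d2 [d20 H2]] := cw' t tS _ e2.
exists (Num.min d1 d2); split; first by rewrite lt_min d10.
move=> s sS; rewrite lt_min => /andP[s1 s2].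
have i1 := integrableB_real mO (iw s sS) (iw t tS).
have i2 := integrableB_real mO (iw' s sS) (iw' t tS).
apply: (@le_trans _ _ (\int[mu]_(x in Omega) (`|w s x - w t x| + `|w' s x - w' t x|))).
  apply: le_Rintegral => //.
  - apply: integrable_norm; have := integrableD mO i1 i2; apply: eq_integrable => // x _ /=.
    by rewrite -EFinD; congr EFin; ring.
  - exact: (integrableD_real mO (integrable_norm i1) (integrable_norm i2)).
  by move=> x Ox; rewrite opprD addrACA ler_normD.
rewrite RintegralD//; [|exact: integrable_norm|exact: integrable_norm].
have := H1 s sS s1; have := H2 s sS s2; lra.
Qed.

Lemma C0_sup_mul a b : C0_sup a -> C0_sup b -> C0_sup (fun t x => a t x * b t x).
Proof.
move=> [ba ca] [bb cb]; split=> [t tS|t tS eps e0].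
  have [ma [M [M0 aM]]] := ba t tS; have [mb [N [N0 bN]]] := bb t tS.
  split; first exact: measurable_funM.
  by exists (M * N); split=> [|x Ox]; [exact: mulr_ge0|rewrite normrM ler_pM ?aM ?bN].
have [_ [M [M0 aM]]] := ba t tS; have [_ [N [N0 bN]]] := bb t tS.
pose c := M + N + 1; have c0 : 0 < c by rewrite /c; lra.
have e1 : 0 < Num.min (eps / c) 1 by rewrite lt_min divr_gt0// ltr01.
have [d1 [d10 H1]] := ca t tS _ e1; have [d2 [d20 H2]] := cb t tS _ e1.
exists (Num.min d1 d2); split; first by rewrite lt_min d10.
move=> s sS; rewrite lt_min => /andP[s1 s2] x Ox.
have := H1 s sS s1 x Ox; rewrite le_min => /andP[a1 a2].
have := H2 s sS s2 x Ox; rewrite le_min => /andP[b1 b2].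
have h3 : `|a s x| <= M + 1.
  by have := ler_normD (a s x - a t x) (a t x); rewrite subrK; have := aM x Ox; lra.
rewrite (_ : _ - _ = a s x * (b s x - b t x) + (a s x - a t x) * b t x); last by ring.
apply: le_trans (ler_normD _ _) _; rewrite !normrM.
have h4 : `|a s x| * `|b s x - b t x| <= (M + 1) * (eps / c) by rewrite ler_pM.
have h5 : `|a s x - a t x| * `|b t x| <= (eps / c) * N by rewrite ler_pM ?bN.
have h6 : (M + 1) * (eps / c) + (eps / c) * N = eps by rewrite /c; field; rewrite -/c; lra.
lra.
Qed.

Lemma C0_sup_comp (h dh : R -> R) v : (forall x : R, is_derive x 1 h (dh x)) -> continuous dh ->
  C0_sup v -> C0_sup (fun t x => h (v t x)).
Proof.
move=> dhE cdh [bv cv].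
have ch : continuous h by apply: derivable_continuous1 => x; have [] := dhE x.
split=> [t tS|t tS eps e0].
  have [mv [M [M0 vM]]] := bv t tS; split.
    by apply: (measurableT_comp _ mv); exact: continuous_measurable_fun.
  have [K [K0 hK]] := continuous_bounded_itv (- M) M ch.
  by exists K; split => // x Ox; apply: hK; rewrite -ler_norml vM.
have [_ [M [M0 vM]]] := bv t tS.
have [K [K0 hK]] := lipschitz_itv (- (M + 1)) (M + 1) dhE cdh.
have K1 : 0 < K + 1 by lra.
have e1 : 0 < Num.min (eps / (K + 1)) 1 by rewrite lt_min divr_gt0// ltr01.
have [d [d0 H]] := cv t tS _ e1; exists d; split => // s sS sd x Ox.
have := H s sS sd x Ox; rewrite le_min => /andP[a1 a2].
have h1 := vM x Ox.
have h2 : `|v s x| <= M + 1 by have := ler_normD (v s x - v t x) (v t x); rewrite subrK; lra.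
apply: le_trans (hK _ _ _ _) _; try (rewrite -ler_norml; lra).
apply: (@le_trans _ _ (K * (eps / (K + 1)))); first by rewrite ler_wpM2l.
have h3 : K / (K + 1) <= 1 by rewrite ler_pdivrMr// mul1r; lra.
rewrite mulrCA; apply: ler_piMr h3; exact: ltW.
Qed.

(** Leibniz rule: each error term is the product of an error that is small in
    L^1(Omega) and a bounded function, except for the last one, in which a
    bounded function multiplies an increment that is uniformly small. *)
Lemma L1_derivative_mul a a' b b' t : in_oo t -> C0_sup a -> C0_sup b -> C0_sup a' -> C0_int b' ->
  L1_derivative_at a a' t -> L1_derivative_at b b' t ->
  L1_derivative_at (fun t x => a t x * b t x) (fun t x => a' t x * b t x + a t x * b' t x) t.
Proof.
move=> It ca cb ca' ib' da db; have tS := in_oo_cc It.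
have [_ [M [M0 aM]]] := ca.1 t tS; have [_ [N [N0 bN]]] := cb.1 t tS.
have [_ [A [A0 a'A]]] := ca'.1 t tS.
have iq := (C0_int_add (C0_sup_mul_int ca' (C0_sup_int cb)) (C0_sup_mul_int ca ib')).1 t tS.
have C0 : 0 <= M + N + 1 by lra.
apply: (L1_derivative_le It C0 (C0_sup_int (C0_sup_mul ca cb)) iq (o_distD da db)) => eps e0.
have A1 : 0 < A + 1 by lra.
have e1 : 0 < Num.min (eps / (A + 1)) 1 by rewrite lt_min divr_gt0// ltr01.
have [delta [d0 H]] := cb.2 t tS _ e1; exists delta; split => // s Is sd x Ox.
have := H s (in_oo_cc Is) sd x Ox; rewrite le_min => /andP[b1 b2].
have bs : `|b s x| <= M + N + 1.
  by have := ler_normD (b s x - b t x) (b t x); rewrite subrK; have := bN x Ox; lra.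
have at_ : `|a t x| <= M + N + 1 by have := aM x Ox; lra.
rewrite (_ : _ - _ - _ = (a s x - a t x - (s - t) * a' t x) * b s x +
  a t x * (b s x - b t x - (s - t) * b' t x) + (s - t) * (a' t x * (b s x - b t x))); last by ring.
apply: le_trans (ler_normD _ _) _; rewrite [X in _ <= X + _]mulrDr; apply: lerD.
  by apply: le_trans (ler_normD _ _) _; rewrite !normrM [X in X + _]mulrC lerD// ler_wpM2r.
rewrite normrM mulrC ler_wpM2r// normrM.
apply: (@le_trans _ _ (A * (eps / (A + 1)))); first by rewrite ler_pM// a'A.
have h1 : A / (A + 1) <= 1 by rewrite ler_pdivrMr// mul1r; lra.
rewrite mulrCA; apply: ler_piMr h1; exact: ltW.
Qed.

(** Chain rule: the Taylor remainder is quadratic in the increment of v; one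
    factor is uniformly small, the other one is O(|s - t|) in L^1(Omega). *)
Lemma L1_derivative_comp (h dh ddh : R -> R) v v' t : in_oo t ->
  (forall x : R, is_derive x 1 h (dh x)) -> (forall x : R, is_derive x 1 dh (ddh x)) ->
  continuous ddh -> C0_sup v -> C0_sup v' -> L1_derivative_at v v' t ->
  L1_derivative_at (fun t x => h (v t x)) (fun t x => dh (v t x) * v' t x) t.
Proof.
move=> It dhE ddhE cddh cv cv' dv; have tS := in_oo_cc It.
have cdh : continuous dh by apply: derivable_continuous1 => x; have [] := ddhE x.
have [_ [M [M0 vM]]] := cv.1 t tS; have [_ [N [N0 v'N]]] := cv'.1 t tS.
have [K [K0 hK]] := taylor_itv (- (M + 1)) (M + 1) dhE ddhE cddh.
have [K1 [K10 dhK]] := continuous_bounded_itv (- (M + 1)) (M + 1) cdh.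
have iq := (C0_sup_mul_int (C0_sup_comp ddhE cddh cv) (C0_sup_int cv')).1 t tS.
apply: (L1_derivative_le It (addr_ge0 K0 K10) (C0_sup_int (C0_sup_comp dhE cdh cv)) iq dv) => eps e0.
pose c := K * N + 1; have c0 : 0 < c by rewrite ltr_wpDl// mulr_ge0.
have e1 : 0 < Num.min (eps / c) 1 by rewrite lt_min divr_gt0// ltr01.
have [delta [d0 H]] := cv.2 t tS _ e1; exists delta; split => // s Is sd x Ox.
have := H s (in_oo_cc Is) sd x Ox; rewrite le_min => /andP[dus dus1].
have vt := vM x Ox.
have in2 : - (M + 1) <= v t x <= M + 1 by rewrite -ler_norml; lra.
have in1 : - (M + 1) <= v s x <= M + 1.
  by rewrite -ler_norml; have := ler_normD (v s x - v t x) (v t x); rewrite subrK; lra.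
have h1 := hK _ _ in2 in1.
set d := `|v s x - v t x - (s - t) * v' t x|; have d_ge0 : 0 <= d by exact: normr_ge0.
have ud : `|v s x - v t x| <= d + `|s - t| * N.
  have := ler_normD (v s x - v t x - (s - t) * v' t x) ((s - t) * v' t x).
  by rewrite subrK normrM -/d => /le_trans; apply; rewrite lerD2l ler_wpM2l// v'N.
rewrite (_ : _ - _ - _ = (h (v s x) - h (v t x) - dh (v t x) * (v s x - v t x)) +
    dh (v t x) * (v s x - v t x - (s - t) * v' t x)); last by ring.
apply: le_trans (ler_normD _ _) _; rewrite [X in _ + X <= _]normrM -/d.
have h3 : `|dh (v t x)| * d <= K1 * d by rewrite ler_wpM2r// dhK.
have h4 : `|v s x - v t x| ^+ 2 <= d + eps / c * (`|s - t| * N).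
  rewrite expr2; set a := `|v s x - v t x| in dus dus1 ud *.
  have a0 : 0 <= a by exact: normr_ge0.
  apply: (@le_trans _ _ (a * (d + `|s - t| * N))); first by rewrite ler_wpM2l.
  by rewrite mulrDr lerD// ?ler_piMl// ler_wpM2r// mulr_ge0.
have h5 : K * `|v s x - v t x| ^+ 2 <= K * (d + eps / c * (`|s - t| * N)) by rewrite ler_wpM2l.
have h6 : K * (eps / c * (`|s - t| * N)) <= eps * `|s - t|.
  rewrite (_ : K * _ = (K * N) / c * (eps * `|s - t|)); last by ring.
  have h7 : (K * N) / c <= 1 by rewrite ler_pdivrMr// mul1r /c; lra.
  by apply: ler_piMl h7; rewrite mulr_ge0// ltW.
lra.
Qed.

Section along_solution.
Context (f : R -> R) (C3f : C3 f).
Context (u u1 u2 : R -> V -> R).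
Context (cu : C0_sup u) (cu1 : C0_sup u1) (cu2 : C0_int u2).

Let C3c1 := C3_continuous1 C3f.
Let C3c2 := C3_continuous2 C3f.

Lemma C0_sup_f : C0_sup (fun t x => f (u t x)).
Proof. exact: C0_sup_comp (C3_is_derive C3f) C3c1 cu. Qed.

Let C0_sup_df : C0_sup (fun t x => derive1 f (u t x)).
Proof. exact: C0_sup_comp (C3_is_derive1 C3f) C3c2 cu. Qed.

Let C0_sup_ddf : C0_sup (fun t x => derive1n 2 f (u t x)).
Proof. exact: C0_sup_comp (C3_is_derive2 C3f) C3f.2 cu. Qed.

Lemma C0_sup_f1 : C0_sup (fun t x => derive1 f (u t x) * u1 t x).
Proof. exact: C0_sup_mul C0_sup_df cu1. Qed.

Lemma C0_int_f2 : C0_int (fun t x => derive1 f (u t x) * u2 t x + derive1n 2 f (u t x) * u1 t x ^+ 2).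
Proof.
apply: C0_int_add; first exact: C0_sup_mul_int C0_sup_df cu2.
exact: C0_sup_int (C0_sup_mul C0_sup_ddf (C0_sup_mul cu1 cu1)).
Qed.

Lemma has_derivative_f t : in_oo t -> L1_derivative_at u u1 t ->
  has_derivative_at (fun s => \int[mu]_(x in Omega) (f (u s x) * g x))
    (\int[mu]_(x in Omega) (derive1 f (u t x) * u1 t x * g x)) t.
Proof.
move=> It du; apply: (has_derivative_pairing (q := fun t x => derive1 f (u t x) * u1 t x) It) => //.
- exact: C0_sup_int C0_sup_f.
- by apply: (C0_sup_int C0_sup_f1).1; exact: in_oo_cc.
- exact (L1_derivative_comp It (C3_is_derive C3f) (C3_is_derive1 C3f) C3c2 cu cu1 du).
Qed.

Lemma has_derivative_f1 t : in_oo t -> L1_derivative_at u u1 t -> L1_derivative_at u1 u2 t ->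
  has_derivative_at (fun s => \int[mu]_(x in Omega) (derive1 f (u s x) * u1 s x * g x))
    (\int[mu]_(x in Omega) ((derive1 f (u t x) * u2 t x + derive1n 2 f (u t x) * u1 t x ^+ 2) * g x)) t.
Proof.
move=> It du du1; have cd := C0_sup_mul C0_sup_ddf cu1.
have dd := L1_derivative_comp It (C3_is_derive1 C3f) (C3_is_derive2 C3f) C3f.2 cu cu1 du.
have dm := L1_derivative_mul It C0_sup_df cu1 cd cu2 dd du1.
have iq := (C0_int_add (C0_sup_mul_int cd (C0_sup_int cu1)) (C0_sup_mul_int C0_sup_df cu2)).1 t (in_oo_cc It).
have := has_derivative_pairing It (C0_sup_int C0_sup_f1) iq dm.
congr has_derivative_at; apply: eq_Rintegral => x _; ring.
Qed.

End along_solution.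

End superposition.

(** * Moments of a strong solution *)

Section function_classes.
Context {R : realType} {n : nat}.
Local Notation V := 'rV[R]_n.
Local Notation mu := (@lebesgue_rV R n).
Local Notation leb := (@lebesgue_measure R).
Context (Omega : set V) (oO : open Omega) (bO : bounded_set Omega).
Context (S : R) (T : \bar R) (ST : (S%:E < T)%E).
Context (e : nat -> V -> R) (lambda : nat -> R) (eig : dirichlet_eigensystem Omega e lambda).
Implicit Types (v w : R -> V -> R).

Let mO : measurable Omega := open_measurable_rV oO.
Let fO : (mu Omega < +oo)%E := bounded_lebesgue_lty mO bO.

Lemma in_cc_Ico0 t : in_cc S t -> Ico0 T t.
Proof. by move=> /andP[t0 tS]; split => //; apply: le_lt_trans ST; rewrite lee_fin. Qed.

Lemma C0_time_dist X N v t (eps : R) : C0_time T X N v -> in_cc S t -> 0 < eps ->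
  exists delta : R, 0 < delta /\
    forall s, in_cc S s -> `|s - t| < delta -> (N (v s \- v t)%R < eps%:E)%E.
Proof.
move=> cv tS e0; have [_ cvt] := cv t (in_cc_Ico0 tS).
have nb : nbhs (0 : \bar R)%E [set y | (y < eps%:E)%E].
  by apply: open_nbhs_nbhs; split; [exact: open_ereal_lt_ereal|rewrite /= lte_fin].
have H : \forall s \near nbhs t, Ico0 T s -> (N (v s \- v t)%R < eps%:E)%E := cvt _ nb.
move/nbhs_ballP : H => [delta /= d0 H]; exists delta; split => // s sS st.
by apply: H; [rewrite -ball_normE /= distrC|exact: in_cc_Ico0].
Qed.

Lemma Lp_norm_sobolev_norm k g : L2 Omega g ->
  (Lp_norm 2%:E Omega g <= sobolev_norm Omega k g)%E.
Proof.
move=> L2g; have ae := weak_deriv0 oO bO eig L2g.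
have mw : measurable_fun Omega (weak_deriv Omega [::] g).
  have w0 : is_weak_deriv Omega [::] g g by move=> phi _ /=; rewrite expr0 mul1r.
  suff [[]] : [set h | L2 Omega h /\ is_weak_deriv Omega [::] g h] (weak_deriv Omega [::] g) by [].
  by apply: getPex; exists g.
have -> : Lp_norm 2%:E Omega g = Lp_norm 2%:E Omega (weak_deriv Omega [::] g).
  rewrite !Lp_norm2E; congr (_ `^ _)%E; apply: ae_eq_integral => //.
  - by apply/measurable_EFinP; apply: measurable_funX; exact: L2g.1.
  - by apply/measurable_EFinP; exact: measurable_funX.
  - by apply: filterS ae => x H Ox; rewrite H.
have pos (j : nat) (t : j.-tuple 'I_n) : (0 <= Lp_norm 2%:E Omega (weak_deriv Omega t g))%E.
  exact: Lnorm_ge0.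
rewrite /sobolev_norm (bigD1 (ord0 : 'I_k.+1))//= (bigD1 (in_tuple [::]))//=.
rewrite -addeA leeDl// adde_ge0//; first by apply: sume_ge0 => t _; exact: pos.
by apply: sume_ge0 => j _; apply: sume_ge0 => t _; exact: pos.
Qed.

Lemma Linfty_loc_time_L2 X N v : 0 < S ->
  (forall g, X g -> L2 Omega g /\ (Lp_norm 2%:E Omega g <= N g)%E) ->
  Linfty_loc_time Omega T X N v -> Linf_L2 Omega S v.
Proof.
move=> S0 XL [mv vM]; split.
  apply: measurable_funS mv => //; last first.
    move=> [t x] [/=]; rewrite /oo_itv/= in_itv/= => /andP[t0 tS] Ox; split => //=; split => //.
    by apply: lt_trans ST; rewrite lte_fin.
  apply: measurableX => //.
  have -> : Ioo0 T = [set t : measurableTypeR R | 0 < t] `&` [set t | (t%:E < T)%E] by [].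
  apply: measurableI.
    by rewrite (_ : [set _ | _] = `]0, +oo[%classic)//; apply/seteqP; split=> t /=; rewrite in_itv/= andbT.
  move: T ST => [r| |] // _.
    by rewrite (_ : [set _ | _] = `]-oo, r[%classic)//; apply/seteqP; split=> t /=; rewrite in_itv/= lte_fin.
  by rewrite (_ : [set _ | _] = setT)//; apply/seteqP; split=> // t _ /=; rewrite ltry.
have [M H] := vM S S0 ST; exists M; apply: (@filterS (measurableTypeR R) (almost_everywhere leb) _ _ _ _ H) => t {}H It.
have [|Xv NM] := H; first by move: It; rewrite /oo_itv/= in_itv.
by have [h1 h2] := XL _ Xv; split => //; exact: le_trans NM.
Qed.

Lemma sobolev_norm_ge0 k g : (0 <= sobolev_norm Omega k g)%E.
Proof. by apply: sume_ge0 => j _; apply: sume_ge0 => t _; exact: Lnorm_ge0. Qed.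

Lemma sobolev0C_C0_sup v : C0_time T (sobolev0C Omega) (sobolev0C_norm Omega) v -> C0_sup Omega S v.
Proof.
move=> cv; split=> t tS.
  have [[[[L2v _] _] wc] _] := cv t (in_cc_Ico0 tS); split; first exact: L2v.1.
  have [M [M0 vM]] := within_continuous_compact_bounded (compact_closure_bounded bO) wc.
  by exists M; split => // x Ox; apply: vM; exact: subset_closure.
move=> eps e0; have [delta [d0 H]] := C0_time_dist cv tS e0; exists delta; split => // s sS st x Ox.
rewrite -lee_fin; apply: le_trans (ltW (H s sS st)); rewrite /sobolev0C_norm.
rewrite -[leLHS]add0e; apply: leeD; first exact: sobolev_norm_ge0.
by apply: ereal_sup_ubound; exists x => //; exact: subset_closure.
Qed.

Lemma sobolev0C_C0_L1 v : C0_time T (sobolev0C Omega) (sobolev0C_norm Omega) v -> C0_L1 Omega S v.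
Proof.
move=> cv; split; last exact (C0_sup_int mO fO (sobolev0C_C0_sup cv)).
by move=> t tS; have [[[[L2v _] _] _] _] := cv t (in_cc_Ico0 tS).
Qed.

Lemma L2_C0_L1 v : C0_time T (L2 Omega) (Lp_norm 2%:E Omega) v -> C0_L1 Omega S v.
Proof.
move=> cv.
have L2v t : in_cc S t -> L2 Omega (v t) by move=> tS; exact: (cv t (in_cc_Ico0 tS)).1.
split=> //; split=> [t tS|t tS eps e0]; first by apply: L2_integrable => //; exact: L2v.
pose c := Num.sqrt (fine (mu Omega)) + 1.
have c0 : 0 < c by rewrite ltr_wpDl// sqrtr_ge0.
have [delta [d0 H]] := C0_time_dist cv tS (divr_gt0 e0 c0); exists delta; split => // s sS st.
have L2d : L2 Omega (v s \- v t).
  have := L2_lin oO 1 (-1) (L2v s sS) (L2v t tS); congr L2; apply/funext => x.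
  by rewrite mul1r mulN1r.
have [_ h] := L1_le_Lp_norm2 mO fO L2d.1 (ltW (H s sS st)).
apply: le_trans h _.
have h1 : Num.sqrt (fine (mu Omega)) / c <= 1 by rewrite ler_pdivrMr// mul1r /c; lra.
rewrite mulrCA; apply: ler_piMr h1; exact: ltW.
Qed.

Lemma weak_time_o_dist v w t :
  Linf_L2 Omega S v -> Linf_L2 Omega S w -> C0_L1 Omega S v -> C0_L1 Omega S w ->
  is_time_deriv Omega T v w -> in_oo S t ->
  L1_derivative_at Omega S v w t.
Proof.
move=> Lv Lw cv cw vw It.
have oo s : in_oo S s -> oo_itv 0 S s by rewrite /oo_itv/= in_itv.
split=> [s Is|eps e0].
  exact: integrable_norm (integrable_increment mO cv.2 (cw.2.1 t (in_oo_cc It)) It Is).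
have [delta [d0 H]] := weak_time_L1_derivative oO bO eig ST Lv Lw cv cw vw (oo t It) e0.
by exists delta; split => // s Is; exact: H (oo s Is).
Qed.

End function_classes.

Section moments.
Context {R : realType} {n : nat}.
Local Notation V := 'rV[R]_n.
Local Notation mu := (@lebesgue_rV R n).
Local Notation leb := (@lebesgue_measure R).
Context (Omega : set V) (oO : open Omega) (bO : bounded_set Omega).
Context (S : R) (T : \bar R) (S0 : 0 < S) (ST : (S%:E < T)%E).
Context (e : nat -> V -> R) (lambda : nat -> R) (eig : dirichlet_eigensystem Omega e lambda).
Context (tau alpha beta gamma : R) (f : R -> R) (tau0 : 0 < tau) (C3f : C3 f).
Context (u ut utt uttt Lu Lut : R -> V -> R).
Context (duut : is_time_deriv Omega T u ut) (dututt : is_time_deriv Omega T ut utt)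
  (dutttt : is_time_deriv Omega T utt uttt).
Context (cu : C0_time T (sobolev0C Omega) (sobolev0C_norm Omega) u)
  (cut : C0_time T (sobolev0C Omega) (sobolev0C_norm Omega) ut)
  (Lu2 : Linfty_loc_time Omega T (sobolev Omega 2) (sobolev_norm Omega 2) u)
  (Lut2 : Linfty_loc_time Omega T (sobolev Omega 2) (sobolev_norm Omega 2) ut).
Context (cutt : C0_time T (L2 Omega) (Lp_norm 2%:E Omega) utt)
  (Lutt1 : Linfty_loc_time Omega T (sobolev0 Omega) (sobolev_norm Omega 1) utt)
  (Luttt : Linfty_loc_time Omega T (L2 Omega) (Lp_norm 2%:E Omega) uttt).
Context (LuE : is_laplacian Omega T u Lu) (LutE : is_laplacian Omega T ut Lut).
Context (pde : {ae (leb \x mu)%E, forall z, cylinder Omega T z ->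
            let: (t, x) := z in
            tau * uttt t x + alpha * utt t x =
            beta * Lut t x + gamma * Lu t x
            + derive1 f (u t x) * utt t x + derive1n 2 f (u t x) * (ut t x) ^+ 2}).

Let mO : measurable Omega := open_measurable_rV oO.
Let fO : (mu Omega < +oo)%E := bounded_lebesgue_lty mO bO.
Let g := e 0%N.

Let dg : dirichlet_smooth Omega g.
Proof. exact: (dirichlet_smooth_eigen eig 0%N). Qed.

Let mg : measurable_fun Omega g.
Proof. exact: (dirichlet_smooth_measurable oO [::] dg erefl). Qed.

Let exMg : exists Mg : R, forall x, Omega x -> `|g x| <= Mg.
Proof. exact: (smooth_closure_bounded bO [::] dg.1). Qed.

Let Liu : Linf_L2 Omega S u.
Proof.
apply: (Linfty_loc_time_L2 oO ST S0 _ Lu2) => h sh; split; first exact: sh.1.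
exact (Lp_norm_sobolev_norm oO bO eig 2 sh.1).
Qed.

Let Liut : Linf_L2 Omega S ut.
Proof.
apply: (Linfty_loc_time_L2 oO ST S0 _ Lut2) => h sh; split; first exact: sh.1.
exact (Lp_norm_sobolev_norm oO bO eig 2 sh.1).
Qed.

Let Liutt : Linf_L2 Omega S utt.
Proof.
apply: (Linfty_loc_time_L2 oO ST S0 _ Lutt1) => h sh; split; first exact: sh.1.1.
exact (Lp_norm_sobolev_norm oO bO eig 1 sh.1.1).
Qed.

Let Liuttt : Linf_L2 Omega S uttt.
Proof. by apply: (Linfty_loc_time_L2 oO ST S0 _ Luttt). Qed.

Let su := sobolev0C_C0_sup bO ST cu.
Let sut := sobolev0C_C0_sup bO ST cut.
Let ku := sobolev0C_C0_L1 oO bO ST cu.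
Let kut := sobolev0C_C0_L1 oO bO ST cut.
Let kutt := L2_C0_L1 oO bO ST cutt.
Let iutt := kutt.2.

Definition moment (w : R -> V -> R) (t : R) : R := \int[mu]_(x in Omega) (w t x * g x).

Definition source (t : R) (x : V) : R :=
  derive1 f (u t x) * utt t x + derive1n 2 f (u t x) * ut t x ^+ 2.

Let isource := C0_int_f2 mO fO C3f su sut iutt.

Lemma C0_int_moment w : C0_int Omega S w -> continuous_cc S (moment w).
Proof. by move=> cw; have [Mg gM] := exMg; exact: (C0_int_pairing mO fO mg gM cw). Qed.

Lemma weak_derivative_moment v w t : C0_int Omega S v -> C0_int Omega S w ->
  L1_derivative_at Omega S v w t -> in_oo S t ->
  is_derive t 1 (moment v) (moment w t).
Proof.
move=> iv iw ovw It; have [Mg gM] := exMg.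
apply: (has_derivative_is_derive It).
exact (has_derivative_pairing mO fO mg gM It iv (iw.1 t (in_oo_cc It)) ovw).
Qed.

Lemma is_derive_moment0 t : in_oo S t -> is_derive t 1 (moment u) (moment ut t).
Proof.
move=> It; apply: weak_derivative_moment => //.
- exact: ku.2.
- exact: kut.2.
- exact (weak_time_o_dist oO bO ST eig Liu Liut ku kut duut It).
Qed.

Lemma is_derive_moment1 t : in_oo S t -> is_derive t 1 (moment ut) (moment utt t).
Proof.
move=> It; apply: weak_derivative_moment => //.
- exact: kut.2.
- exact (weak_time_o_dist oO bO ST eig Liut Liutt kut kutt dututt It).
Qed.

Lemma is_derive_moment_f t : in_oo S t ->
  is_derive t 1 (moment (fun t x => f (u t x))) (moment (fun t x => derive1 f (u t x) * ut t x) t).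
Proof.
move=> It; have [Mg gM] := exMg; apply: (has_derivative_is_derive It).
apply: (has_derivative_f mO fO mg gM C3f su sut It).
exact (weak_time_o_dist oO bO ST eig Liu Liut ku kut duut It).
Qed.

Lemma is_derive_moment_f1 t : in_oo S t ->
  is_derive t 1 (moment (fun t x => derive1 f (u t x) * ut t x)) (moment source t).
Proof.
move=> It; have [Mg gM] := exMg; apply: (has_derivative_is_derive It).
apply: (has_derivative_f1 mO fO mg gM C3f su sut iutt It).
  exact (weak_time_o_dist oO bO ST eig Liu Liut ku kut duut It).
exact (weak_time_o_dist oO bO ST eig Liut Liutt kut kutt dututt It).
Qed.

Lemma moment_laplacian v : sobolev Omega 2 v -> sobolev0 Omega v ->
  mu.-integrable Omega (EFin \o (fun x => weak_laplacian Omega v x * g x)) /\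
  \int[mu]_(x in Omega) (weak_laplacian Omega v x * g x) =
  - lambda 0%N * \int[mu]_(x in Omega) (v x * g x).
Proof.
move=> sv sv0; have [_ de _ _ gpos] := eig.
have [iw ->] := green_identity oO bO eig sv sv0 dg gpos (de 0%N).1; split => //.
have [iS _] := Rintegral_sum_seq (index_enum 'I_n) mO iw.
by apply: eq_integrable iS => // x _ /=; rewrite /weak_laplacian mulr_suml.
Qed.

(** For almost every t the equation holds at almost every x. Multiplied by e 0
    and integrated there, it loses its Laplacians to Green's identity. *)
Lemma moment_pde : {ae leb, forall t : measurableTypeR R, in_oo S t ->
  L2 Omega (uttt t) /\
  tau * moment uttt t = moment source t - alpha * moment utt t -
    lambda 0%N * beta * moment ut t - lambda 0%N * gamma * moment u t}.
Proof.
have [Mu Hu] := Lu2.2 S S0 ST; have [Mt Ht] := Lut2.2 S S0 ST.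
have [_ LuS] := LuE; have [_ LutS] := LutE.
have [M3 H3] := Luttt.2 S S0 ST.
have pdeS := ae_prod_section pde.
pose F := almost_everywhere (leb : set (measurableTypeR R) -> \bar R).
have FF : Filter F by rewrite /F; typeclasses eauto.
have I1 := @filterI (measurableTypeR R) F FF _ _ Hu Ht.
have I2 := @filterI (measurableTypeR R) F FF _ _ LuS LutS.
have I3 := @filterI (measurableTypeR R) F FF _ _ H3 pdeS.
have I4 := @filterI (measurableTypeR R) F FF _ _ I1 (@filterI (measurableTypeR R) F FF _ _ I2 I3).
apply: (@filterS (measurableTypeR R) F FF _ _ _ I4) => t /= [[h1 h2] [[h3 h4] [h5 h6]]] It.
have tS := in_oo_cc It; have tT := in_cc_Ico0 ST tS.
have tI : Ioo0 T t by case/andP: It => t0 _; split => //; exact: tT.2.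
have [s1 _] := h1 It; have [s2 _] := h2 It; have [L2t _] := h5 It.
have {}h3 := h3 tI; have {}h4 := h4 tI.
have z1 : sobolev0 Omega (u t) by case: (cu tT) => -[].
have z2 : sobolev0 Omega (ut t) by case: (cut tT) => -[].
have [i1 J1] := moment_laplacian s1 z1; have [i2 J2] := moment_laplacian s2 z2.
have [Mg gM] := exMg.
have i3 := integrable_mul_bounded mO (L2_integrable mO fO L2t) mg gM.
have i4 := integrable_mul_bounded mO (iutt.1 t tS) mg gM.
have i5 := integrable_mul_bounded mO (isource.1 t tS) mg gM.
have [i6 J6] := Rintegral_lin beta gamma mO i2 i1.
have [i7 J7] := Rintegral_lin 1 (- alpha) mO i5 i4.
have [i8 J8] := Rintegral_lin 1 1 mO i6 i7.
(* the term with coefficient 0 gives both sides the shape of Rintegral_lin *)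
have [i9 J9] := Rintegral_lin tau 0 mO i3 i3.
split=> //.
have E : tau * moment uttt t + 0 * moment uttt t = 1 * (beta * (- lambda 0%N * moment ut t) +
   gamma * (- lambda 0%N * moment u t)) + 1 * (1 * moment source t + - alpha * moment utt t).
  rewrite /moment -J1 -J2 -J6 -J7 -J8 -J9.
  apply: ae_eq_Rintegral_real => //.
  - by apply/measurable_EFinP; exact: measurable_int i9.
  - by apply/measurable_EFinP; exact: measurable_int i8.
  - apply: filterS3 h3 h4 h6 => x e3 e4 e6 Ox.
    have := e6 (conj tI Ox); rewrite (e3 Ox) (e4 Ox) => e7.
    rewrite /source; set dd := derive1 f (u t x) in e7 *.
    set ee := derive1n 2 f (u t x) in e7 *.
    transitivity ((tau * uttt t x) * g x); first by ring.
    have -> : tau * uttt t x = beta * weak_laplacian Omega (ut t) x +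
      gamma * weak_laplacian Omega (u t) x + dd * utt t x + ee * ut t x ^+ 2 - alpha * utt t x.
      by rewrite -e7; ring.
    by ring.
move: E; rewrite mul0r addr0 => ->; ring.
Qed.

Definition moment_rate (t : R) : R := tau^-1 * (moment source t - alpha * moment utt t -
    lambda 0%N * beta * moment ut t - lambda 0%N * gamma * moment u t).

Lemma continuous_cc_rate : continuous_cc S moment_rate.
Proof.
have cs := C0_int_moment isource; have c2 := C0_int_moment iutt.
have c1 := C0_int_moment kut.2; have c0 := C0_int_moment ku.2.
have lin := @continuous_cc_lin R S.
have := lin 1 1 _ _ (lin tau^-1 (- (tau^-1 * alpha)) _ _ cs c2)
  (lin (- (tau^-1 * (lambda 0%N * beta))) (- (tau^-1 * (lambda 0%N * gamma))) _ _ c1 c0).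
congr (continuous_cc S _); apply/funext => t; rewrite /moment_rate; ring.
Qed.

Lemma moment2_increment t1 t2 (q eps : R) : 0 < t1 -> t1 < t2 -> t2 < S ->
  (forall s, t1 <= s <= t2 -> `|moment_rate s - q| <= eps) ->
  `|moment utt t2 - moment utt t1 - (t2 - t1) * q| <= eps * (t2 - t1).
Proof.
move=> t10 t12 t2S qeps; have [Mg gM] := exMg.
have subI : oc_itv t1 t2 `<=` oo_itv 0 S := oc_sub_I t10 t2S.
have moc := measurable_oc_itv t1 t2.
rewrite (weak_time_increment oO bO ST Liutt Liuttt kutt dutttt dg t10 t12 t2S).
have [iw _] := Linf_L2_integrable oO bO Liuttt.
have mD : measurable (oc_itv t1 t2 `*` Omega) by exact: measurableX.
have mI : measurable (oo_itv 0 S `*` Omega) by apply: measurableX => //; exact: measurable_oo_itv.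
have iwg : (leb \x mu)%E.-integrable (oc_itv t1 t2 `*` Omega) (EFin \o (fun z => uttt z.1 z.2 * g z.2)).
  apply: (@integrable_mul_bounded _ _ _ _ _ _ _ Mg) => //.
  - by apply: integrableS iw => // z [h1 h2]; split => //; exact: subI.
  - by apply: (measurable_comp (F := Omega)) => //; [move=> _ [z [? ?] <-]|exact: measurable_funTS].
  - by move=> z [_ Oz]; exact: gM.
have [iJ ->] := Rintegral_fubini1 moc mO iwg.
have lebE : fine (leb (oc_itv t1 t2)) = t2 - t1.
  by rewrite /oc_itv lebesgue_measure_itv/= lte_fin t12 -EFinB.
have icst (c : R) : leb.-integrable (oc_itv t1 t2) (EFin \o cst c).
  by apply: integrable_cst_real => //; exact: oc_itv_lty.
have iq := integrableB_real moc iJ (icst q).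
have -> : (t2 - t1) * q = \int[leb]_(s in oc_itv t1 t2) q by rewrite Rintegral_cst// lebE mulrC.
have -> : eps * (t2 - t1) = \int[leb]_(s in oc_itv t1 t2) eps by rewrite Rintegral_cst// lebE.
rewrite -RintegralB//; last exact: icst.
have mq : measurable_fun (oc_itv t1 t2) (fun s => moment uttt s - q).
  by apply/measurable_EFinP; exact: measurable_int iq.
have aq : {ae leb, forall s, oc_itv t1 t2 s -> `|moment uttt s - q| <= eps}.
  apply: (@filterS (measurableTypeR R) _ _ _ _ _ moment_pde) => s H hs.
  have Is : in_oo S s by have := subI s hs; rewrite /oo_itv/= in_itv.
  have [_ E] := H Is.
  have -> : moment uttt s = moment_rate s by rewrite /moment_rate -E mulKf// gt_eqF.
  by apply: qeps; move: hs; rewrite /oc_itv/= in_itv/= => /andP[h1 ->]; rewrite ltW.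
by have [_ h] := ae_integrable_le moc mq (icst eps) aq.
Qed.

(** The moment of utt is a time integral of the moment of uttt, which the
    equation identifies almost everywhere with a continuous function. *)
Lemma is_derive_moment2 t : in_oo S t -> is_derive t 1 (moment utt) (moment_rate t).
Proof.
move=> It; apply: (has_derivative_is_derive It) => eps e0; have tS := in_oo_cc It.
have [delta [d0 H]] := continuous_cc_rate tS e0; exists delta; split => // s Is std.
have sS := in_oo_cc Is.
have near r : Num.min s t <= r <= Num.max s t -> `|moment_rate r - moment_rate t| <= eps.
  rewrite ge_min le_max => /andP[h1 h2]; move: std; rewrite ltr_norml => /andP[h3 h4].
  move: sS tS => /andP[s0 s1] /andP[t0 t1].
  apply: H; first by apply/andP; case/orP : h1 => h1; case/orP : h2 => h2; split; lra.
  by rewrite ltr_norml; case/orP : h1 => h1; case/orP : h2 => h2; lra.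
move: It Is => /andP[t0 tS'] /andP[s0 sS'].
have [st|st|st] := ltgtP s t.
- have := @moment2_increment s t (moment_rate t) eps s0 st tS' => h.
  rewrite (_ : _ - _ - _ = - (moment utt t - moment utt s - (t - s) * moment_rate t)); last by ring.
  rewrite normrN [X in _ <= _ * X]distrC (@ger0_norm _ (t - s)); last by rewrite subr_ge0 ltW.
  apply: h => r hr; apply: near.
  by rewrite (min_l (ltW st)) (max_r (ltW st)).
- have := @moment2_increment t s (moment_rate t) eps t0 st sS'.
  rewrite (@ger0_norm _ (s - t)); last by rewrite subr_ge0 ltW.
  apply => r hr; apply: near.
  by rewrite (min_r (ltW st)) (max_l (ltW st)).
- by rewrite st !subrr normr0 mulr0 mul0r subrr normr0.
Qed.

End moments.

(** * The scalar system *)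

Section mean_value.
Context {R : realType} (S : R).

Lemma continuous_cc_within P r t : continuous_cc S P -> 0 <= r -> t <= S ->
  {within `[r, t], continuous P}.
Proof.
move=> cP r0 tS; apply/subspace_continuousP => x /=; rewrite in_itv/= => /andP[rx xt].
apply/cvgrPdist_le => eps e0.
have xS : in_cc S x by rewrite /in_cc (le_trans r0) // (le_trans xt).
have [d [d0 H]] := cP x xS eps e0.
suff : \forall s \near nbhs x, `[r, t]%classic s -> `|P x - P s| <= eps by [].
apply/nbhs_ballP; exists d => //= s; rewrite -ball_normE /= => xs.
rewrite in_itv/= => /andP[rs st]; rewrite distrC; apply: H; last by rewrite distrC.
by rewrite /in_cc (le_trans r0)// (le_trans st).
Qed.

Lemma mean_value_ge P q (r t m : R) : continuous_cc S P -> 0 <= r -> r <= t -> t <= S ->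
  (forall s, r < s < t -> is_derive s 1 P (q s)) -> (forall s, r < s < t -> m <= q s) ->
  m * (t - r) <= P t - P r.
Proof.
move=> cP r0 rt tS dP mq.
move: rt; rewrite le_eqVlt => /predU1P[<-|rt]; first by rewrite !subrr mulr0.
have dP' x : x \in `]r, t[ -> is_derive x 1 P (q x) by rewrite in_itv/=; exact: dP.
have [c] := @MVT R P q r t rt dP' (continuous_cc_within cP r0 tS).
rewrite in_itv/= => h ->; rewrite ler_wpM2r//; first by rewrite subr_ge0 ltW.
exact: mq.
Qed.

End mean_value.

Section scalar_system.
Context {R : realType} (S tau alpha lb lg c b : R) (f : R -> R).
Context (S0 : 0 < S) (tau0 : 0 < tau) (c0 : 0 < c) (b0 : 0 < b).
Context (Y0 Y1 Y2 F G H : R -> R).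
Context (cY0 : continuous_cc S Y0) (cY1 : continuous_cc S Y1) (cY2 : continuous_cc S Y2)
  (cF : continuous_cc S F) (cG : continuous_cc S G).
Context (dY0 : forall t, in_oo S t -> is_derive t 1 Y0 (Y1 t))
  (dY1 : forall t, in_oo S t -> is_derive t 1 Y1 (Y2 t))
  (dY2 : forall t, in_oo S t ->
    is_derive t 1 Y2 (tau^-1 * (H t - alpha * Y2 t - lb * Y1 t - lg * Y0 t)))
  (dF : forall t, in_oo S t -> is_derive t 1 F (G t))
  (dG : forall t, in_oo S t -> is_derive t 1 G (H t)).
Context (jensen : forall t, in_cc S t -> c * f (Y0 t / c) <= F t).

(** Bounds the coefficient with which the linear terms, integrated twice in time,
    can reduce the velocity. *)
Definition absorbed : R := `|alpha| + `|lb| * S + `|lg| * S ^+ 2.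

Context (fb : forall x, b <= x -> 2 * absorbed * x <= f x /\ 1 <= f x).
Context (init0 : c * b < Y0 0)
  (initF : 0 < tau * Y1 0 + alpha * Y0 0 - F 0)
  (initG : 0 < tau * Y2 0 + alpha * Y1 0 + lb * Y0 0 - G 0).

Let in_sub t s : in_cc S t -> 0 < s < t -> in_oo S s.
Proof. by move=> /andP[_ tS] /andP[h1 h2]; rewrite /in_oo h1 (lt_le_trans h2). Qed.

Lemma absorbed_ge0 : 0 <= absorbed.
Proof. by have S_ge0 := ltW S0; rewrite /absorbed !addr_ge0// mulr_ge0// exprn_ge0. Qed.

(** Two integrations of the third order system. The linear terms become time
    integrals of Y0, which the value Y0 t controls as long as it is the largest one
    and none is negative. *)
Lemma velocity_ge t : in_cc S t -> (forall s, 0 <= s <= t -> 0 <= Y0 s <= Y0 t) ->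
  tau * Y1 0 + alpha * Y0 0 - F 0 + F t - absorbed * Y0 t <= tau * Y1 t.
Proof.
move=> tS mono; have /andP[t0 tS'] := tS.
have tt : 0 <= t <= t by rewrite t0 lexx.
have Yt : 0 <= Y0 t by have /andP[] := mono t tt.
pose Z s := tau * Y2 s + alpha * Y1 s + lb * Y0 s - G s.
pose X s := tau * Y1 s + alpha * Y0 s - F s.
have cZ : continuous_cc S Z.
  have := continuous_cc_lin 1 1 (continuous_cc_lin tau alpha cY2 cY1) (continuous_cc_lin lb (-1) cY0 cG).
  by congr (continuous_cc S _); apply/funext => s; rewrite /Z; ring.
have cX : continuous_cc S X.
  have := continuous_cc_lin 1 (-1) (continuous_cc_lin tau alpha cY1 cY0) cF.
  by congr (continuous_cc S _); apply/funext => s; rewrite /X; ring.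
have dZ s : in_oo S s -> is_derive s 1 Z (- lg * Y0 s).
  move=> Is; have := dY0 Is; have := dY1 Is; have := dY2 Is; have := dG Is => h1 h2 h3 h4.
  rewrite (_ : - lg * Y0 s = tau *: (tau^-1 * (H s - alpha * Y2 s - lb * Y1 s - lg * Y0 s)) +
    alpha *: Y2 s + lb *: Y1 s - H s); last by rewrite /GRing.scale/= mulrA mulfV ?gt_eqF// mul1r; ring.
  exact: (is_deriveB (is_deriveD (is_deriveD (is_deriveZ tau h2) (is_deriveZ alpha h3)) (is_deriveZ lb h4)) h1).
have dX s : in_oo S s -> is_derive s 1 X (Z s - lb * Y0 s).
  move=> Is; have := dY0 Is; have := dY1 Is; have := dF Is => h1 h3 h4.
  rewrite (_ : Z s - _ = tau *: Y2 s + alpha *: Y1 s - G s); last by rewrite /Z /GRing.scale/=; ring.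
  exact: (is_deriveB (is_deriveD (is_deriveZ tau h3) (is_deriveZ alpha h4)) h1).
have Ys s : 0 <= s <= t -> forall a, - (`|a| * Y0 t) <= - a * Y0 s.
  move=> hs a; have /andP[h1 h2] := mono s hs.
  rewrite mulNr lerN2; apply: le_trans (ler_wpM2l (normr_ge0 a) h2).
  by rewrite ler_wpM2r// ler_norm.
have Zge r : 0 <= r <= t -> - (`|lg| * Y0 t * S) <= Z r.
  move=> /andP[r0 rt].
  have rS : r <= S by exact: le_trans tS'.
  have := @mean_value_ge R S Z (fun s => - lg * Y0 s) 0 r (- (`|lg| * Y0 t)) cZ (lexx _) r0 rS.
  rewrite subr0 mulNr; have dZ' s : 0 < s < r -> is_derive s 1 Z (- lg * Y0 s).
    by move=> hs; apply: dZ; apply: in_sub hs; rewrite /in_cc r0.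
  move=> /(_ dZ')h; have {}h : - (`|lg| * Y0 t * r) <= Z r - Z 0.
    apply: h => s /andP[s1 s2]; apply: Ys; rewrite ltW//=; apply: ltW; exact: lt_le_trans rt.
  have h1 : `|lg| * Y0 t * r <= `|lg| * Y0 t * S.
    by rewrite ler_wpM2l// ?mulr_ge0// (le_trans rt).
  have h2 : 0 < Z 0 := initG.
  lra.
have h := @mean_value_ge R S X (fun s => Z s - lb * Y0 s) 0 t (- (`|lg| * Y0 t * S + `|lb| * Y0 t)) cX (lexx _) t0 tS'
  (fun s hs => dX s (in_sub tS hs)).
have {}h : - (`|lg| * Y0 t * S + `|lb| * Y0 t) * t <= X t - X 0.
  rewrite subr0 in h; apply: h => s /andP[s1 s2]; have hs : 0 <= s <= t by rewrite !ltW.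
  have := Ys s hs lb; have := Zge s hs; lra.
have h1 : (`|lg| * Y0 t * S + `|lb| * Y0 t) * t <= (`|lg| * Y0 t * S + `|lb| * Y0 t) * S.
  by rewrite ler_wpM2l// addr_ge0// ?mulr_ge0// ltW.
have h2 : alpha * Y0 t <= `|alpha| * Y0 t by rewrite ler_wpM2r// ler_norm.
have E : absorbed * Y0 t = `|alpha| * Y0 t + (`|lg| * Y0 t * S + `|lb| * Y0 t) * S by rewrite /absorbed; ring.
rewrite E; move: h; rewrite /X; lra.
Qed.

(** By superlinearity of f the linear terms take up at most half of F t, and
    Jensen's inequality bounds the other half from below. *)
Lemma velocity_lower t : in_cc S t -> (forall s, 0 <= s <= t -> Y0 0 <= Y0 s <= Y0 t) ->
  0 < tau * Y1 t /\ c / 2 * f (Y0 t / c) <= tau * Y1 t.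
Proof.
move=> tS mono; have /andP[t0 _] := tS.
have tt : 0 <= t <= t by rewrite t0 lexx.
have cb : 0 < c * b by exact: mulr_gt0.
have pos s : 0 <= s <= t -> 0 <= Y0 s <= Y0 t.
  by move=> hs; have /andP[h1 ->] := mono s hs; rewrite andbT; apply: le_trans h1; rewrite ltW// (lt_trans cb).
have h := velocity_ge tS pos; have J := jensen tS.
have hb : b <= Y0 t / c.
  rewrite ler_pdivlMr// mulrC; apply: le_trans (ltW init0) _.
  by have /andP[] := mono t tt.
have [h1 h2] := fb hb.
have h3 : 2 * absorbed * Y0 t <= c * f (Y0 t / c).
  have := ler_wpM2l (ltW c0) h1; rewrite (_ : c * (2 * absorbed * (Y0 t / c)) = 2 * absorbed * Y0 t)//.
  by field; rewrite gt_eqF.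
have h4 : 0 < c * f (Y0 t / c) by rewrite mulr_gt0// (lt_le_trans ltr01).
rewrite (_ : c / 2 * f (Y0 t / c) = (c * f (Y0 t / c)) / 2); last by ring.
move: h3 h4 h J; rewrite -(mulrA 2) => h3 h4 h J.
have h5 := initF.
set q := absorbed * Y0 t in h3 h; set r := c * f (Y0 t / c) in h3 h4 J *.
by split; lra.
Qed.

Lemma nondecreasing_until t : t <= S -> (forall s, 0 < s < t -> 0 < Y1 s) ->
  forall r s, 0 <= r -> r <= s -> s <= t -> Y0 r <= Y0 s.
Proof.
move=> tS pos r s r0 rs st.
have := @mean_value_ge R S Y0 Y1 r s 0 cY0 r0 rs (le_trans st tS); rewrite mul0r subr_ge0.
apply=> z /andP[z1 z2]; first by apply: dY0; rewrite /in_oo (le_lt_trans r0)//= (lt_le_trans z2)// (le_trans st).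
by apply: ltW; apply: pos; rewrite (le_lt_trans r0)//= (lt_le_trans z2).
Qed.

(** The velocity cannot reach 0: up to a first such time
    the moment increases, and then the lower bound for the velocity is positive. *)
Lemma velocity_gt0 t : in_cc S t -> 0 < Y1 t.
Proof.
move=> tS; rewrite ltNge; apply/negP => Yt.
pose A := [set s | in_cc S s /\ Y1 s <= 0].
have At : A t by [].
have hA : has_inf A.
  by split; [exists t|exists 0 => s [/andP[]]].
pose m := inf A.
have mS : in_cc S m.
  apply/andP; split; first by apply: lb_le_inf; [exists t|move=> s [/andP[]]].
  by apply: le_trans (ge_inf hA.2 At) _; case/andP: tS.
have lem s : A s -> m <= s := ge_inf hA.2 (x := s).
have Ym : Y1 m <= 0.
  rewrite leNgt; apply/negP => Ym.
  have [d [d0 Hd]] := cY1 mS (divr_gt0 Ym (ltr0n _ 2)).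
  have [s As sd] := inf_adherent d0 hA.
  have sm : `|s - m| < d by rewrite ger0_norm ?subr_ge0 ?lem//; lra.
  have := Hd s As.1 sm; have := As.2; rewrite ler_norml; lra.
have pos s : 0 <= s -> s < m -> 0 < Y1 s.
  move=> s0 sm; rewrite ltNge; apply/negP => Ys.
  have As : A s by split => //; rewrite /in_cc s0 ltW// (lt_le_trans sm)//; case/andP: mS.
  by have := lem s As; rewrite leNgt sm.
have mS' : m <= S by case/andP: mS.
have nd := @nondecreasing_until m mS'.
have [|h _] := velocity_lower mS.
  move=> s /andP[s0 sm]; rewrite !nd//; by [move=> z /andP[z1 z2]; apply: pos => //; exact: ltW|].
by move: h; rewrite pmulr_rgt0// ltNge Ym.
Qed.

Lemma moment_mono s t : 0 <= s -> s <= t -> t <= S -> Y0 s <= Y0 t.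
Proof.
move=> s0 st tS; apply: (@nondecreasing_until t) => // z /andP[z0 zt].
by apply: velocity_gt0; rewrite /in_cc ltW//= (le_trans (ltW zt)).
Qed.

Lemma mean_gt t : in_cc S t -> b < Y0 t / c.
Proof.
move=> /andP[t0 tS]; rewrite ltr_pdivlMr// mulrC; apply: lt_le_trans init0 _.
exact: moment_mono.
Qed.

Lemma mean_velocity_ge t : in_cc S t -> f (Y0 t / c) / (2 * tau) <= Y1 t / c.
Proof.
move=> tS; have /andP[t0 tS'] := tS.
have [|_ h] := velocity_lower tS.
  by move=> s /andP[s0 st]; rewrite !moment_mono// (le_trans st).
rewrite -(ler_pM2l (mulr_gt0 c0 tau0)).
rewrite (_ : _ * (f _ / _) = c / 2 * f (Y0 t / c)); last by field; rewrite gt_eqF.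
rewrite (_ : _ * (Y1 t / c) = tau * Y1 t)//; first by field; rewrite gt_eqF.
Qed.

(** Osgood's criterion: along the mean, a primitive of 1/f grows at least linearly. *)
Lemma osgood_time (Phi : R -> R) (eps : R) :
  (forall y, b < y -> is_derive y 1 Phi (f y)^-1) ->
  (forall y z, b <= y -> b <= z -> Phi z - Phi y <= eps) -> S <= 4 * tau * eps.
Proof.
move=> dPhi Phib.
pose y s := Y0 s / c.
(* Y0 is known to be differentiable in the interior of the time interval only *)
have Spos := S0.
have hoo s : S / 4 <= s <= 3 * S / 4 -> in_oo S s.
  by move=> /andP[h1 h2]; rewrite /in_oo; apply/andP; split; lra.
have dy s : in_oo S s -> is_derive s 1 (Phi \o y) ((f (y s))^-1 * (Y1 s / c)).
  move=> Is; apply: is_derive1_comp; first by apply: dPhi; apply: mean_gt; exact: in_oo_cc.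
  rewrite mulrC /y (_ : (fun s => Y0 s / c) = c^-1 \*: Y0); last by apply/funext => z; rewrite mulrC.
  exact: (is_deriveZ c^-1 (dY0 Is)).
have lt : S / 4 < 3 * S / 4 by lra.
have cont : {within `[S / 4, 3 * S / 4], continuous (Phi \o y)}.
  apply: derivable_within_continuous => s; rewrite in_itv/= => hs.
  by have [] := dy s (hoo s hs).
have dy' z : z \in `]S / 4, 3 * S / 4[ -> is_derive z 1 (Phi \o y) ((f (y z))^-1 * (Y1 z / c)).
  by rewrite in_itv/= => /andP[h1 h2]; apply: dy; apply: hoo; rewrite !ltW.
have [z] := @MVT R (Phi \o y) _ _ _ lt dy' cont.
rewrite in_itv/= => /andP[/ltW h1 /ltW h2] E.
have zS : in_cc S z by apply: in_oo_cc; apply: hoo; rewrite h1.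
have hy s : S / 4 <= s <= 3 * S / 4 -> b <= y s.
  by move=> hs; apply: ltW; apply: mean_gt; apply: in_oo_cc; exact: hoo.
have := Phib (y (S / 4)) (y (3 * S / 4)) (hy _ _) (hy _ _).
have [_ f1] := fb (ltW (mean_gt zS)).
have fy : 0 < f (y z) by apply: lt_le_trans f1.
have h3 : (2 * tau)^-1 <= (f (y z))^-1 * (Y1 z / c).
  by rewrite ler_pdivlMl//; exact: mean_velocity_ge.
have {}E : Phi (y (3 * S / 4)) - Phi (y (S / 4)) = (f (y z))^-1 * (Y1 z / c) * (3 * S / 4 - S / 4) by exact: E.
rewrite E => h4; have {}h4 : (f (y z))^-1 * (Y1 z / c) * (3 * S / 4 - S / 4) <= eps by apply: h4; lra.
have h5 : (2 * tau)^-1 * (S / 2) <= eps.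
  apply: le_trans h4; rewrite (_ : 3 * S / 4 - S / 4 = S / 2); last by field.
  by rewrite ler_wpM2r// divr_ge0// ltW.
move: h5; rewrite ler_pdivrMl ?mulr_gt0// => h5; lra.
Qed.

End scalar_system.

Section osgood.
Context {R : realType} (f : R -> R).
Local Notation leb := (@lebesgue_measure R).

(** As 1/f is integrable at infinity, its integral beyond a distant point b is
    small. *)
Lemma osgood_primitive (a eps : R) : continuous f -> (forall x, a <= x -> 1 <= f x) ->
  leb.-integrable `[a, +oo[ (fun x => ((f x)^-1)%:E) -> 0 < eps ->
  exists (Phi : R -> R) (b : R), [/\ a <= b, forall y, b < y -> is_derive y 1 Phi (f y)^-1 &
    forall y z, b <= y -> b <= z -> Phi z - Phi y <= eps].
Proof.
move=> cf f1 intf e0.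
(* equal to 1/f on [a, +oo[, and continuous on the whole line *)
pose h x := (Num.max (f x) 1)^-1.
have hE x : a <= x -> h x = (f x)^-1 by move=> ax; rewrite /h max_l// f1.
have h0 x : 0 <= h x by rewrite invr_ge0 le_max ler01 orbT.
have ch : continuous h.
  move=> x; apply: cvgV; first by rewrite gt_eqF// lt_max ltr01 orbT.
  apply: continuous_max; [exact: cf|exact: cvg_cst].
pose J y := \int[leb]_(x in `[a, +oo[) ((x <= y)%R%:R * h x).
have mh : measurable_fun setT h by exact: continuous_measurable_fun.
have mJ (y : R) : measurable_fun `[a, +oo[ (fun x : R => (x <= y)%R%:R * h x).
  apply: measurable_funM; last exact: measurable_funTS.
  rewrite (_ : (fun x : R => _) = \1_(`]-oo, y]%classic : set R)); first exact: measurable_indic.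
  apply/funext => x; rewrite indicE; congr (_%:R); congr nat_of_bool.
  by apply/idP/idP => [xy|/set_mem/=]; [apply/mem_set; rewrite /= in_itv|rewrite in_itv].
have hf x : `[a, +oo[%classic x -> h x = (f x)^-1 by rewrite /= in_itv/= andbT; exact: hE.
have Jh y x : `|(x <= y)%R%:R * h x| <= h x.
  by case: (x <= y); rewrite ?mul1r ?mul0r ?normr0// ger0_norm.
have ih : leb.-integrable `[a, +oo[ (EFin \o h).
  by apply: eq_integrable intf => // x /set_mem xa /=; rewrite hf.
have iJ y : leb.-integrable `[a, +oo[ (EFin \o (fun x => (x <= y)%R%:R * h x)).
  apply: (@le_integrable_real _ _ _ leb `[a, +oo[ (fun x => (x <= y)%R%:R * h x) h) => //.
  exact: mJ.
have JE y : J y = \int[leb]_(x in `[a, y]) h x.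
  rewrite /J Rintegral_mkcond [RHS]Rintegral_mkcond; congr Rintegral; apply/funext => x.
  rewrite !patchE; case: ifPn => [/set_mem|/negP hx].
    rewrite /= in_itv/= andbT => ax; have [xy|xy] := leP x y.
      by rewrite mul1r mem_set//= in_itv/= ax.
    by rewrite mul0r memNset//= in_itv/= [x <= y]leNgt xy andbF.
  rewrite memNset//= in_itv/=; apply/negP; apply: contra_notN hx => /andP[ax _].
  by apply/mem_set; rewrite /= in_itv/= ax.
have dJ y : a < y -> is_derive y 1 J (f y)^-1.
  move=> ay; have y1 : y < y + 1 by lra.
  have ihy : leb.-integrable `[a, y + 1] (EFin \o h).
    apply: integrableS ih => // x; rewrite /= !in_itv/= andbT => /andP[]//.
  have [d] := @continuous_FTC1_closed R h a y (y + 1) y1 ihy ay (@ch y).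
  rewrite (_ : (fun x => _) = J) in d *; last by apply/funext => x; rewrite JE.
  rewrite hE ?(ltW ay)// => E.
  by apply: DeriveDef; [exact: d|rewrite -derive1E; exact: E].
pose L := \int[leb]_(x in `[a, +oo[) h x.
have JL y : J y <= L.
  by apply: le_Rintegral => // x _; apply: le_trans (ler_norm _) _; exact: Jh.
have Jnd y z : y <= z -> J y <= J z.
  move=> yz; apply: le_Rintegral => // x _; rewrite ler_wpM2r// ler_nat.
  by have [xy|//] := leP x y; rewrite (le_trans xy).
have cJ : (fun k : nat => J k%:R) @ \oo --> L.
  apply: (@Rintegral_cvg _ _ _ leb `[a, +oo[ (fun k x => (x <= k%:R)%R%:R * h x) h h) => //.
    by move=> k; exact: mJ.
  move=> x _; apply: cvg_near_cst; near=> k; rewrite (_ : x <= k%:R) ?mul1r//.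
  by near: k; exact: nbhs_infty_ger.
have [k [ka Lk]] : exists k : nat, a <= k%:R /\ L - J k%:R <= eps.
  have h1 : \forall k \near \oo, `|L - J k%:R| <= eps by move/cvgrPdist_le : cJ; apply.
  near \oo => k; exists k; split; first by near: k; exact: nbhs_infty_ger.
  by apply: le_trans (ler_norm _) _; near: k.
exists J, k%:R; split => // [y ky|y z ky _]; first by apply: dJ; exact: le_lt_trans ky.
have := JL z; have := Jnd _ _ ky; lra.
Unshelve. all: by end_near. Qed.
End osgood.

(** * Blow-up *)

Section blow_up.
Context {R : realType} {n : nat}.
Local Notation V := 'rV[R]_n.
Local Notation mu := (@lebesgue_rV R n).
Local Notation leb := (@lebesgue_measure R).
Context (Omega : set V) (oO : open Omega) (bO : bounded_set Omega).
Context (e : nat -> V -> R) (lambda : nat -> R) (eig : dirichlet_eigensystem Omega e lambda).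
Context (tau alpha beta gamma : R) (f : R -> R) (tau0 : 0 < tau) (C3f : C3 f).
Context (f''_ge0 : forall x, 0 <= derive1n 2 f x).

Let mO : measurable Omega := open_measurable_rV oO.
Let fO : (mu Omega < +oo)%E := bounded_lebesgue_lty mO bO.
Let g := e 0%N.

Let dg : dirichlet_smooth Omega g.
Proof. exact: (dirichlet_smooth_eigen eig 0%N). Qed.

Let mg : measurable_fun Omega g.
Proof. exact: (dirichlet_smooth_measurable oO [::] dg erefl). Qed.

Let exMg : exists Mg : R, forall x, Omega x -> `|g x| <= Mg.
Proof. exact: (smooth_closure_bounded bO [::] dg.1). Qed.

Let ig : mu.-integrable Omega (EFin \o g).
Proof. by have [Mg gM] := exMg; exact: bounded_integrable gM. Qed.

Let g_gt0 x : Omega x -> 0 < g x.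
Proof. by case: eig => _ _ _ _; apply. Qed.

Definition eigen_mass : R := \int[mu]_(x in Omega) g x.

(** The normalization of e 0 gives 1 = int e0^2 <= max e0 * int e0. *)
Lemma eigen_mass_gt0 : 0 < eigen_mass.
Proof.
have [_ _ on _ _] := eig; have := on 0%N 0%N; rewrite eqxx -/g => g2.
have [Mg gM] := exMg.
have ig2 : mu.-integrable Omega (EFin \o (fun x => g x * g x)) := integrable_mul_bounded mO ig mg gM.
have igM : mu.-integrable Omega (EFin \o (fun x => `|Mg| * g x)).
  exact: (integrableZl_real `|Mg| mO ig).
have h : 1 <= `|Mg| * eigen_mass.
  rewrite -[leLHS]g2 /eigen_mass -RintegralZl//; apply: le_Rintegral => // x Ox.
  apply: ler_wpM2r; first by rewrite ltW// g_gt0.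
  apply: le_trans (ler_norm _) _.
  by apply: le_trans (gM x Ox) _; exact: ler_norm.
rewrite ltNge; apply/negP => m0; have : `|Mg| * eigen_mass <= 0 by rewrite mulr_ge0_le0.
lra.
Qed.

(** Jensen's inequality, by integrating the tangent of f at the mean. *)
Lemma jensen_eigen (p : V -> R) : mu.-integrable Omega (EFin \o p) ->
  mu.-integrable Omega (EFin \o (fun x => f (p x))) ->
  eigen_mass * f ((\int[mu]_(x in Omega) (p x * g x)) / eigen_mass) <=
  \int[mu]_(x in Omega) (f (p x) * g x).
Proof.
move=> ip ifp; have c0 := eigen_mass_gt0; have [Mg gM] := exMg.
set y := \int[mu]_(x in Omega) (p x * g x); pose m := y / eigen_mass.
have ipg := integrable_mul_bounded mO ip mg gM.
have ifg := integrable_mul_bounded mO ifp mg gM.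
have [i1 J1] := Rintegral_lin (derive1 f m) (f m - derive1 f m * m) mO ipg ig.
rewrite (_ : _ * f _ = derive1 f m * y + (f m - derive1 f m * m) * eigen_mass); last first.
  have -> : y = m * eigen_mass by rewrite /m divfK// gt_eqF.
  by rewrite mulfK ?gt_eqF//; ring.
rewrite -[leLHS]J1; apply: le_Rintegral => // x Ox.
have h := convex_tangent C3f f''_ge0 m (p x); have g0 := g_gt0 Ox.
rewrite (_ : _ + _ = (f m + derive1 f m * (p x - m)) * g x); last by ring.
by rewrite ler_wpM2r// ltW.
Qed.

Local Notation lb := (lambda 0%N * beta).
Local Notation lg := (lambda 0%N * gamma).

(** The moments of u, of its first two time derivatives, of f(u) and of its time
    derivative satisfy the scalar system, with initial values given by the data. *)
Lemma existence_time_le (S : R) (T : \bar R) (u0 u1 u2 : V -> R) (u : R -> V -> R)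
    (b eps : R) (Phi : R -> R) : 0 < S -> (S%:E < T)%E ->
  strong_solution Omega tau alpha beta gamma f u0 u1 u2 T u ->
  L2 Omega u0 -> L2 Omega u1 -> L2 Omega u2 -> 0 < b ->
  (forall x, b <= x -> 2 * absorbed S alpha lb lg * x <= f x /\ 1 <= f x) ->
  (forall y, b < y -> is_derive y 1 Phi (f y)^-1) ->
  (forall y z, b <= y -> b <= z -> Phi z - Phi y <= eps) ->
  let y0 := \int[mu]_(x in Omega) (u0 x * g x) in
  let y1 := \int[mu]_(x in Omega) (u1 x * g x) in
  let y2 := \int[mu]_(x in Omega) (u2 x * g x) in
  eigen_mass * b < y0 ->
  0 < tau * y1 + alpha * y0 - \int[mu]_(x in Omega) (f (u0 x) * g x) ->
  0 < tau * y2 + alpha * y1 + lb * y0 -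
    \int[mu]_(x in Omega) (derive1 f (u0 x) * u1 x * g x) ->
  S <= 4 * tau * eps.
Proof.
move=> S0 ST [ut [utt [uttt [Lu [Lut]]]]] [[duut dututt dutttt] [cu cut Lu2 Lut2]
  [cutt Lutt1 Luttt] init [LuE LutE pde]] L0 L1 L2' b0 fb dPhi Phib y0 y1 y2 h0 hF hG.
have tS0 : in_cc S 0 by rewrite /in_cc lexx ltW.
have su := sobolev0C_C0_sup bO ST cu; have sut := sobolev0C_C0_sup bO ST cut.
have ku := sobolev0C_C0_L1 oO bO ST cu; have kut := sobolev0C_C0_L1 oO bO ST cut.
have kutt := L2_C0_L1 oO bO ST cutt.
have cf := C3_continuous C3f; have cf1 := C3_continuous1 C3f.
have comp (h : R -> R) w : continuous h -> measurable_fun Omega w -> measurable_fun Omega (fun x => h (w x)).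
  by move=> ch mw; apply: (measurableT_comp _ mw); exact: continuous_measurable_fun.
have m0 := (ku.1 0 tS0).1; have m1 := (kut.1 0 tS0).1; have m2 := (kutt.1 0 tS0).1.
have E0 : moment Omega e u 0 = y0.
  apply: ae_eq_Rintegral_real => //; [exact: measurable_funM|exact: measurable_funM L0.1 mg|].
  by apply: filterS init => x H Ox; have [-> _ _] := H Ox.
have E1 : moment Omega e ut 0 = y1.
  apply: ae_eq_Rintegral_real => //; [exact: measurable_funM|exact: measurable_funM L1.1 mg|].
  by apply: filterS init => x H Ox; have [_ -> _] := H Ox.
have E2 : moment Omega e utt 0 = y2.
  apply: ae_eq_Rintegral_real => //; [exact: measurable_funM|exact: measurable_funM L2'.1 mg|].
  by apply: filterS init => x H Ox; have [_ _ ->] := H Ox.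
have EF : moment Omega e (fun t x => f (u t x)) 0 = \int[mu]_(x in Omega) (f (u0 x) * g x).
  apply: ae_eq_Rintegral_real => //.
  - by apply: measurable_funM => //; exact: comp.
  - by apply: measurable_funM => //; apply: comp => //; exact: L0.1.
  - by apply: filterS init => x H Ox; have [-> _ _] := H Ox.
have EG : moment Omega e (fun t x => derive1 f (u t x) * ut t x) 0 =
    \int[mu]_(x in Omega) (derive1 f (u0 x) * u1 x * g x).
  apply: ae_eq_Rintegral_real => //.
  - by apply: measurable_funM => //; apply: measurable_funM => //; exact: comp.
  - by apply: measurable_funM => //; apply: measurable_funM L1.1; apply: comp => //; exact: L0.1.
  - by apply: filterS init => x H Ox; have [-> -> _] := H Ox.
have kc w : C0_int Omega S w -> continuous_cc S (moment Omega e w).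
  by exact: (C0_int_moment oO bO eig).
have isu := C0_sup_int mO fO su.
have isf := C0_sup_int mO fO (C0_sup_f C3f su).
have isf1 := C0_sup_int mO fO (C0_sup_f1 C3f su sut).
rewrite -E0 -E1 -E2 -EF -EG in h0 hF hG.
apply: (osgood_time S0 tau0 eigen_mass_gt0 b0 (kc _ isu) (kc _ kut.2)
  (kc _ kutt.2) (kc _ isf) (kc _ isf1) _ _ _ _ _ _ fb h0 hF hG dPhi Phib).
- exact (is_derive_moment0 oO bO S0 ST eig duut cu cut Lu2 Lut2).
- exact (is_derive_moment1 oO bO S0 ST eig dututt cut Lut2 cutt Lutt1).
- exact (is_derive_moment2 oO bO S0 ST eig tau0 C3f dutttt cu cut Lu2 Lut2 cutt Lutt1 Luttt LuE LutE pde).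
- exact (is_derive_moment_f oO bO S0 ST eig C3f duut cu cut Lu2 Lut2).
- exact (is_derive_moment_f1 oO bO S0 ST eig C3f duut dututt cu cut Lu2 Lut2 cutt Lutt1).
- by move=> t tS; apply: jensen_eigen; [exact: isu.1|exact: isf.1].
Qed.

Lemma superlinear_ge (A a : R) : 0 <= A -> f xi / xi @[xi --> +oo] --> +oo ->
  exists b, [/\ a <= b, 1 <= b & forall x, b <= x -> A * x <= f x /\ 1 <= f x].
Proof.
move=> A0 /cvgryPge /(_ (A + 1))[M [_ fM]].
exists (Num.max (Num.max a 1) (M + 1)); split.
- by rewrite !le_max lexx.
- by rewrite !le_max lexx orbT.
move=> x; rewrite !ge_max => /andP[/andP[_ x1] xM].
have x0 : 0 < x by apply: lt_le_trans x1.
have := fM x; rewrite ler_pdivlMr// => /(_ _)h.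
have {}h : (A + 1) * x <= f x by apply: h; lra.
have Ax : 0 <= A * x by rewrite mulr_ge0// ltW.
by split; lra.
Qed.

End blow_up.

Theorem theorem1p2 (R : realType) (n : nat) (Omega : set 'rV[R]_n)
    (e : nat -> 'rV[R]_n -> R) (lambda : nat -> R)
    (tau alpha beta gamma : R) (f : R -> R) :
  (0 < n <= 3)%N ->
  smooth_bounded_domain Omega ->
  dirichlet_eigensystem Omega e lambda ->
  0 < tau -> 0 < beta -> 0 < gamma ->
  C3 f -> f 0 = 0 ->
  (forall xi, 0 <= derive1n 2 f xi) ->
  f xi / xi @[xi --> +oo] --> +oo ->
  (exists xi0 : R, 0 < xi0 /\
    (@lebesgue_measure R).-integrable `[xi0, +oo[ (fun xi => ((f xi)^-1)%:E)) ->
  forall T0 : R, 0 < T0 ->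
  exists K0 : R, 0 < K0 /\
  forall u0 : 'rV[R]_n -> R,
    sobolev Omega 4 u0 -> sobolev0 Omega u0 ->
    K0 < \int[lebesgue_rV n]_(x in Omega) (u0 x * e 0%N x) ->
  exists K1 : R, 0 < K1 /\
  forall u1 : 'rV[R]_n -> R,
    sobolev Omega 2 u1 -> sobolev0 Omega u1 ->
    K1 < \int[lebesgue_rV n]_(x in Omega) (u1 x * e 0%N x) ->
  exists K2 : R, 0 < K2 /\
  forall u2 : 'rV[R]_n -> R,
    sobolev Omega 2 u2 -> sobolev0 Omega u2 ->
    K2 < \int[lebesgue_rV n]_(x in Omega) (u2 x * e 0%N x) ->
  forall (Tmax : \bar R) (u : R -> 'rV[R]_n -> R),
    maximal_strong_solution Omega tau alpha beta gamma f u0 u1 u2 Tmax u ->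
    (Tmax <= T0%:E)%E /\ blows_up_at Omega u (fine Tmax).
Proof.
move=> _ [oO _ _ bO _] eig tau0 _ _ C3f _ f''0 superlin [xi0 [_ intf]] T0 T0_gt0.
pose lb := lambda 0%N * beta; pose lg := lambda 0%N * gamma.
pose A := 2 * absorbed T0 alpha lb lg.
have A0 : 0 <= A by rewrite mulr_ge0// absorbed_ge0.
have [a [axi0 a1 fa]] := superlinear_ge xi0 A0 superlin.
have intfa : (@lebesgue_measure R).-integrable `[a, +oo[ (fun xi => ((f xi)^-1)%:E).
  by apply: integrableS intf => // x; rewrite /= !in_itv/= !andbT; exact: le_trans.
(* with this growth of Phi, existence up to T0 implies T0 <= T0 / 2 *)
have eps0 : 0 < T0 / (8 * tau) by rewrite divr_gt0// mulr_gt0.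
have [Phi [b [ab dPhi Phib]]] := osgood_primitive (C3_continuous C3f) (fun x ax => (fa x ax).2) intfa eps0.
have b0 : 0 < b by rewrite (lt_le_trans ltr01)// (le_trans a1).
have c0 : 0 < eigen_mass Omega e := eigen_mass_gt0 oO bO eig.
exists (eigen_mass Omega e * b); split; first exact: mulr_gt0.
move=> u0 su0 _ hK0.
set y0 := Rintegral _ _ _ in hK0.
pose F0 := \int[lebesgue_rV n]_(x in Omega) (f (u0 x) * e 0%N x).
have K_gt0 (p : R) : 0 <= p -> 0 < 1 + p / tau by move=> p0; rewrite ltr_wpDr// divr_ge0// ltW.
have Ktau (p y : R) : 1 + p / tau < y -> p < tau * y.
  move=> h; have : p / tau < y by lra.
  by rewrite ltr_pdivrMr// mulrC.
(* K1 and K2 make the two constants of integration positive *)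
exists (1 + (`|alpha * y0| + `|F0|) / tau); split; first by apply: K_gt0; rewrite addr_ge0.
move=> u1 su1 _; set y1 := Rintegral _ _ _ => /Ktau hK1.
pose G0 := \int[lebesgue_rV n]_(x in Omega) (derive1 f (u0 x) * u1 x * e 0%N x).
exists (1 + (`|alpha * y1| + `|lb * y0| + `|G0|) / tau); split; first by apply: K_gt0; rewrite !addr_ge0.
move=> u2 su2 _; set y2 := Rintegral _ _ _ => /Ktau hK2.
move=> Tmax u [Tpos sol blow].
have le_T0 : (Tmax <= T0%:E)%E.
  rewrite leNgt; apply/negP => TT.
  have hF : 0 < tau * y1 + alpha * y0 - F0.
    have := ler_norm (- (alpha * y0)); rewrite normrN; have := ler_norm F0; lra.
  have hG : 0 < tau * y2 + alpha * y1 + lb * y0 - G0.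
    have := ler_norm (- (alpha * y1)); have := ler_norm (- (lb * y0)); rewrite !normrN; have := ler_norm G0; lra.
  have := existence_time_le oO bO eig tau0 C3f f''0 T0_gt0 TT sol su0.1 su1.1 su2.1 b0
    (fun x bx => fa x (le_trans ab bx)) dPhi Phib hK0 hF hG.
  rewrite (_ : 4 * tau * (T0 / (8 * tau)) = T0 / 2); last by field; rewrite gt_eqF.
  lra.
split=> //; apply: blow; apply: le_lt_trans le_T0 _; exact: ltry.
Qed.
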